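(* Let $\mathcal W$ be a real-valued even tempered distribution on $\mathbb R$ with $\widehat{\mathcal W}\in L^\infty(\mathbb R)$. Let $c\ge0$, and let $u\in\mathcal E(\mathbb R)$ be a solution to $$icu'+u''+u\,\bigl(\mathcal W*(1-|u|^2)\bigr)=0\quad\text{in }\mathbb R.$$ Set $M_c(\xi)=\xi^2+2\widehat{\mathcal W}(\xi)-c^2$, assume that $M_c>0$ a.e. on $\mathbb R$ and that $1/M_c$ defines a tempered distribution, and let $\mathcal L_c$ be the tempered distribution with $\widehat{\mathcal L_c}=1/M_c$. Suppose that $$e^{m|\cdot|}\mathcal L_c\in L^p(\mathbb R)\quad\text{for some } m>0,\ p\in(1,\infty].$$ Then, for all $\ell\in[0,m)$, the function $\eta=1-|u|^2$ satisfies $$\lim_{|x|\to\infty}e^{\ell|x|}D^k\eta(x)=0\quad\text{for all }k\in\mathbb N.$$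
   Context: Fourier transform convention: $\widehat f(\xi)=\int_{\mathbb R}e^{-ix\xi}f(x)\,dx$. For $f\in L^2(\mathbb R)$, $\mathcal W*f\in L^2(\mathbb R)$ is defined by $\widehat{\mathcal W*f}=\widehat{\mathcal W}\,\widehat f$. The energy space is $\mathcal E(\mathbb R)=\{v\in H^1_{\rm loc}(\mathbb R;\mathbb C): 1-|v|^2\in L^2(\mathbb R),\ v'\in L^2(\mathbb R)\}$. The equation is understood in the sense of distributions; every solution in $\mathcal E(\mathbb R)$ is in fact of class $C^\infty$. $D^k$ denotes the $k$-th derivative and $\mathbb N$ includes $0$. *)

(* Defs.v *)
From HB Require Import structures.
From mathcomp Require Import all_boot all_order all_algebra complex.
From mathcomp Require Import all_classical all_reals all_analysis.

Set Implicit Arguments.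
Unset Strict Implicit.
Unset Printing Implicit Defensive.
Import Order.TTheory GRing.Theory Num.Theory.
Import numFieldNormedType.Exports.
Local Open Scope classical_set_scope.
Local Open Scope ring_scope.
Local Open Scope complex_scope.

Section ComplexFunctions.
Variable R : realType.
Local Notation mu := (@lebesgue_measure R).
Implicit Types (f g : R -> R[i]) (x : R).

Definition re f x : R := complex.Re (f x).
Definition im f x : R := complex.Im (f x).

(* The modulus as an element of R; `|f x| would live in R[i]. *)
Definition cabs f x : R := Normc.normc (f x).

Definition cexpi (t : R) : R[i] := cos t +i* sin t.

(* k-th derivative, taken componentwise. *)
Definition cderiv (k : nat) f x : R[i] :=
  derive1n k (re f) x +i* derive1n k (im f) x.

Definition smooth f := forall k x,
  derivable (derive1n k (re f)) x 1 /\ derivable (derive1n k (im f)) x 1.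

Definition cmeasurable f :=
  measurable_fun setT (re f) /\ measurable_fun setT (im f).

Definition cintegrable f :=
  mu.-integrable setT (EFin \o re f) /\ mu.-integrable setT (EFin \o im f).

Definition cint f : R[i] :=
  Rintegral mu setT (re f) +i* Rintegral mu setT (im f).

(* Membership in L^p(R; C) of a function (not a class). Measurability is with
   respect to Borel sets; every L^p class has a Borel representative. *)
Definition in_Lp (p : \bar R) f :=
  cmeasurable f /\ ('N[mu]_p[EFin \o cabs f] < +oo)%E.

Definition in_L2loc f :=
  cmeasurable f /\ forall K : set R, compact K ->
    (\int[mu]_(x in K) ((cabs f x) ^+ 2)%:E < +oo)%E.

Definition test_function f :=
  smooth f /\ exists B : R, forall x, B < `|x| -> f x = 0.

End ComplexFunctions.

Section Distributions.
Variable R : realType.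
Local Notation mu := (@lebesgue_measure R).
Implicit Types (f g phi psi : R -> R[i]).

Definition schwartz phi :=
  smooth phi /\ forall j k : nat, exists B : R, forall x,
    `|x| ^+ j * cabs (cderiv k phi) x <= B.

Definition schwartz_seminorm (j k : nat) phi : R :=
  sup (range (fun x : R => `|x| ^+ j * cabs (cderiv k phi) x)).

(* Only the values on Schwartz functions are meaningful. *)
Definition distribution_on_schwartz := (R -> R[i]) -> R[i].
Implicit Types T : distribution_on_schwartz.

Definition tempered T :=
  (forall (a : R[i]) phi psi, schwartz phi -> schwartz psi ->
     T (fun x => a * phi x + psi x) = a * T phi + T psi) /\
  (exists (C : R) (N : nat), forall phi, schwartz phi ->
     Normc.normc (T phi) <=
       C * \sum_(j < N.+1) \sum_(k < N.+1) schwartz_seminorm j k phi).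

Definition real_valued_dist T := forall phi, schwartz phi ->
  (forall x, complex.Im (phi x) = 0) -> complex.Im (T phi) = 0.

Definition even_dist T := forall phi, schwartz phi ->
  T (fun x => phi (- x)) = T phi.

Definition fourier phi (xi : R) : R[i] :=
  cint (fun x => cexpi (- (x * xi)) * phi x).

Definition fourier_dist T : distribution_on_schwartz :=
  fun phi => T (fourier phi).

Definition dist_of f : distribution_on_schwartz :=
  fun phi => cint (fun x => f x * phi x).

(* The tempered distribution T is given by integration against f, with
   absolutely convergent integrals. *)
Definition is_function T f :=
  cmeasurable f /\ forall phi, schwartz phi ->
    cintegrable (fun x => f x * phi x) /\ T phi = dist_of f phi.

Definition defines_tempered f := exists T, tempered T /\ is_function T f.

(* The Plancherel extension of the Fourier transform to L^2, characterised by
   duality with Schwartz functions: int F phi = int f fourier(phi). *)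
Definition is_fourier_L2 f F :=
  [/\ in_Lp 2%:E f, in_Lp 2%:E F & is_function (fourier_dist (dist_of f)) F].

(* h = W * f, for f in L^2 and a tempered W whose Fourier transform is in
   L^oo; h is unique up to a null set. *)
Definition is_convolution (W : distribution_on_schwartz) f h :=
  exists What F, [/\ in_Lp +oo What, is_function (fourier_dist W) What,
    is_fourier_L2 f F & is_fourier_L2 h (fun xi => What xi * F xi)].

End Distributions.

Section Equation.
Variable R : realType.
Implicit Types (u v : R -> R[i]).

Definition weak_derivative u v := forall phi, test_function phi ->
  cint (fun x => u x * cderiv 1 phi x) = - cint (fun x => v x * phi x).

Definition in_H1loc u := in_L2loc u /\
  exists v, in_L2loc v /\ weak_derivative u v.

Definition eta_of u (x : R) : R := 1 - (cabs u x) ^+ 2.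

Definition energy_space u :=
  [/\ in_H1loc u, in_Lp 2%:E (fun x => (eta_of u x)%:C) &
      exists v, [/\ in_L2loc v, weak_derivative u v & in_Lp 2%:E v]].

(* i c u' + u'' + u (W * (1 - |u|^2)) = 0 tested against phi, the derivatives
   of u being moved onto phi. *)
Definition solution (W : distribution_on_schwartz R) (c : R) u :=
  exists h, is_convolution W (fun x => (eta_of u x)%:C) h /\
    forall phi, test_function phi ->
      - (0 +i* c) * cint (fun x => u x * cderiv 1 phi x)
      + cint (fun x => u x * cderiv 2 phi x)
      + cint (fun x => u x * h x * phi x) = 0.

(* The order of R[i] is partial: 0 < z means that z is real and positive, so
   0 < Mc What c xi also asserts that What xi is real. *)
Definition Mc (What : R -> R[i]) (c xi : R) : R[i] :=
  (xi ^+ 2)%:C + 2 * What xi - (c ^+ 2)%:C.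

End Equation.

(* Main.v *)
(* Write u = A + iB, eta = 1 - |u|^2 and h = W * eta. Then
   -eta'' - c^2 eta + 2h = G with G = 2|u'|^2 + 2 eta h, and conservation of angular
   momentum gives (1 - eta)|u'|^2 = (eta'^2 + c^2 eta^2)/4. On the Fourier side
   M_c * eta^ = G^. A bootstrap on the decay of eta^ shows that eta and h have
   bounded derivatives of all orders, so eta and its derivatives vanish at infinity
   and G is there small compared with sup |eta| over |y| >= |x|. Since
   eta = L_c * G with exp(l|x|) L_c integrable for l < m, a weighted sup norm of eta
   absorbs the right-hand side, so eta = O(exp(-l|x|)). Landau's inequality then
   transfers the rate to the derivatives. *)
Require Import Defs.
From HB Require Import structures.
From mathcomp Require Import all_boot all_order all_algebra complex.
From mathcomp Require Import all_classical all_reals all_analysis.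
From mathcomp Require Import measurable_realfun ess_sup_inf.
From mathcomp Require Import ring lra.

Set Implicit Arguments.
Unset Strict Implicit.
Unset Printing Implicit Defensive.
Import Order.TTheory GRing.Theory Num.Theory.
Import numFieldNormedType.Exports.
Local Open Scope classical_set_scope.
Local Open Scope ring_scope.
Local Open Scope complex_scope.

(** * Lebesgue integration on the line *)

Section LineIntegral.
Variable R : realType.
Local Notation mu := (@lebesgue_measure R).
Local Notation meas := (measurable_fun [set: R]).
Implicit Types (f g : R -> R).

(** The symbol of [W] is merely bounded: it acts on [L2], but in general neither on bounded nor on
    continuous functions. Regularity is therefore tracked on the Fourier side, in weighted [L1]
    spaces, which the symbol preserves and which, being convolution algebras, are also stable under
    products of functions. All data are classes modulo null sets and the equation is weak.
    Identities between transforms are proved by pairing with Gaussians, whose transforms are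
    explicit. Real functions suffice: the symbol is real and even almost everywhere, so [h] is real
    and only the even part of the real part of the kernel counts. Two losses shape the decay
    argument. The source contains [eta'^2], which no power of [eta] bounds pointwise; on a tail it
    is controlled by [sup |eta|] times [sup |eta''|], so [eta''] must first be shown to vanish at
    infinity. And Landau's inequality with a bounded second derivative passes on only half of the
    rate; interpolating repeatedly recovers every rate below [m], since the range of admissible
    rates is open. *)

Definition L1 f := mu.-integrable setT (EFin \o f).
Definition Int f : R := Rintegral mu setT f.

Lemma L1_meas f : L1 f -> meas f.
Proof. by move=> /integrableP[/measurable_EFinP]. Qed.

Lemma L1D f g : L1 f -> L1 g -> L1 (fun x => f x + g x).
Proof. by move=> Lf Lg; apply: (integrableD _ Lf Lg). Qed.

Lemma L1Z (k : R) f : L1 f -> L1 (fun x => k * f x).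
Proof. by move=> Lf; apply: (integrableZl _ _ Lf). Qed.

Lemma L1N f : L1 f -> L1 (fun x => - f x).
Proof. by move=> Lf; apply: (integrableN Lf). Qed.

Lemma L1B f g : L1 f -> L1 g -> L1 (fun x => f x - g x).
Proof. by move=> Lf Lg; apply: L1D => //; exact: L1N. Qed.

Lemma L1_norm f : L1 f -> L1 (fun x => `|f x|).
Proof. by move=> Lf; apply: (integrable_norm Lf). Qed.

Lemma L1_dom f g : meas f -> (forall x, `|f x| <= g x) -> L1 g -> L1 f.
Proof.
move=> mf fg Lg; apply: (le_integrable _ _ _ Lg) => //.
  exact/measurable_EFinP.
by move=> x _ /=; rewrite lee_fin (le_trans (fg x))// ler_norm.
Qed.

Lemma L1_0 : L1 (fun=> 0).
Proof. exact: integrable0. Qed.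

Lemma eq_L1 f g : f =1 g -> L1 f -> L1 g.
Proof. by move=> /funext ->. Qed.

Lemma eq_Int f g : f =1 g -> Int f = Int g.
Proof. by move=> /funext ->. Qed.

Lemma Int0 : Int (fun=> 0) = 0.
Proof. by rewrite /Int /Rintegral integral0. Qed.

Lemma IntD f g : L1 f -> L1 g -> Int (fun x => f x + g x) = Int f + Int g.
Proof. by move=> Lf Lg; rewrite /Int RintegralD. Qed.

Lemma IntB f g : L1 f -> L1 g -> Int (fun x => f x - g x) = Int f - Int g.
Proof. by move=> Lf Lg; rewrite /Int RintegralB. Qed.

Lemma IntZ (k : R) f : L1 f -> Int (fun x => k * f x) = k * Int f.
Proof. by move=> Lf; rewrite /Int RintegralZl. Qed.

Lemma IntN f : L1 f -> Int (fun x => - f x) = - Int f.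
Proof.
by move=> Lf; rewrite -mulN1r -IntZ//; apply: eq_Int => x; rewrite mulN1r.
Qed.

Lemma Int_ge0 f : (forall x, 0 <= f x) -> 0 <= Int f.
Proof. by move=> f0; apply: Rintegral_ge0. Qed.

Lemma le_Int f g : L1 f -> L1 g -> (forall x, f x <= g x) -> Int f <= Int g.
Proof. by move=> Lf Lg fg; apply: le_Rintegral. Qed.

Lemma le_norm_Int f : L1 f -> `|Int f| <= Int (fun x => `|f x|).
Proof. by move=> Lf; apply: le_normr_Rintegral. Qed.

Lemma EFin_Int f : L1 f -> (Int f)%:E = (\int[mu]_x (f x)%:E)%E.
Proof. by move=> Lf; rewrite fineK//; exact: integrable_fin_num. Qed.

Definition aeq f g := {ae mu, forall x, f x = g x}.

Lemma aeP (P : R -> Prop) :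
  {ae mu, forall x, P x} <->
  exists N, [/\ measurable N, mu N = 0%E & forall x, ~ N x -> P x].
Proof.
split=> -[N [mN N0 NP]]; exists N; split=> //.
  by move=> x; apply: contra_notP => ?; exact: NP.
by move=> x /= nP; apply: contrapT => /NP.
Qed.

Lemma ae_imp (P Q : R -> Prop) : (forall x, P x -> Q x) ->
  {ae mu, forall x, P x} -> {ae mu, forall x, Q x}.
Proof. exact: (@filterS _ _ (ae_filter_ringOfSetsType mu)). Qed.

Lemma ae_imp2 (P Q S : R -> Prop) : (forall x, P x -> Q x -> S x) ->
  {ae mu, forall x, P x} -> {ae mu, forall x, Q x} -> {ae mu, forall x, S x}.
Proof. exact: (@filterS2 _ _ (ae_filter_ringOfSetsType mu)). Qed.

Lemma ae_imp3 (P Q S T : R -> Prop) : (forall x, P x -> Q x -> S x -> T x) ->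
  {ae mu, forall x, P x} -> {ae mu, forall x, Q x} -> {ae mu, forall x, S x} ->
  {ae mu, forall x, T x}.
Proof. exact: (@filterS3 _ _ (ae_filter_ringOfSetsType mu)). Qed.

Lemma aeW (P : R -> Prop) : (forall x, P x) -> {ae mu, forall x, P x}.
Proof. by move=> h; apply: (@filterS _ _ (ae_filter_ringOfSetsType mu) setT) => //; exact: filterT. Qed.

Lemma ae_forall (P : nat -> R -> Prop) :
  (forall n, {ae mu, forall x, P n x}) -> {ae mu, forall x, forall n, P n x}.
Proof.
move=> h; apply: (negligibleS _ (negligible_bigcup h)) => x /= /existsNP[n nP].
by exists n.
Qed.

Lemma aeq_Int f g : meas f -> meas g -> aeq f g -> Int f = Int g.
Proof.
move=> mf mg fg; rewrite /Int /Rintegral; congr fine.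
apply: ae_eq_integral => //; try exact/measurable_EFinP.
by apply: ae_imp fg => x -> _.
Qed.

Lemma aeq_L1 f g : meas f -> meas g -> aeq f g -> L1 f -> L1 g.
Proof.
move=> mf mg fg /integrableP[_ foo]; apply/integrableP; split.
  exact/measurable_EFinP.
apply: le_lt_trans foo; rewrite le_eqVlt; apply/orP; left; apply/eqP.
apply: ae_eq_integral => //.
- by apply: measurableT_comp => //; exact/measurable_EFinP.
- by apply: measurableT_comp => //; exact/measurable_EFinP.
- by apply: ae_imp fg => x /= -> _.
Qed.

Lemma L1_domae f g : meas f -> {ae mu, forall x, `|f x| <= g x} -> L1 g -> L1 f.
Proof.
move=> mf fg Lg; apply/integrableP; split; first exact/measurable_EFinP.
have /integrableP[mg goo] := L1_norm Lg.
apply: le_lt_trans goo; apply: ae_ge0_le_integral => //.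
- by apply: measurableT_comp => //; exact/measurable_EFinP.
- by apply: measurableT_comp => //; exact/measurable_EFinP.
- apply: ae_imp fg => x fgx _ /=.
  by rewrite lee_fin normr_id (le_trans fgx)// ler_norm.
Qed.

Lemma Int_ae0 f : L1 f -> (forall x, 0 <= f x) -> Int f = 0 ->
  {ae mu, forall x, f x = 0}.
Proof.
move=> Lf f0 If.
have mf := L1_meas Lf.
have := EFin_Int Lf; rewrite If => /esym I0.
have /(ae_eq_integral_abs mu measurableT (measurable_int _ Lf)) :
    (\int[mu]_x `|(EFin \o f) x|)%E = 0%E.
  by rewrite -[RHS]I0; apply: eq_integral => x _ /=; rewrite ger0_norm.
by apply: ae_imp => x /= /(_ I) [].
Qed.

Lemma Int_dct (F : nat -> R -> R) f g :
  (forall n, meas (F n)) -> meas f ->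
  {ae mu, forall x, F ^~ x @ \oo --> f x} -> L1 g ->
  (forall n, {ae mu, forall x, `|F n x| <= g x}) ->
  L1 f /\ (fun n => Int (F n)) @ \oo --> Int f.
Proof.
move=> mF mf Ff Lg Fg.
have mF' n : measurable_fun setT (fun x => (F n x)%:E). apply/measurable_EFinP. exact: mF.
have mf' : measurable_fun setT (EFin \o f) by apply/measurable_EFinP.
have Ff' : {ae mu, forall x, setT x -> (fun n => (F n x)%:E) @ \oo --> (EFin \o f) x}.
  apply: ae_imp Ff => x Fx _; apply/fine_cvgP; split; first exact: nearW.
  exact: Fx.
have Fg' : {ae mu, forall x n, setT x -> (`|(F n x)%:E| <= (EFin \o g) x)%E}.
  apply: (ae_imp _ (ae_forall Fg)) => x Fgx n _.
  by rewrite lee_fin.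
have [Lf _ FI] := @dominated_convergence _ _ _ mu setT measurableT _ _ _ mF' mf' Ff' Lg Fg'.
split=> //.
apply: fine_cvg; rewrite /Rintegral fineK//; exact: integrable_fin_num.
Qed.

End LineIntegral.

(** * Translations, reflections and dilations of the line *)

Section Substitution.
Variable R : realType.
Local Notation mu := (@lebesgue_measure R).
Local Notation T := (measurableTypeR R).
Local Notation meas := (measurable_fun [set: R]).
Implicit Types (f g : R -> R).

Lemma meas_opp : meas (fun x : R => - x).
Proof. by apply: measurableT_comp. Qed.

Lemma meas_shift (b : R) : meas (fun x : R => x + b).
Proof. by apply: measurable_funD. Qed.

Lemma meas_scale (s : R) : meas (fun x : R => s * x).
Proof. by apply: measurable_funM. Qed.

Lemma lebesgue_measure_shift (b : R) (A : set R) : measurable A ->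
  pushforward mu ((fun x => x + b) : _ -> measurableTypeR R) A = mu A.
Proof.
move=> mA; apply/esym/lebesgue_measure_unique => //=.
  exact: meas_shift.
move=> _ _ [[u v]] _ <-.
rewrite /pushforward (_ : _ @^-1` _ = `]u - b, v - b]%classic); last first.
  by apply/seteqP; split=> x /=; rewrite !in_itv/= ltrBlDr lerBrDr.
rewrite !lebesgue_measure_itv/= !lte_fin ltrD2r.
by case: ifP => // _; rewrite -!EFinB; congr EFin; ring.
Qed.

(** One change of variables serves translations, reflections and dilations: all that matters is that
    [phi] pushes [mu] forward to [k * mu]. The nonnegative case is applied to the positive and
    negative parts. *)
Lemma Int_push (phi : R -> R) (k : R) f : 0 < k -> meas phi ->
  (forall A : set R, measurable A ->
    pushforward mu (phi : _ -> measurableTypeR R) A = (k%:E * mu A)%E) ->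
  meas f -> L1 f -> L1 (f \o phi) /\ Int (f \o phi) = k * Int f.
Proof.
move=> k0 mphi phiE mf Lf.
have nnk : 0 <= k by exact: ltW.
have mfphi : meas (f \o phi) by apply: measurableT_comp mphi.
have pushE (g : R -> \bar R) : measurable_fun setT g -> (forall x, 0 <= g x)%E ->
    (\int[mu]_x g (phi x) = k%:E * \int[mu]_x g x)%E.
  move=> mg g0.
  rewrite -{1}(preimage_setT (phi : T -> T)).
  rewrite -(@ge0_integral_pushforward _ _ _ _ _ (phi : T -> T))//.
  rewrite -(ge0_integral_mscale _ measurableT (NngNum nnk))//.
  by apply: eq_measure_integral => A mA _; exact: phiE.
have Lfphi : L1 (f \o phi).
  apply/integrableP; split; first exact/measurable_EFinP.
  rewrite (pushE (fun x => `|(f x)%:E|%E))//.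
    by have /integrableP[_ foo] := Lf; rewrite lte_mul_pinfty.
  by apply: measurableT_comp => //; exact/measurable_EFinP.
split=> //; rewrite /Int /Rintegral.
have -> : (\int[mu]_x ((f \o phi) x)%:E = k%:E * \int[mu]_x (f x)%:E)%E.
  rewrite integralE [in RHS]integralE muleBr//; last first.
    by apply: integrable_add_def => //; exact: Lf.
  have mEf : measurable_fun setT (EFin \o f) by exact/measurable_EFinP.
  congr (_ - _)%E.
  - rewrite -(pushE _ (measurable_funepos mEf) (funepos_ge0 _)).
    by apply: eq_integral => x _; rewrite !funeposE.
  - rewrite -(pushE _ (measurable_funeneg mEf) (funeneg_ge0 _)).
    by apply: eq_integral => x _; rewrite !funenegE.
by rewrite fineM//; exact: integrable_fin_num.
Qed.

Lemma Int_shift (b : R) f : L1 f ->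
  L1 (fun x => f (x + b)) /\ Int (fun x => f (x + b)) = Int f.
Proof.
move=> Lf; have mf := L1_meas Lf.
have [] := @Int_push (fun x => x + b) 1 f _ (meas_shift b) _ mf Lf => //.
  by move=> A mA; rewrite lebesgue_measure_shift// mul1e.
by rewrite mul1r.
Qed.

Lemma Int_opp f : L1 f ->
  L1 (fun x => f (- x)) /\ Int (fun x => f (- x)) = Int f.
Proof.
move=> Lf; have mf := L1_meas Lf.
have [] := @Int_push (fun x => - x) 1 f _ meas_opp _ mf Lf => //.
  by move=> A mA; rewrite lebesgue_measureN// mul1e.
by rewrite mul1r.
Qed.

(** [s] times the pushforward agrees with [mu] on half-open intervals, hence on all measurable sets
    by uniqueness of Lebesgue measure. *)
Lemma lebesgue_measure_scale (s : R) (A : set R) : 0 < s -> measurable A ->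
  pushforward mu ((fun x => s * x) : _ -> measurableTypeR R) A =
  (s^-1%:E * mu A)%E.
Proof.
move=> s0 mA.
have nns : 0 <= s by exact: ltW.
have uniq (m : {measure set T -> \bar R}) :
    (forall X, @ocitv R X -> mu X = (s%:E * m X)%E) -> mu A = (s%:E * m A)%E.
  move=> mE; exact: (lebesgue_measure_unique (mu := mscale (NngNum nns) m)).
have -> : mu A = (s%:E *
    pushforward mu ((fun x => s * x)%R : _ -> measurableTypeR R) A)%E.
  apply: uniq; first exact: meas_scale.
  move=> ? _ [[u v]] _ <-.
  rewrite /= /pushforward (_ : _ @^-1` _ = `]s^-1 * u, s^-1 * v]%classic); last first.
    by apply/seteqP; split=> x /=; rewrite !in_itv/= ltr_pdivrMl// ler_pdivlMl.
  rewrite !lebesgue_measure_itv/= !lte_fin ltr_pM2l ?invr_gt0//.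
  case: ifP => // _; last by rewrite mule0.
  by rewrite -!EFinB -EFinM; congr EFin; field; rewrite gt_eqF.
by rewrite muleA -EFinM mulVf ?mul1e// gt_eqF.
Qed.

Lemma Int_scale (s : R) f : 0 < s -> L1 f ->
  L1 (fun x => f (s * x)) /\ Int (fun x => f (s * x)) = s^-1 * Int f.
Proof.
move=> s0 Lf; have mf := L1_meas Lf.
apply: (@Int_push (fun x => s * x)) => //; first by rewrite invr_gt0.
  exact: meas_scale.
by move=> A mA; exact: lebesgue_measure_scale.
Qed.

End Substitution.

(** * Fubini's theorem for real-valued integrands *)

Section Fubini.
Variable R : realType.
Local Notation mu := (@lebesgue_measure R).
Local Notation T := (measurableTypeR R).
Local Notation meas := (measurable_fun [set: R]).
Local Notation meas2 := (measurable_fun [set: T * T]).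
Implicit Types (f g : R -> R) (F : R * R -> R).

Definition L1prod F := (mu \x mu)%E.-integrable [set: T * T] (EFin \o F).

(** The partial integrals of Fubini's theorem are extended-valued and finite only almost everywhere.
    Applying [fine] alters them on a null set and returns to real functions. *)
Lemma L1_fine (G : R -> \bar R) : mu.-integrable setT G ->
  L1 (fine \o G) /\ Int (fine \o G) = fine (\int[mu]_x G x)%E.
Proof.
move=> LG.
have mG : meas (fine \o G).
  by apply: measurableT_comp => //; exact: measurable_int LG.
have LfG : L1 (fine \o G).
  apply: le_integrable LG => //; first exact/measurable_EFinP.
  by move=> x _ /=; case: (G x) => [r| |] //=; rewrite ?normr0 ?lee_fin ?leey.
split=> //; rewrite /Int /Rintegral; congr fine; apply: ae_eq_integral => //.
- exact/measurable_EFinP.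
- exact: measurable_int LG.
- by apply: ae_imp (integrable_ae measurableT LG) => x fx _ /=; rewrite fineK ?fx.
Qed.

Lemma meas_Int_abs F : meas2 (EFin \o F) ->
  measurable_fun [set: T] (fun y => \int[mu]_x `|(F (x, y))%:E|)%E.
Proof.
move=> mF; have mabs : meas2 (abse \o (EFin \o F)) by exact: measurableT_comp.
exact: (@measurable_fun_fubini_tonelli_G _ _ _ _ R mu _ mabs
          (fun=> abse_ge0 _)).
Qed.

Lemma Int_Fubini F : L1prod F ->
  [/\ L1 (fun x => Int (fun y => F (x, y))),
      L1 (fun y => Int (fun x => F (x, y))) &
      Int (fun x => Int (fun y => F (x, y))) =
      Int (fun y => Int (fun x => F (x, y)))].
Proof.
move=> LF.
have [L1F I1] := L1_fine (integrable_fubini_F LF).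
have mF : measurable_fun setT (EFin \o F) by exact: measurable_int LF.
have LG : mu.-integrable setT (fubini_G mu (EFin \o F)).
  apply/integrableP; split; first exact: (measurable_fubini_G LF).
  have LFy : (\int[mu]_y \int[mu]_x `|(F (x, y))%:E| < +oo)%E.
    have [+ _] := @integrable21ltyP _ _ _ _ R mu mu _ (measurable_int _ LF).
    exact.
  apply: (le_lt_trans _ LFy).
  apply: ge0_le_integral => //.
  - by apply: measurableT_comp => //; exact: (measurable_fubini_G LF).
  - exact: meas_Int_abs (measurable_int _ LF).
  - move=> y _; apply: le_abse_integral => //.
    exact: (measurable_fun_pair1 (f := EFin \o F)).
have [L2F I2] := L1_fine LG.
split=> //; rewrite [LHS]I1 [RHS]I2; congr fine.
exact: (Fubini LF).
Qed.

Lemma meas2_fst f : meas f -> meas2 (fun z => f z.1).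
Proof. by move=> mf; apply: measurableT_comp mf _. Qed.

Lemma meas2_snd f : meas f -> meas2 (fun z => f z.2).
Proof. by move=> mf; apply: measurableT_comp mf _. Qed.

Lemma L1prod_tonelli F : meas2 F ->
  (forall y, L1 (fun x => F (x, y))) ->
  L1 (fun y => Int (fun x => `|F (x, y)|)) -> L1prod F.
Proof.
move=> mF L1F LI; apply/integrable21ltyP; first exact/measurable_EFinP.
have /integrableP[_] := LI; apply: le_lt_trans.
apply: ge0_le_integral => //.
- by move=> y _; exact: integral_ge0.
- by apply: meas_Int_abs; exact/measurable_EFinP.
- by apply: measurableT_comp => //; apply/measurable_EFinP; exact: L1_meas LI.
- move=> y _ /=; rewrite ger0_norm; last exact: Int_ge0.
  by rewrite EFin_Int//; exact: L1_norm (L1F y).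
Qed.

Lemma L1prod_dom F (G : R * R -> R) : meas2 F -> (forall z, `|F z| <= G z) ->
  L1prod G -> L1prod F.
Proof.
move=> mf fg Lg; apply: (le_integrable _ _ _ Lg) => //.
  exact/measurable_EFinP.
by move=> x _ /=; rewrite lee_fin (le_trans (fg x))// ler_norm.
Qed.

Lemma L1prod_tensor f g : L1 f -> L1 g -> L1prod (fun z => f z.1 * g z.2).
Proof.
move=> Lf Lg; apply: L1prod_tonelli.
- apply: measurable_funM; [exact: meas2_fst (L1_meas Lf)|].
  exact: meas2_snd (L1_meas Lg).
- by move=> y /=; apply: eq_L1 (L1Z (g y) Lf) => x; rewrite mulrC.
- apply: eq_L1 (L1Z (Int (fun x => `|f x|)) (L1_norm Lg)) => y /=.
  rewrite mulrC -IntZ; last exact: L1_norm.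
  by apply: eq_Int => x; rewrite normrM mulrC.
Qed.

Lemma L1prod_kernel f g (k : R * R -> R) (C : R) : L1 f -> L1 g -> meas2 k ->
  (forall z, `|k z| <= C) -> L1prod (fun z => f z.1 * g z.2 * k z).
Proof.
move=> Lf Lg mk kC.
have C0 : 0 <= C by rewrite (le_trans _ (kC (0, 0))).
apply: (@L1prod_dom _ (fun z => (C * `|f z.1|) * `|g z.2|)).
- apply: measurable_funM => //; apply: measurable_funM.
    exact: meas2_fst (L1_meas Lf).
  exact: meas2_snd (L1_meas Lg).
- move=> z; rewrite !normrM mulrC -mulrA ler_wpM2r// mulr_ge0//.
- apply: (L1prod_tensor (f := fun x => C * `|f x|) (g := fun x => `|g x|)).
    exact/L1Z/L1_norm.
  exact: L1_norm.
Qed.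

(** A bounded kernel is dominated through the tensor product of [f] and [g], so Fubini applies. The
    kernel will be an order indicator (integration by parts), [cas] (duality) or a Gaussian
    (averaging over centres). *)
Lemma Int_swap f g (k : R * R -> R) (C : R) : L1 f -> L1 g -> meas2 k ->
  (forall z, `|k z| <= C) ->
  Int (fun x => f x * Int (fun y => g y * k (x, y))) =
  Int (fun y => g y * Int (fun x => f x * k (x, y))).
Proof.
move=> Lf Lg mk kC; have LF := L1prod_kernel Lf Lg mk kC.
have mkx x : meas (fun y => k (x, y)).
  exact: (measurable_fun_pair2 (f := k : T * T -> T)).
have mky y : meas (fun x => k (x, y)).
  exact: (measurable_fun_pair1 (f := k : T * T -> T)).
have Lgk x : L1 (fun y => g y * k (x, y)).
  apply: (L1_dom (g := fun y => C * `|g y|)); last exact/L1Z/L1_norm.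
    by apply: measurable_funM => //; exact: L1_meas Lg.
  by move=> y; rewrite normrM mulrC ler_wpM2r.
have Lfk y : L1 (fun x => f x * k (x, y)).
  apply: (L1_dom (g := fun y => C * `|f y|)); last exact/L1Z/L1_norm.
    by apply: measurable_funM => //; exact: L1_meas Lf.
  by move=> x; rewrite normrM mulrC ler_wpM2r.
have [_ _ E] := Int_Fubini LF.
transitivity (Int (fun x => Int (fun y => f x * g y * k (x, y)))).
  by apply: eq_Int => x; rewrite -IntZ//; apply: eq_Int => y; rewrite mulrA.
rewrite E; apply: eq_Int => y; rewrite -IntZ//; apply: eq_Int => x.
by rewrite /= mulrA (mulrC (g y)).
Qed.

End Fubini.

(** * Absolutely continuous functions *)

Lemma meas_norm d (X : measurableType d) (R : realType) (f : X -> R) :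
  measurable_fun setT f -> measurable_fun setT (fun x => `|f x|).
Proof. by move=> mf; exact: measurableT_comp. Qed.

Lemma meas_opp_fun d (X : measurableType d) (R : realType) (f : X -> R) :
  measurable_fun setT f -> measurable_fun setT (fun x => - f x).
Proof. by move=> mf; exact: measurableT_comp. Qed.

Ltac solve_meas := repeat first
  [ assumption | exact: measurable_cst | exact: measurable_id
  | exact: measurable_indic | by apply: L1_meas; eassumption
  | apply: measurable_funD | apply: measurable_funB | apply: measurable_funM
  | apply: measurable_funX
  | apply: meas_norm | apply: meas_opp_fun ].

Section Primitives.
Variable R : realType.
Local Notation meas := (measurable_fun [set: R]).
Implicit Types (f g : R -> R) (a b x : R).

(** Integrals over [[a, b]] are written as integrals over the whole line against this weight, so
    that a single set of rules suffices; the weight is zero when [b < a]. *)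
Definition itvi a b : R -> R := \1_(`[a, b]%classic).

Lemma itviE a b x : itvi a b x = ((a <= x) && (x <= b))%:R.
Proof. by rewrite /itvi indicE mem_setE in_itv. Qed.

Lemma itvi_ge0 a b x : 0 <= itvi a b x.
Proof. by rewrite itviE ler0n. Qed.

Lemma itvi_le1 a b x : itvi a b x <= 1.
Proof. by rewrite itviE lern1; case: (_ && _). Qed.

Lemma meas_itvi a b : meas (itvi a b).
Proof. exact: measurable_indic. Qed.
Local Hint Resolve meas_itvi : core.

Lemma L1_itvi a b : L1 (itvi a b).
Proof. exact: (integrable_indic_itv a b true false). Qed.

Lemma Int_itvi a b : a <= b -> Int (itvi a b) = b - a.
Proof.
move=> ab; rewrite /Int /Rintegral integral_indic//= setIT.
rewrite lebesgue_measure_itv/= lte_fin; case: ifP => [_ //|/negbT].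
by rewrite -leNgt => ba /=; lra.
Qed.

Definition L1loc g := meas g /\ forall a b, L1 (fun x => itvi a b x * g x).

Lemma L1_itvi_dom g h a b : meas g -> (forall x, a <= x <= b -> `|g x| <= h x) ->
  L1 (fun x => itvi a b x * h x) -> L1 (fun x => itvi a b x * g x).
Proof.
move=> mg gh Lh; apply: (L1_dom _ _ Lh); first exact: measurable_funM.
move=> x; rewrite itviE; case: (boolP ((a <= x) && (x <= b))) => [|_].
  by rewrite !mul1r => /gh.
by rewrite !mul0r normr0.
Qed.

Lemma L1loc_dom g h : meas g -> (forall x, `|g x| <= h x) -> L1loc h -> L1loc g.
Proof.
by move=> mg gh [mh Lh]; split=> // a b; exact: (L1_itvi_dom _ _ (Lh a b)).
Qed.

Lemma L1locD f g : L1loc f -> L1loc g -> L1loc (fun x => f x + g x).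
Proof.
move=> [mf Lf] [mg Lg]; split=> [|a b]; first exact: measurable_funD.
by apply: eq_L1 (L1D (Lf a b) (Lg a b)) => x; rewrite mulrDr.
Qed.

Lemma L1locZ k f : L1loc f -> L1loc (fun x => k * f x).
Proof.
move=> [mf Lf]; split=> [|a b]; first exact: measurable_funM.
by apply: eq_L1 (L1Z k (Lf a b)) => x; rewrite mulrCA.
Qed.

Lemma L1locN f : L1loc f -> L1loc (fun x => - f x).
Proof. by move=> /(L1locZ (-1)); under eq_fun do rewrite mulN1r. Qed.

Lemma L1locB f g : L1loc f -> L1loc g -> L1loc (fun x => f x - g x).
Proof. by move=> ? ?; apply: L1locD => //; exact: L1locN. Qed.

Lemma L1_L1loc f : L1 f -> L1loc f.
Proof.
move=> Lf; split=> [|a b]; first exact: L1_meas.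
apply: (L1_dom _ _ (L1_norm Lf)).
  by apply: measurable_funM; [exact: meas_itvi|exact: L1_meas].
move=> x; rewrite normrM ger0_norm ?itvi_ge0//.
by rewrite ler_piMl// itvi_le1.
Qed.

Lemma L1loc_cst k : L1loc (fun=> k).
Proof.
split=> [|a b]; first exact: measurable_cst.
by apply: eq_L1 (L1Z k (L1_itvi a b)) => x; rewrite mulrC.
Qed.

Lemma cont_bounded f a b : continuous f ->
  exists2 C, 0 <= C & forall x, a <= x <= b -> `|f x| <= C.
Proof.
move=> cf; have [ab|ba] := leP a b; last first.
  exists 0 => // x /andP[ax xb].
  by have := le_lt_trans (le_trans ax xb) ba; rewrite ltxx.
have cn : {within `[a, b], continuous (fun x => `|f x|)}.
  apply: continuous_subspaceT => x.
  by apply: continuous_comp; [exact: cf|exact: norm_continuous].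
have [c _ hc] := EVT_max ab cn.
by exists `|f c| => // x xab; apply: hc; rewrite in_itv.
Qed.

Lemma cont_meas f : continuous f -> meas f.
Proof. exact: continuous_measurable_fun. Qed.

Lemma L1locM f g : continuous f -> L1loc g -> L1loc (fun x => f x * g x).
Proof.
move=> cf [mg Lg]; split=> [|a b].
  by apply: measurable_funM => //; exact: cont_meas.
have [C C0 fC] := cont_bounded a b cf.
apply: (L1_itvi_dom (h := fun x => C * `|g x|)).
- by apply: measurable_funM => //; exact: cont_meas.
- by move=> x /fC fx; rewrite normrM ler_wpM2r.
- apply: eq_L1 (L1Z C (L1_norm (Lg a b))) => x.
  by rewrite normrM ger0_norm ?itvi_ge0// mulrCA.
Qed.

Lemma L1loc_cont f : continuous f -> L1loc f.
Proof.
by move=> cf; have := L1locM cf (L1loc_cst 1); under eq_fun do rewrite mulr1.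
Qed.

Lemma L1loc_sq f : meas f -> L1 (fun x => f x ^+ 2) -> L1loc f.
Proof.
move=> mf Lf; apply: (L1loc_dom (h := fun x => 1 + f x ^+ 2)) => //.
  move=> x; have : 0 <= (`|f x| - 1) ^+ 2 by exact: sqr_ge0.
  rewrite sqrrB1 real_normK ?num_real// => h.
  have := normr_ge0 (f x); lra.
by apply: L1locD; [exact: L1loc_cst|exact: L1_L1loc].
Qed.

Lemma itvi_cut g a b c : a <= b -> b <= c -> L1loc g ->
  Int (fun x => itvi a c x * g x) =
  Int (fun x => itvi a b x * g x) + Int (fun x => itvi b c x * g x).
Proof.
move=> ab bc [mg Lg]; rewrite -IntD//; apply: aeq_Int.
- by apply: measurable_funM => //.
- by apply: measurable_funD; apply: measurable_funM => //.
- apply/aeP; exists [set b]; split=> //; first exact: lebesgue_measure_set1.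
  move=> x /= /eqP xb; rewrite -mulrDl !itviE; congr (_ * _).
  case: (ltgtP x b) xb => //= xb _.
    by rewrite (le_trans (ltW xb) bc) ?andbT ?addr0.
  by rewrite (le_trans ab (ltW xb)) ?andbF ?add0r.
Qed.

(** [f] is locally absolutely continuous with almost everywhere derivative [g]. The integral form
    admits a merely locally integrable [g], which is all that the weak equation yields at the
    start. *)
Definition prim f g := L1loc g /\
  forall a b, a <= b -> f b - f a = Int (fun x => itvi a b x * g x).

Lemma primD f f' g g' : prim f f' -> prim g g' ->
  prim (fun x => f x + g x) (fun x => f' x + g' x).
Proof.
move=> [Lf' If'] [Lg' Ig']; split=> [|a b ab]; first exact: L1locD.
rewrite opprD addrACA If'// Ig'// -IntD; [|exact: Lf'.2|exact: Lg'.2].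
by apply: eq_Int => x; rewrite mulrDr.
Qed.

Lemma primZ k f f' : prim f f' -> prim (fun x => k * f x) (fun x => k * f' x).
Proof.
move=> [Lf' If']; split=> [|a b ab]; first exact: L1locZ.
rewrite -mulrBr If'// -IntZ; last exact: Lf'.2.
by apply: eq_Int => x; rewrite mulrCA.
Qed.

Lemma primN f f' : prim f f' -> prim (fun x => - f x) (fun x => - f' x).
Proof.
move=> /(primZ (-1)).
by under eq_fun do rewrite mulN1r; under [X in prim _ X]eq_fun do rewrite mulN1r.
Qed.

Lemma primB f f' g g' : prim f f' -> prim g g' ->
  prim (fun x => f x - g x) (fun x => f' x - g' x).
Proof. by move=> ? ?; apply: primD => //; exact: primN. Qed.

Lemma prim_cst k : prim (fun=> k) (fun=> 0).
Proof.
split=> [|a b ab]; first exact: L1loc_cst.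
by rewrite subrr; under eq_fun do rewrite mulr0; rewrite Int0.
Qed.

Lemma eq_prim f1 f2 g1 g2 : f1 =1 f2 -> g1 =1 g2 -> prim f1 g1 -> prim f2 g2.
Proof. by move=> /funext -> /funext ->. Qed.

Lemma prim_aeq f g1 g2 : meas g2 -> aeq g1 g2 -> prim f g1 -> prim f g2.
Proof.
move=> mg2 g12 [[mg1 Lg1] I1].
have ae12 a b : aeq (fun x => itvi a b x * g1 x) (fun x => itvi a b x * g2 x).
  by apply: ae_imp g12 => x ->.
have mi g a b : meas g -> meas (fun x => itvi a b x * g x).
  by move=> mg; apply: measurable_funM => //.
split=> [|a b ab]; last first.
  by rewrite I1//; apply: aeq_Int => //; exact: mi.
by split=> // a b; apply: aeq_L1 (ae12 a b) (Lg1 a b); exact: mi.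
Qed.

Lemma prim_bound f g x y a b : prim f g -> a <= x <= b -> a <= y <= b ->
  `|f y - f x| <= Int (fun z => itvi a b z * `|g z|).
Proof.
move=> [[mg Lg] Ig].
have Lab : L1 (fun z => itvi a b z * `|g z|).
  apply: eq_L1 (L1_norm (Lg a b)) => z.
  by rewrite normrM ger0_norm// itvi_ge0.
wlog xy : x y / x <= y => [H|] xab yab.
  by have [/H|/ltW /H] := leP x y; [exact|rewrite distrC; exact].
rewrite Ig//; apply: le_trans (le_norm_Int (Lg x y)) _.
apply: le_Int => //; first exact: L1_norm.
move=> z; rewrite normrM ger0_norm ?itvi_ge0// ler_wpM2r// !itviE.
case/andP: xab => ax _; case/andP: yab => _ yb.
have [/andP[xz zy]|] := boolP ((x <= z) && _); last by rewrite ler0n.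
by rewrite (le_trans ax xz) (le_trans zy yb).
Qed.

End Primitives.

(** * Continuity and products of absolutely continuous functions *)

Section PrimitiveCalculus.
Variable R : realType.
Local Notation T := (measurableTypeR R).
Local Notation meas := (measurable_fun [set: R]).
Local Notation meas2 := (measurable_fun [set: T * T]).
Implicit Types (f g : R -> R) (a b x : R).
Local Hint Resolve meas_itvi : core.

Lemma itvi1 a b x : a <= x <= b -> itvi a b x = 1.
Proof. by rewrite itviE => ->. Qed.

Lemma itvi0 a b x : ~~ (a <= x <= b) -> itvi a b x = 0.
Proof. by rewrite itviE => /negbTE ->. Qed.

Lemma itvi_dom a b g x : `|itvi a b x * g x| <= `|g x|.
Proof. by rewrite normrM ger0_norm ?itvi_ge0// ler_piMl// itvi_le1. Qed.

Lemma cvg0_norm (u : nat -> R) e : 0 < e -> u @ \oo --> (0 : R) ->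
  exists n, `|u n| <= e.
Proof.
move=> e0 /cvgrPdist_le/(_ e e0) [n _ /(_ n (leqnn n))].
by rewrite sub0r normrN; exists n.
Qed.

(** By dominated convergence the integral of [|g|] over the interval of radius [1 / (n + 1)] about
    [x] tends to 0, the limit set [{x}] being null. *)
Lemma prim_continuous f g : prim f g -> continuous f.
Proof.
move=> pf x; have [[mg Lg] Ig] := pf.
pose d n : R := n.+1%:R^-1.
have d0 n : 0 < d n by rewrite invr_gt0.
pose G n z := itvi (x - d n) (x + d n) z * (itvi (x - 1) (x + 1) z * g z).
have d1 n : d n <= 1 by rewrite invf_le1// ler1n.
have [_ GI] : L1 (fun=> 0 : R) /\
    (fun n => Int (fun z => `|G n z|)) @ \oo --> Int (fun=> 0 : R).
  apply: (Int_dct (g := fun z => `|itvi (x - 1) (x + 1) z * g z|)) => //.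
  - move=> n; rewrite /G; solve_meas.
  - apply/aeP; exists [set x]; split=> //; first exact: lebesgue_measure_set1.
    move=> z /= /eqP zx; apply: cvg_near_cst.
    have zx0 : 0 < `|z - x| by rewrite normr_gt0 subr_eq0.
    near=> n; rewrite /G itvi0 ?mul0r ?normr0//.
    have dn : d n < `|z - x|.
      by near: n; exact: (near_infty_natSinv_lt (PosNum zx0)).
    apply/negP => /andP[h1 h2]; move: dn; rewrite ltNge ler_distl.
    by rewrite h1 h2.
  - exact: L1_norm (Lg _ _).
  - move=> n; apply: aeW => z; rewrite normr_id.
    exact: (itvi_dom _ _ (fun z => itvi (x - 1) (x + 1) z * g z)).
rewrite Int0 in GI.
apply/cvgrPdist_le => e e0; have [n] := cvg0_norm e0 GI.
rewrite ger0_norm; last exact: Int_ge0.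
move=> ne; exists (d n) => /=; first exact: d0.
move=> y /=; rewrite ltr_norml => /andP[y1 y2].
rewrite distrC (le_trans (prim_bound (a := x - d n) (b := x + d n) pf _ _))//.
- by apply/andP; have := d0 n; split; lra.
- by apply/andP; split; lra.
apply: le_trans ne; rewrite le_eqVlt; apply/orP; left; apply/eqP.
apply: eq_Int => z; rewrite /G normrM ger0_norm ?itvi_ge0// !itviE.
have [/andP[z1 z2]|] := boolP (_ && _); last by rewrite !mul0r.
rewrite normrM !mul1r (_ : _ && _ = true) ?normr1 ?mul1r//.
by apply/andP; have := d1 n; split; lra.
Unshelve. all: by end_near. Qed.

Lemma meas2_le : meas2 (fun z : R * R => (z.1 <= z.2)%R%:R : R).
Proof.
rewrite (_ : (fun z : R * R => _) =
    \1_((fun z : T * T => z.2 - z.1 : R) @^-1` `[0, +oo[)); last first.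
  apply/funext => z; rewrite indicE; congr (_ %:R); congr nat_of_bool.
  apply/idP/idP; rewrite inE/= in_itv/= andbT subr_ge0//.
apply: measurable_indic; rewrite -[X in measurable X]setTI.
by apply: measurable_funB => //; exact: measurable_itv.
Qed.

Lemma prim_local f g a x : prim f g -> a <= x -> forall b, x <= b ->
  f x - f a = Int (fun r => (itvi a b r * g r) * (r <= x)%R%:R).
Proof.
move=> [_ Ig] ax b xb; rewrite Ig//; apply: eq_Int => r; rewrite !itviE.
rewrite mulrAC; congr (_ * _).
have [ar|] := boolP (a <= r); last by rewrite mul0r.
have [rx|] := boolP (r <= x); last by rewrite mulr0.
by rewrite (le_trans rx xb) mulr1.
Qed.

Lemma L1_bounded f (k : R -> R) (C : R) : L1 f -> meas k ->
  (forall x, `|k x| <= C) -> L1 (fun x => f x * k x).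
Proof.
move=> Lf mk kC; apply: (L1_dom _ _ (L1Z C (L1_norm Lf))).
  by apply: measurable_funM mk; exact: L1_meas Lf.
by move=> x; rewrite normrM mulrC ler_wpM2r.
Qed.

Lemma norm_boolR (c : bool) : `|c%:R : R| <= 1.
Proof. by rewrite normr_nat lern1; case: c. Qed.

Lemma L1_kernel_inner f g (k : R -> R -> R) : L1 f -> L1 g ->
  meas2 (fun z : R * R => k z.1 z.2) -> (forall x y, `|k x y| <= 1) ->
  L1 (fun x => f x * Int (fun y => g y * k x y)).
Proof.
move=> Lf Lg mk k1.
have [+ _ _] := Int_Fubini (L1prod_kernel Lf Lg mk (fun z => k1 z.1 z.2)).
apply: eq_L1 => x; rewrite -IntZ; last first.
  by apply: (@L1_bounded _ _ 1) => //; exact: (measurable_fun_pair2 x mk).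
by apply: eq_Int => y /=; rewrite mulrA.
Qed.

Lemma meas2_ge : meas2 (fun z : R * R => (z.2 <= z.1)%R%:R : R).
Proof. exact: (measurableT_comp meas2_le (@measurable_swap _ _ _ _)). Qed.

Lemma Int_diagonal f g : L1 f -> L1 g ->
  Int (fun x => f x * Int (fun y => g y * (x <= y)%R%:R)) +
  Int (fun x => f x * Int (fun y => g y * (y <= x)%R%:R)) = Int f * Int g.
Proof.
move=> Lf Lg.
have L1' := L1_kernel_inner (k := fun x y => (x <= y)%R%:R) Lf Lg meas2_le (fun _ _ => norm_boolR _).
have L2' := L1_kernel_inner (k := fun x y => (y <= x)%R%:R) Lf Lg meas2_ge (fun _ _ => norm_boolR _).
rewrite -(IntD L1' L2') mulrC -(IntZ _ Lf); apply: eq_Int => x.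
rewrite -mulrDr mulrC; congr (_ * _).
have Lx := L1_bounded (k := fun y => (x <= y)%R%:R) Lg (measurable_fun_pair2 x meas2_le)
  (fun=> norm_boolR _).
have Lx' := L1_bounded (k := fun y => (y <= x)%R%:R) Lg (measurable_fun_pair2 x meas2_ge)
  (fun=> norm_boolR _).
rewrite -(IntD Lx Lx'); apply: aeq_Int.
- by apply: measurable_funD; [exact: L1_meas Lx|exact: L1_meas Lx'].
- exact: L1_meas Lg.
apply/aeP; exists [set x]; split; [exact: measurable_set1|
  exact: lebesgue_measure_set1|].
move=> y /= yx; case: (ltgtP x y) yx => [_ _|_ _|-> /(_ erefl) []].
  by rewrite mulr0 mulr1 ?add0r ?addr0.
by rewrite mulr0 mulr1 ?add0r ?addr0.
Qed.

(* Integration by parts for absolutely continuous functions: Fubini on the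
   square [a, b]^2, cut along its diagonal. *)
Lemma primM f f' g g' : prim f f' -> prim g g' ->
  prim (fun x => f x * g x) (fun x => f' x * g x + f x * g' x).
Proof.
move=> pf pg; have [Lf' If'] := pf; have [Lg' Ig'] := pg.
have cf := prim_continuous pf; have cg := prim_continuous pg.
have Lfg' : L1loc (fun x => f x * g' x) by exact: L1locM.
have Lf'g : L1loc (fun x => f' x * g x).
  by under eq_fun do rewrite mulrC; exact: L1locM.
split=> [|a b ab]; first exact: L1locD.
have LF := Lf'.2 a b; have LG := Lg'.2 a b.
(* For fixed [s] the inner integral runs over [a <= r <= s] and equals [f s - f a]. *)
have E1 : Int (fun s => (itvi a b s * g' s) *
      Int (fun r => (itvi a b r * f' r) * (r <= s)%R%:R)) =
    Int (fun s => itvi a b s * (f s * g' s)) - f a * (g b - g a).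
  rewrite (Ig' _ _ ab) -(IntZ _ LG) -(IntB (Lfg'.2 _ _) (L1Z _ LG)).
  apply: eq_Int => s; rewrite !(itviE a b s).
  have [/andP[as_ sb]|] := boolP (_ && _); last by rewrite !mul0r mulr0 subr0.
  by rewrite -(prim_local pf as_ sb); ring.
have E2 : Int (fun r => (itvi a b r * f' r) *
      Int (fun s => (itvi a b s * g' s) * (s <= r)%R%:R)) =
    Int (fun s => itvi a b s * (f' s * g s)) - g a * (f b - f a).
  rewrite (If' _ _ ab) -(IntZ _ LF) -(IntB (Lf'g.2 _ _) (L1Z _ LF)).
  apply: eq_Int => s; rewrite !(itviE a b s).
  have [/andP[as_ sb]|] := boolP (_ && _); last by rewrite !mul0r mulr0 subr0.
  by rewrite -(prim_local pg as_ sb); ring.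
have := Int_diagonal LF LG.
rewrite -(If' _ _ ab) -(Ig' _ _ ab) {}E2.
have <- := Int_swap LG LF meas2_ge (fun=> norm_boolR _).
rewrite {}E1.
have -> : (fun x => itvi a b x * (f' x * g x + f x * g' x)) =
   (fun x => itvi a b x * (f' x * g x) + itvi a b x * (f x * g' x)).
  by apply/funext => x; rewrite mulrDr.
rewrite (IntD (Lf'g.2 _ _) (Lfg'.2 _ _)).
move: (Int _) (Int _) => I1 I2 E.
clear -E; lra.
Qed.

End PrimitiveCalculus.

(** * The fundamental theorem of calculus and behaviour at infinity *)

Section PrimitiveLimits.
Variable R : realType.
Local Notation mu := (@lebesgue_measure R).
Local Notation meas := (measurable_fun [set: R]).
Implicit Types (f g : R -> R) (a b x : R).

Lemma Int_itviE g a b :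
  Int (fun x => itvi a b x * g x) = Rintegral mu `[a, b] g.
Proof.
rewrite Rintegral_mkcond; apply: eq_Rintegral => x _.
rewrite patchE /itvi indicE; case: ifP => _; rewrite ?mul1r ?mul0r//.
Qed.

Lemma L1_itviE g a b : meas g -> L1 (fun x => itvi a b x * g x) ->
  mu.-integrable `[a, b] (EFin \o g).
Proof.
move=> mg Lg; apply/integrable_mkcond => //.
apply: eq_integrable Lg => // x _; rewrite patchE /itvi /= indicE.
by case: ifP => _; rewrite ?mul1r ?mul0r.
Qed.

Lemma derive_prim f g : continuous g -> (forall x : R, is_derive x 1 f (g x)) ->
  prim f g.
Proof.
move=> cg df; split=> [|a b]; first exact: L1loc_cont.
rewrite le_eqVlt => /predU1P[<-|ab].
  rewrite subrr -Int0; apply: aeq_Int; first exact: measurable_cst.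
    by apply: measurable_funM; [exact: meas_itvi|exact: cont_meas].
  apply/aeP; exists [set a]; split; [exact: measurable_set1|
    exact: lebesgue_measure_set1|].
  move=> x /= xa; rewrite itviE -eq_le eq_sym.
  by case: eqP xa => // _ _; rewrite mul0r.
have dfx x : derivable f x 1 by have [] := df x.
have cf : continuous f.
  by move=> x; apply: differentiable_continuous; apply/derivable1_diffP.
rewrite Int_itviE /Rintegral (continuous_FTC2 ab (F := f))//.
- exact: continuous_subspaceT.
- split=> [x _|//|//]; first exact: dfx.
  + by apply: cvg_at_right_filter; exact: cf.
  + by apply: cvg_at_left_filter; exact: cf.
- by move=> x _; rewrite derive1E; exact: derive_val.
Qed.

Lemma prim_derive f g x : prim f g -> {for x, continuous g} -> is_derive x 1 f (g x).
Proof.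
move=> [[mg Lg] Ig] cg.
pose F y := Rintegral mu `[x - 1, y] g.
have [] := @continuous_FTC1_closed R g (x - 1) x (x + 1).
- by rewrite ltrDl.
- exact: L1_itviE.
- by rewrite ltrBlDr ltrDl.
- by [].
move=> dF F'.
have FE : {near x, F =1 (fun y => f y - f (x - 1))}.
  exists 1 => /=; first exact: ltr01.
  move=> y /=; rewrite ltr_norml => /andP[y1 y2].
  by rewrite /F -Int_itviE -Ig//; lra.
have dF1 : is_derive x 1 F (g x).
  by apply: DeriveDef; [exact: dF|rewrite -derive1E; exact: F'].
have df1 : is_derive x 1 (fun y => f y - f (x - 1)) (g x).
  by apply: near_eq_is_derive FE dF1; rewrite oner_neq0.
have -> : f = (fun y => (f y - f (x - 1)) + f (x - 1)).
  by apply/funext => y; rewrite subrK.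
by apply: is_derive_eq; rewrite addr0.
Qed.

(** The inequality [|f x| <= |f y| + |f y - f x|] averaged over [y] in [[x, x + 1]]: a local Sobolev
    embedding of [W^{1,1}] into bounded functions. *)
Lemma prim_mean f g x : prim f g -> `|f x| <=
  Int (fun y => itvi x (x + 1) y * `|f y|) + Int (fun y => itvi x (x + 1) y * `|g y|).
Proof.
move=> pf; have cf := prim_continuous pf.
set D := Int (fun y => _ * `|g y|).
have x1 : x <= x + 1 by lra.
have Lf : L1 (fun y => itvi x (x + 1) y * `|f y|).
  by apply: (L1loc_cont _).2 => y; apply: continuous_comp;
    [exact: cf|exact: norm_continuous].
have -> : `|f x| = Int (fun y => itvi x (x + 1) y * `|f x|).
  under eq_Int do rewrite mulrC.
  by rewrite (IntZ _ (L1_itvi _ _)) Int_itvi// addrAC subrr add0r mulr1.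
have -> : D = Int (fun y => itvi x (x + 1) y * D).
  under eq_Int do rewrite mulrC.
  by rewrite (IntZ _ (L1_itvi _ _)) Int_itvi// addrAC subrr add0r mulr1.
have LD k : L1 (fun y => itvi x (x + 1) y * k).
  exact: (L1loc_cst k).2.
rewrite -IntD//; apply: le_Int => //; first exact: L1D.
move=> y; rewrite -mulrDr !itviE.
have [/andP[xy yx]|] := boolP (_ && _); last by rewrite !mul0r.
rewrite !mul1r -lerBlDl; apply: le_trans (lerB_dist _ _) _.
by apply: (prim_bound pf); rewrite ?lexx ?xy ?yx ?x1.
Qed.

(** An integrable excess [p] or [q] over a constant contributes at most its full [L1] norm to each
    unit interval, so the averages in [prim_mean] are bounded uniformly in [x]. *)
Lemma prim_mean_bounded f g p q : prim f g -> L1 p -> L1 q ->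
  (exists C, forall x, `|f x| <= C + p x) ->
  (exists C, {ae mu, forall x, `|g x| <= C + q x}) ->
  exists C, forall x, `|f x| <= C.
Proof.
move=> pf Lp Lq [C fC] [D gD]; have cf := prim_continuous pf.
have [[mg Lg] _] := pf.
have Lcst k y : L1 (fun z => itvi y (y + 1) z * k) by exact: (L1loc_cst k).2.
have Lr r y : L1 r -> L1 (fun z => itvi y (y + 1) z * r z).
  by move=> Lr; exact: (L1_L1loc Lr).2.
have bnd h r k y : L1loc h -> L1 r -> {ae mu, forall x, `|h x| <= k + r x} ->
    Int (fun z => itvi y (y + 1) z * `|h z|) <= k + Int (fun z => `|r z|).
  move=> [mh Lh] Lrr hk.
  have mi : meas (fun z => itvi y (y + 1) z * `|h z|).
    by apply: measurable_funM; [exact: meas_itvi|exact: meas_norm].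
  pose B z := itvi y (y + 1) z * k + `|r z|.
  have LB : L1 B by apply: L1D; [exact: Lcst|exact: L1_norm].
  have Li : L1 (fun z => itvi y (y + 1) z * `|h z|).
    apply: eq_L1 (L1_norm (Lh y (y + 1))) => z.
    by rewrite normrM ger0_norm ?itvi_ge0.
  (* The bound holds only almost everywhere, while monotonicity of [Int] is used with a pointwise
     one. Taking the minimum with the bound changes the integrand on a null set only. *)
  pose m z := Num.min (itvi y (y + 1) z * `|h z|) (B z).
  have mm : meas m by apply: measurable_minr => //; exact: L1_meas LB.
  have am : aeq (fun z => itvi y (y + 1) z * `|h z|) m.
    apply: ae_imp hk => z hz; apply/esym/min_idPl; rewrite /B.
    apply: le_trans (_ : itvi y (y + 1) z * (k + r z) <= _).
      by rewrite ler_wpM2l ?itvi_ge0.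
    rewrite mulrDr lerD2l; apply: le_trans (ler_norm _) (itvi_dom _ _ _ _).
  rewrite (aeq_Int mi mm am).
  have Lm : L1 m by exact: aeq_L1 am Li.
  have y1 : y <= y + 1 by lra.
  have -> : k = Int (fun z => itvi y (y + 1) z * k).
    under eq_Int do rewrite mulrC.
    by rewrite (IntZ _ (L1_itvi _ _)) Int_itvi// addrAC subrr add0r mulr1.
  rewrite -IntD//; last exact: L1_norm.
  by apply: le_Int => // z; rewrite /m ge_min lexx orbT.
exists ((C + Int (fun z => `|p z|)) + (D + Int (fun z => `|q z|))) => x.
apply: le_trans (prim_mean x pf) _; apply: lerD.
- by apply: bnd => //; [exact: L1loc_cont|exact: aeW].
- exact: bnd.
Qed.

Definition vanishes f := forall e, 0 < e -> exists X, forall x, X <= `|x| -> `|f x| <= e.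

(** Uniform over all weights of size at most 1 living outside [[- n, n]]. It is applied both to a
    distant unit interval and to the complement of a large one. *)
Lemma L1_tail h e : L1 h -> 0 < e -> exists n : nat, forall g : R -> R,
  meas g -> (forall x, `|x| <= n%:R -> g x = 0) -> (forall x, `|g x| <= 1) ->
  Int (fun x => `|g x| * `|h x|) <= e.
Proof.
move=> Lh e0.
pose G n x := (1 - itvi (- n%:R) n%:R x) * `|h x|.
have mG n : meas (G n).
  by rewrite /G; solve_meas.
have G0 n x : 0 <= G n x by rewrite mulr_ge0// subr_ge0 itvi_le1.
have Gh n x : `|G n x| <= `|h x|.
  rewrite ger0_norm// ler_piMl//; have := itvi_ge0 (- n%:R) n%:R x; lra.
have [_ GI] : L1 (fun=> 0 : R) /\
    (fun n => Int (G n)) @ \oo --> Int (fun=> 0 : R).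
  apply: (Int_dct (g := fun x => `|h x|)) => //.
  - apply: aeW => x; apply: cvg_near_cst; near=> n.
    rewrite /G itvi1 ?subrr ?mul0r// -ler_norml.
    by near: n; exact: nbhs_infty_ger.
  - exact: L1_norm.
  - by move=> n; exact: aeW.
have LG n : L1 (G n) by exact: (L1_dom (mG n) (Gh n) (L1_norm Lh)).
rewrite Int0 in GI; have [n] := cvg0_norm e0 GI.
rewrite ger0_norm; last exact: Int_ge0.
move=> ne; exists n => g mg g0 g1; apply: le_trans ne.
have gG x : `|g x| * `|h x| <= G n x.
  rewrite ler_wpM2r// itviE -ler_norml.
  have [/g0 ->|_] := boolP (`|x| <= n%:R); first by rewrite normr0 subrr.
  by rewrite subr0.
apply: le_Int => //; apply: (L1_dom _ _ (LG n)).
  by apply: measurable_funM; apply: meas_norm => //; exact: L1_meas.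
by move=> x; rewrite ger0_norm ?mulr_ge0.
Unshelve. all: by end_near. Qed.

(** By [prim_mean], [|f x|] is at most the mass of [|f|] and [|g|] on [[x, x + 1]]. The margin 2 in
    the threshold keeps this interval outside [[- n, n]] also when [x] is negative. *)
Lemma prim_vanishes f g : prim f g -> L1 f -> L1 g -> vanishes f.
Proof.
move=> pf Lf Lg e e0.
have e20 : 0 < e / 2 by lra.
have [n1 h1] := L1_tail Lf e20; have [n2 h2] := L1_tail Lg e20.
exists (n1%:R + n2%:R + 2) => x xn.
have n10 : 0 <= n1%:R :> R by exact: ler0n.
have n20 : 0 <= n2%:R :> R by exact: ler0n.
have itv0 (n : nat) y : n%:R + 2 <= `|x| -> `|y| <= n%:R -> itvi x (x + 1) y = 0.
  move=> nx yn; apply: itvi0; apply/negP => /andP[a1 a2].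
  move: nx yn; rewrite ler_norml => + /andP[b1 b2].
  by case: (ger0P x) => x0; lra.
have bnd h : Int (fun y => `|itvi x (x + 1) y| * `|h y|) =
    Int (fun y => itvi x (x + 1) y * `|h y|).
  by apply: eq_Int => y; rewrite ger0_norm ?itvi_ge0.
apply: le_trans (prim_mean x pf) _; rewrite -!bnd.
rewrite (splitr e); apply: lerD.
- apply: h1; first exact: meas_itvi.
  + by move=> y; apply: itv0; lra.
  + by move=> y; rewrite ger0_norm ?itvi_ge0// itvi_le1.
- apply: h2; first exact: meas_itvi.
  + by move=> y; apply: itv0; lra.
  + by move=> y; rewrite ger0_norm ?itvi_ge0// itvi_le1.
Qed.

(** The boundary terms vanish at infinity. Combined with [primM] this is integration by parts over
    the whole line. *)
Lemma prim_Int0 f g : prim f g -> L1 f -> L1 g -> Int g = 0.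
Proof.
move=> pf Lf Lg; have vf := prim_vanishes pf Lf Lg.
have [[mg Lgl] Ig] := pf.
apply/eqP; rewrite -normr_eq0; apply/eqP/le_anti; rewrite normr_ge0 andbT.
apply/ler_addgt0Pl => e e0; rewrite addr0.
have e30 : 0 < e / 3 by lra.
have [X hX] := vf _ e30; have [n hn] := L1_tail Lg e30.
pose N := Num.max (`|X|) n%:R.
have N0 : 0 <= N by rewrite le_max normr_ge0.
have XN : X <= N by rewrite (le_trans (ler_norm X))// le_max lexx.
have nN : n%:R <= N by rewrite le_max lexx orbT.
have := Ig (- N) N; rewrite (le_trans _ N0) ?oppr_le0// => /(_ isT) E.
have -> : Int g = (f N - f (- N)) + Int (fun x => (1 - itvi (- N) N x) * g x).
  rewrite E -IntD; first by apply: eq_Int => x; ring.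
  - exact: Lgl.
  - by apply: eq_L1 (L1B Lg (Lgl (- N) N)) => x; ring.
have L1m : L1 (fun x => (1 - itvi (- N) N x) * g x).
  by apply: eq_L1 (L1B Lg (Lgl (- N) N)) => x; ring.
have h1 : `|f N| <= e / 3 by apply: hX; rewrite ger0_norm.
have h2 : `|f (- N)| <= e / 3 by apply: hX; rewrite normrN ger0_norm.
have h3 : `|Int (fun x => (1 - itvi (- N) N x) * g x)| <= e / 3.
  apply: le_trans (le_norm_Int L1m) _.
  under eq_Int do rewrite normrM.
  apply: hn.
  - by apply: measurable_funB => //; exact: meas_itvi.
  - by move=> x xn; rewrite itvi1 ?subrr// -ler_norml (le_trans xn nN).
  - move=> x; have := itvi_ge0 (- N) N x; have := itvi_le1 (- N) N x.
    by rewrite ler_norml => a1 a2; apply/andP; split; lra.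
apply: le_trans (ler_normD _ _) _.
have := ler_normB (f N) (f (- N)); lra.
Qed.

(** A strict violation at one point would persist on a ball, which is not null. *)
Lemma ae_le_continuous f g : continuous f -> continuous g ->
  {ae mu, forall x, f x <= g x} -> forall x, f x <= g x.
Proof.
move=> cf cg fg x; rewrite leNgt; apply/negP => gf.
have [N [mN N0 NP]] := (aeP _).1 fg.
have [d /= d0 hd] : \forall y \near x, g y < f y.
  have : \forall y \near x, 0 < f y - g y.
    have /cvgr_gt : (f y - g y) @[y --> x] --> f x - g x.
      by apply: cvgB; [exact: cf|exact: cg].
    by apply; rewrite subr_gt0.
  by apply: filterS => y; rewrite subr_gt0.
have : (mu (ball x d) <= mu N)%E.
  apply: le_measure; rewrite ?inE//; first exact: measurable_ball.
  move=> y xy; apply: contrapT => /NP; have := hd _ xy => /= + h.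
  by rewrite ltNge h.
have := lebesgue_measure_ball x (ltW d0) => ->.
by rewrite N0 lee_fin leNgt mulrn_wgt0.
Qed.

Lemma ae_eq_continuous f g : continuous f -> continuous g -> aeq f g -> f =1 g.
Proof.
move=> cf cg fg x; apply/le_anti/andP; split; apply: ae_le_continuous => //.
  by apply: ae_imp fg => y ->.
by apply: ae_imp fg => y ->.
Qed.

End PrimitiveLimits.

(** * Smooth functions and weak derivatives *)

Section Smoothness.
Variable R : realType.
Implicit Types (f g : R -> R) (b x : R).

Definition has_deriv f g := forall x : R, is_derive x 1 f (g x).

Lemma deriv_derive1 f g : has_deriv f g -> (derive1 f) = g.
Proof. by move=> fg; apply/funext => x; rewrite derive1E; exact: derive_val. Qed.

Lemma deriv_derivable f g : has_deriv f g -> forall x, derivable f x 1.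
Proof. by move=> fg x; have [] := fg x. Qed.

Lemma derivable_deriv f : (forall x, derivable f x 1) -> has_deriv f (derive1 f).
Proof. by move=> df x; apply: DeriveDef; [exact: df|rewrite derive1E]. Qed.

Lemma deriv_continuous f g : has_deriv f g -> continuous f.
Proof.
move=> fg x; apply: differentiable_continuous.
by apply/derivable1_diffP; exact: deriv_derivable fg x.
Qed.

Lemma derivD f f' g g' : has_deriv f f' -> has_deriv g g' ->
  has_deriv (fun x => f x + g x) (fun x => f' x + g' x).
Proof. by move=> df dg x; apply: is_deriveD. Qed.

Lemma derivM f f' g g' : has_deriv f f' -> has_deriv g g' ->
  has_deriv (fun x => f x * g x) (fun x => f' x * g x + f x * g' x).
Proof.
move=> df dg x; have := is_deriveM (df x) (dg x) => h.
by apply: (is_derive_eq h); rewrite addrC /GRing.scale/= (mulrC (g x)).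
Qed.

Lemma derivZ k f f' : has_deriv f f' -> has_deriv (fun x => k * f x) (fun x => k * f' x).
Proof. by move=> df x; apply: is_deriveZ. Qed.

Lemma derivN f f' : has_deriv f f' -> has_deriv (fun x => - f x) (fun x => - f' x).
Proof. by move=> df x; apply: is_deriveN. Qed.

Lemma derivB f f' g g' : has_deriv f f' -> has_deriv g g' ->
  has_deriv (fun x => f x - g x) (fun x => f' x - g' x).
Proof. by move=> df dg x; apply: is_deriveB. Qed.

Lemma deriv_cst k : has_deriv (fun=> k) (fun=> 0).
Proof. by move=> x; exact: is_derive_cst. Qed.

Lemma deriv_comp f f' g g' : has_deriv f f' -> has_deriv g g' ->
  has_deriv (fun x => f (g x)) (fun x => f' (g x) * g' x).
Proof. by move=> df dg x; exact: (is_derive1_comp (df (g x)) (dg x)). Qed.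

Lemma deriv_affine s b : has_deriv (fun x => s * x + b) (fun=> s).
Proof.
move=> x; have h1 : is_derive x 1 (fun y : R => s * y) (s * 1).
  exact: is_deriveZ.
have h2 := is_deriveD h1 (is_derive_cst b x 1).
by apply: (is_derive_eq h2); rewrite mulr1 addr0.
Qed.

Lemma deriv_prim f g : continuous g -> has_deriv f g -> prim f g.
Proof. exact: derive_prim. Qed.

(* [Dk n f]: f is n times differentiable, with no continuity required of the
   last derivative. *)
Fixpoint Dk (n : nat) f : Prop :=
  if n is n'.+1 then (forall x, derivable f x 1) /\ Dk n' (derive1 f) else True.

Lemma Dk_deriv n f g : has_deriv f g -> Dk n g -> Dk n.+1 f.
Proof.
move=> fg Dg; split; first exact: deriv_derivable fg.
by rewrite (deriv_derive1 fg).
Qed.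

Lemma DkW n f : Dk n.+1 f -> Dk n f.
Proof.
elim: n f => [//|n IH] f [df Df]; split=> //.
exact: IH.
Qed.

Lemma Dk_cst n k : Dk n (fun=> k).
Proof. by elim: n k => [//|n IH] k; apply: Dk_deriv (deriv_cst k) _. Qed.

Lemma DkD n f g : Dk n f -> Dk n g -> Dk n (fun x => f x + g x).
Proof.
elim: n f g => [//|n IH] f g [df Df] [dg Dg].
by apply: Dk_deriv (derivD (derivable_deriv df) (derivable_deriv dg)) _; exact: IH.
Qed.

Lemma DkM n f g : Dk n f -> Dk n g -> Dk n (fun x => f x * g x).
Proof.
elim: n f g => [//|n IH] f g /[dup] /DkW Wf [df Df] /[dup] /DkW Wg [dg Dg].
apply: Dk_deriv (derivM (derivable_deriv df) (derivable_deriv dg)) _.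
by apply: DkD; exact: IH.
Qed.

Lemma DkZ n k f : Dk n f -> Dk n (fun x => k * f x).
Proof. by move=> Df; apply: DkM => //; exact: Dk_cst. Qed.

Lemma DkB n f g : Dk n f -> Dk n g -> Dk n (fun x => f x - g x).
Proof.
move=> Df Dg; have -> : (fun x => f x - g x) = (fun x => f x + (-1) * g x).
  by apply/funext => x; rewrite mulN1r.
by apply: DkD => //; exact: DkZ.
Qed.

Lemma Dk_affine n s b f : Dk n f -> Dk n (fun x => f (s * x + b)).
Proof.
elim: n f => [//|n IH] f [df Df].
apply: Dk_deriv (deriv_comp (derivable_deriv df) (deriv_affine s b)) _.
by apply: DkM; [exact: IH|exact: Dk_cst].
Qed.

Definition smoothR f := forall k x, derivable (derive1n k f) x 1.

Lemma derive1Sn f k : derive1n k.+1 f = derive1n k (derive1 f).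
Proof. by rewrite /derive1n iterSr. Qed.

Lemma smoothRP f : smoothR f <-> forall n, Dk n f.
Proof.
split=> [sf n|Df k].
  elim: n f sf => [//|n IH] f sf; split; first exact: (sf 0).
  by apply: IH => k x; rewrite -derive1Sn; exact: sf.
elim: k f Df => [|k IH] f Df x; first by have [] := Df 1%N.
by rewrite derive1Sn; apply: IH => n; have [] := Df n.+1.
Qed.

Lemma smoothR_deriv f : smoothR f -> has_deriv f (derive1 f) /\ smoothR (derive1 f).
Proof.
move=> sf; split; first by apply: derivable_deriv; exact: (sf 0).
by move=> k x; rewrite -derive1Sn; exact: sf.
Qed.

(** Smoothness for explicit families stable under differentiation: the functions [flat P] and,
    later, Gaussian packets. *)
Lemma smooth_class (S : (R -> R) -> Prop) :
  (forall f, S f -> exists2 g, S g & has_deriv f g) ->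
  forall f, S f -> smoothR f /\ forall k, S (derive1n k f).
Proof.
move=> Sd f Sf; have Sk k : S (derive1n k f).
  elim: k => [//|k /Sd[g Sg fg]].
  by rewrite derive1nS (deriv_derive1 fg).
split=> // k x; have [g _ fg] := Sd _ (Sk k).
exact: deriv_derivable fg x.
Qed.

Lemma poly_bound (P : {poly R}) :
  exists2 C, 0 <= C & exists n : nat, forall y, `|P.[y]| <= C * (1 + `|y|) ^+ n.
Proof.
elim/poly_ind: P => [|P c [C C0 [n Pn]]].
  by exists 0 => //; exists 0%N => y; rewrite horner0 normr0 mul0r.
exists (C + `|c|); first exact: addr_ge0.
exists n.+1 => y; rewrite !hornerE.
have y1 : 1 <= 1 + `|y| by rewrite lerDl.
have y0 : 0 <= 1 + `|y| by lra.
apply: le_trans (ler_normD _ _) _; rewrite mulrDl; apply: lerD.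
  rewrite normrM exprSr mulrA; apply: ler_pM => //.
  by rewrite lerDr.
by rewrite ler_peMr// exprn_ege1.
Qed.

(** With [N = n + 1], the inequality [(1 + y) / N <= 1 + y / N <= expR (y / N)] is raised to the
    power [N], whence the constant [N ^+ N]. *)
Lemma pow_expR (n : nat) : exists2 C : R, 0 <= C &
  forall y, 0 <= y -> (1 + y) ^+ n <= C * expR y.
Proof.
exists (n.+1%:R ^+ n.+1) => [|y y0]; first exact: exprn_ge0.
have N0 : 0 < n.+1%:R :> R by [].
have h : (1 + y) / n.+1%:R <= expR (y / n.+1%:R).
  apply: le_trans (expR_ge1Dx _); rewrite mulrDl div1r lerD2r.
  by rewrite invf_le1// ler1n.
have y1 : 0 <= 1 + y by lra.
apply: (@le_trans _ _ ((1 + y) ^+ n.+1)).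
  by apply: ler_weXn2l => //; lra.
have -> : (1 + y) ^+ n.+1 = n.+1%:R ^+ n.+1 * ((1 + y) / n.+1%:R) ^+ n.+1.
  by rewrite -exprMn; congr (_ ^+ _); field; rewrite gt_eqF.
rewrite ler_wpM2l ?exprn_ge0//.
apply: (@le_trans _ _ (expR (y / n.+1%:R) ^+ n.+1)).
  by apply: lerXn2r => //; rewrite nnegrE ?expR_ge0// divr_ge0.
by rewrite -expRM_natl mulrCA divff ?mulr1// gt_eqF.
Qed.

Lemma poly_expR (P : {poly R}) : exists2 C, 0 <= C &
  forall y, 0 <= y -> `|P.[y]| <= C * expR y.
Proof.
have [C C0 [n Pn]] := poly_bound P; have [D D0 nD] := pow_expR n.
exists (C * D) => [|y y0]; first exact: mulr_ge0.
apply: le_trans (Pn y) _; rewrite -mulrA ler_wpM2l//.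
by rewrite ger0_norm//; exact: nD.
Qed.

(* The class [P (1/x) exp (-1/x)] is closed under differentiation, which gives
   the smoothness of [bump]. *)
Definition flat (P : {poly R}) x : R :=
  if 0 < x then P.[x^-1] * expR (- x^-1) else 0.

(** The exponential also beats [P * 'X^2] evaluated at [x^-1]. The spare factor [x ^+ 2] is what
    makes [flat P] differentiable at 0. *)
Lemma flat_bound P : exists2 C, 0 <= C & forall x, `|flat P x| <= C * x ^+ 2.
Proof.
have [C C0 hC] := poly_expR (P * 'X^2).
exists C => // x; rewrite /flat; case: ifP => [x0|_]; last first.
  by rewrite normr0 mulr_ge0 ?sqr_ge0.
have xi0 : 0 < x^-1 by rewrite invr_gt0.
have := hC _ (ltW xi0); rewrite hornerM hornerXn (normrM _ (x^-1 ^+ 2)) (normrM _ (expR _)).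
rewrite (@ger0_norm _ (x^-1 ^+ 2)) ?sqr_ge0// (@ger0_norm _ (expR _)) ?expR_ge0//.
rewrite expRN => h; rewrite ler_pdivrMr ?expR_gt0//.
have -> : `|P.[x^-1]| = (`|P.[x^-1]| * x^-1 ^+ 2) * x ^+ 2.
  by rewrite -mulrA -exprMn mulVf ?gt_eqF// expr1n mulr1.
by rewrite (mulrAC C) ler_wpM2r// sqr_ge0.
Qed.

(** The polynomial comes from differentiating [P (1/x) exp (-1/x)] with [(1/x)' = - 1/x^2]. At 0 the
    slope [flat P z / z] is at most [C |z|] in absolute value by [flat_bound]. *)
Lemma flat_deriv P : has_deriv (flat P) (flat ('X^2 * (P - P^`()))).
Proof.
move=> x; have [x0|x0|->] := ltgtP x 0.
- have -> : flat ('X^2 * (P - P^`())) x = 0 by rewrite /flat ltNge ltW.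
  have h : is_derive x 1 (fun=> 0 : R) (0 : R) by exact: is_derive_cst.
  apply: (near_eq_is_derive _ h).
  near=> y; rewrite /flat ltNge ltW//.
  by near: y; exact: lt_nbhsl.
- have nx0 : x != 0 by rewrite gt_eqF.
  have dV : is_derive x 1 (fun y : R => y^-1) (- x ^- 2 *: 1).
    exact: (is_deriveV (f := id)).
  have dP : is_derive x 1 (fun y : R => P.[y^-1]) (P^`().[x^-1] * (- x ^- 2 *: 1)).
    exact: (@is_derive1_comp _ (horner P) (fun y => y^-1)).
  have dN : is_derive x 1 (fun y : R => - y^-1) (- (- x ^- 2 *: 1)).
    exact: is_deriveN.
  have dE : is_derive x 1 (fun y : R => expR (- y^-1))
      (expR (- x^-1) * (- (- x ^- 2 *: 1))).
    exact: (@is_derive1_comp _ expR (fun y => - y^-1)).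
  have h := is_deriveM dP dE.
  have E : \forall y \near x, P.[y^-1] * expR (- y^-1) = flat P y.
    near=> y; rewrite /flat ifT//.
    by near: y; exact: lt_nbhsr.
  apply: (near_eq_is_derive E); apply: (is_derive_eq h).
  rewrite /flat x0 !hornerE /GRing.scale/= !mulr1 -exprVn; ring.
- rewrite [X in is_derive _ _ _ X](_ : _ = 0); last by rewrite /flat ltxx.
  have [C C0 hC] := flat_bound P.
  apply/is_derive1_caratheodory.
  exists (fun z => flat P z / z); split.
  + move=> z; rewrite subr0 {2}/flat ltxx subr0.
    have [->|z0] := eqVneq z 0; first by rewrite mulr0 /flat ltxx.
    by rewrite -mulrA mulVf// mulr1.
  + apply/cvgrPdist_le => e e0; exists (e / (C + 1)) => /=.
      by rewrite divr_gt0//; lra.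
    move=> y /=; rewrite invr0 mulr0 !sub0r !normrN => hy.
    have [->|y0] := eqVneq y 0; first by rewrite invr0 mulr0 normr0 ltW.
    rewrite normrM normfV ler_pdivrMr ?normr_gt0//.
    apply: le_trans (hC y) _; rewrite -real_normK ?num_real// expr2 mulrA.
    rewrite ler_wpM2r//.
    have := ltW hy; rewrite ler_pdivlMr; last by lra.
    by have := normr_ge0 y; nra.
  + by rewrite invr0 mulr0.
Unshelve. all: by end_near. Qed.

Definition bump x : R := flat 1 x * flat 1 (- 1 * x + 1).

Lemma bump_smooth n : Dk n bump.
Proof.
have Df m : Dk m (flat 1).
  suff sf : smoothR (flat 1) by exact: (smoothRP _).1 sf m.
  have cl f : (exists P, f = flat P) ->
      exists2 g, exists P, g = flat P & has_deriv f g.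
    move=> [P ->]; exists (flat ('X^2 * (P - P^`()))); first by eexists.
    exact: flat_deriv.
  have f1 : exists P, flat 1 = flat P by exists 1.
  exact: (smooth_class cl f1).1.
by apply: DkM => //; exact: Dk_affine.
Qed.

Lemma flat1_ge0 x : 0 <= flat 1 x.
Proof. by rewrite /flat; case: ifP => // _; rewrite hornerE mul1r expR_ge0. Qed.

Lemma flat1_le1 x : flat 1 x <= 1.
Proof.
rewrite /flat; case: ifP => // x0; rewrite hornerE mul1r -expR0 ler_expR.
by rewrite oppr_le0 invr_ge0 ltW.
Qed.

Lemma bump_ge0 x : 0 <= bump x.
Proof. by rewrite mulr_ge0 ?flat1_ge0. Qed.

Lemma bump_le1 x : bump x <= 1.
Proof. by rewrite mulr_ile1 ?flat1_ge0 ?flat1_le1. Qed.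

Lemma bump_gt0 x : 0 < x -> x < 1 -> 0 < bump x.
Proof.
move=> x0 x1; rewrite /bump /flat x0 ifT; last by lra.
by rewrite !hornerE !mulr_gt0 ?expR_gt0.
Qed.

Lemma bump0 x : ~~ (0 < x < 1) -> bump x = 0.
Proof.
rewrite negb_and -!leNgt => /orP[x0|x1]; rewrite /bump /flat.
  by rewrite ltNge x0/= mul0r.
by rewrite [X in _ * X]ifF ?mulr0//; apply/negbTE; rewrite -leNgt; lra.
Qed.

Lemma bump_continuous : continuous bump.
Proof.
by have [/derivable_deriv/deriv_continuous] := bump_smooth 1.
Qed.

Lemma L1_bump : L1 bump.
Proof.
apply: (L1_dom _ _ (L1_itvi 0 1)).
  exact: cont_meas bump_continuous.
move=> x; rewrite ger0_norm ?bump_ge0// itviE.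
have [_|h] := boolP (_ && _); first exact: bump_le1.
rewrite bump0//; apply: contra h => /andP[h1 h2].
by rewrite !ltW.
Qed.

Lemma Int_bump_gt0 : 0 < Int bump.
Proof.
rewrite lt_neqAle (Int_ge0 bump_ge0) andbT eq_sym.
apply/eqP => I0; have b0 := Int_ae0 L1_bump bump_ge0 I0.
have c0 : continuous ((fun=> 0) : R -> R) by move=> ?; exact: cvg_cst.
have := ae_eq_continuous bump_continuous c0 b0 (2^-1).
have := @bump_gt0 (2^-1); rewrite invr_gt0 ltr0n/=.
rewrite invf_lt1 ?ltr1n ?ltr0n// => /(_ isT isT) h E.
by move: h; rewrite E ltxx.
Qed.

End Smoothness.

(** * The du Bois-Reymond lemma *)

Section DuBoisReymond.
Variable R : realType.
Local Notation mu := (@lebesgue_measure R).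
Local Notation meas := (measurable_fun [set: R]).
Implicit Types (f g : R -> R) (a b x : R).

(** The oriented integral from 0 to [x]: the second weight is zero for [x > 0], the first for
    [x < 0]. *)
Definition prim0 g x : R :=
  Int (fun y => itvi 0 x y * g y) - Int (fun y => itvi x 0 y * g y).

Lemma Int_itvi_le0 g a b : b <= a -> meas g -> Int (fun x => itvi a b x * g x) = 0.
Proof.
move=> ba mg; rewrite -(@Int0 R); apply: aeq_Int.
- by apply: measurable_funM mg; exact: meas_itvi.
- exact: measurable_cst.
apply/aeP; exists [set a]; split; [exact: measurable_set1|
  exact: lebesgue_measure_set1|].
move=> x /= xa; rewrite itvi0 ?mul0r//; apply/negP => /andP[ax xb].
by apply: xa; apply/le_anti; rewrite ax (le_trans xb ba).
Qed.

Lemma prim_prim0 g : L1loc g -> prim (prim0 g) g.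
Proof.
move=> Lg; split=> // a b ab; have mg := Lg.1; rewrite /prim0.
have Z u v : v <= u -> Int (fun x => itvi u v x * g x) = 0.
  by move=> vu; exact: Int_itvi_le0.
have C := itvi_cut _ _ Lg.
have [a0|a0] := leP 0 a.
  rewrite (Z a 0)// (Z b 0) ?(le_trans a0 ab)// !subr0 (C _ _ _ a0 ab).
  by rewrite addrAC subrr add0r.
rewrite (Z 0 a) ?ltW//; have [b0|b0] := leP 0 b.
  by rewrite (Z b 0)// (C _ _ _ (ltW a0) b0); ring.
by rewrite (Z 0 b) ?ltW// (C _ _ _ ab (ltW b0)); ring.
Qed.

Definition cpt_supp f := exists B : R, forall x, B < `|x| -> f x = 0.

Lemma L1_cpt h phi : L1loc h -> continuous phi -> cpt_supp phi ->
  L1 (fun x => h x * phi x).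
Proof.
move=> Lh cphi [B phiB].
have L := (L1locM cphi Lh).2 (- B) B.
apply: eq_L1 L => x; rewrite itviE -ler_norml.
have [_|] := boolP (`|x| <= B); first by rewrite mul1r mulrC.
by rewrite -ltNge => /phiB ->; rewrite mul0r !mulr0.
Qed.

Lemma prim_test f g phi phi' : prim f g -> has_deriv phi phi' ->
  continuous phi' -> cpt_supp phi -> cpt_supp phi' ->
  Int (fun x => f x * phi' x) = - Int (fun x => g x * phi x).
Proof.
move=> pf dphi cphi' sphi sphi'.
have cphi := deriv_continuous dphi.
have Lf : L1loc f := L1loc_cont (prim_continuous pf).
have Lg : L1loc g := pf.1.
have L1' := L1_cpt Lg cphi sphi; have L2' := L1_cpt Lf cphi' sphi'.
have := prim_Int0 (primM pf (derive_prim cphi' dphi)) (L1_cpt Lf cphi sphi)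
  (L1D L1' L2').
by rewrite (IntD L1' L2') => /eqP; rewrite addrC addr_eq0 => /eqP.
Qed.

(** The mean oscillation over a ball, which has length [2 * r], is eventually below [e / 2];
    multiplied out this is [r * e]. *)
Lemma lebesgue_pt_small w a e : L1loc w -> lebesgue_pt w a -> 0 < e ->
  exists2 d, 0 < d & forall r, 0 < r -> r < d ->
    Int (fun y => itvi (a - r) (a + r) y * `|w y - w a|) <= r * e.
Proof.
move=> Lw la e0.
have e20 : (0 < (e / 2)%:E)%E by rewrite lte_fin; lra.
have mw : meas (fun y => w y - w a).
  by apply: measurable_funB; [exact: Lw.1|exact: measurable_cst].
have /fine_cvgP[fin_d /cvgrPdist_lt/(_ (e / 2)) cvg_d] := la.
have [d /= d0 hd] : \forall r \near 0^'+,
    davg w a r \is a fin_num /\ `|0 - fine (davg w a r)| < e / 2.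
  by apply: filterI; [exact: fin_d|apply: cvg_d; lra].
exists d => // r r0 rd.
have br : ball_ [eta Num.Def.normr] 0 d r by rewrite /ball_ /= sub0r normrN gtr0_norm.
have [_ hr] := hd r br r0; move: hr.
rewrite /davg /iavg (lebesgue_measure_ball a (ltW r0)).
have LW : L1 (fun y => itvi (a - r) (a + r) y * `|w y - w a|).
  have := (L1locB Lw (L1loc_cst (w a))).2 (a - r) (a + r) => /L1_norm.
  by apply: eq_L1 => y; rewrite normrM ger0_norm ?itvi_ge0.
have -> : (\int[mu]_(y in ball a r) `|((center (w a) \o w) y)%:E| =
    (Int (fun y => itvi (a - r) (a + r) y * `|w y - w a|))%:E)%E.
  have mab : measurable_fun setT (fun y => `|((center (w a) \o w) y)%:E|%E).
    by apply: (measurableT_comp (f := abse)) => //; exact/measurable_EFinP.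
  rewrite ball_itv EFin_Int// integral_itv_bndo_bndc; last exact: measurable_funTS.
  rewrite integral_itv_obnd_cbnd; last exact: measurable_funTS.
  rewrite integral_mkcond; apply: eq_integral => y _.
  by rewrite patchE /itvi indicE; case: ifP => _; rewrite ?mul1r ?mul0r.
rewrite inver mulrn_eq0 /= gt_eqF// -EFinM /= sub0r normrN ger0_norm; last first.
  apply: mulr_ge0; first by rewrite invr_ge0 mulrn_wge0// ltW.
  by apply: Int_ge0 => y; rewrite mulr_ge0 ?itvi_ge0.
rewrite ltr_pdivrMl ?mulrn_wgt0// -mulr_natr => h.
by apply: le_trans (ltW h) _; rewrite le_eqVlt; apply/orP; left; apply/eqP; field.
Qed.

(* Testing against the smoothed indicator of [a, b], whose derivative is the
   difference of two approximate identities, compares [w] at [a] and [b]. *)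
Definition plateau (e a x : R) : R := prim0 (@bump R) (e^-1 * x + - (e^-1 * a)).

Lemma prim0_bump : has_deriv (prim0 (@bump R)) (@bump R).
Proof.
move=> x; apply: prim_derive; first exact/prim_prim0/L1_L1loc/L1_bump.
exact: bump_continuous.
Qed.

Lemma prim0_bump_const x : ~~ (0 < x < 1) ->
  prim0 (@bump R) x = if x <= 0 then 0 else Int (@bump R).
Proof.
have pb := prim_prim0 (L1_L1loc (@L1_bump R)).
have p00 : prim0 (@bump R) 0 = 0 by rewrite /prim0 subrr.
rewrite negb_and -!leNgt => x01; case: ifP => [x0|/negbT].
  have := pb.2 _ _ x0; rewrite p00 sub0r => /eqP.
  rewrite eqr_oppLR => /eqP ->; rewrite -[RHS]oppr0; congr (- _).
  rewrite -[RHS](@Int0 R); apply: eq_Int => y; rewrite itviE.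
  have [/andP[xy y0]|] := boolP (_ && _); last by rewrite mul0r.
  by rewrite bump0 ?mulr0// negb_and -!leNgt y0.
rewrite -ltNge => x0; have x1 : 1 <= x.
  by move: x01; rewrite leNgt x0.
have := pb.2 _ _ (ltW x0); rewrite p00 subr0 => ->.
apply: eq_Int => y; rewrite itviE.
have [|] := boolP (_ && _); first by rewrite mul1r.
move=> h; rewrite mul0r bump0//; apply: contra h => /andP[y0 y1].
by rewrite ltW//= (le_trans (ltW y1)).
Qed.

Lemma plateau_deriv e a :
  has_deriv (plateau e a) (fun x => bump (e^-1 * x + - (e^-1 * a)) * e^-1).
Proof. exact: deriv_comp prim0_bump (deriv_affine _ _). Qed.

Lemma cont_plateau_deriv e a :
  continuous (fun x => @bump R (e^-1 * x + - (e^-1 * a)) * e^-1).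
Proof.
suff [/derivable_deriv/deriv_continuous] :
  Dk 1 (fun x => @bump R (e^-1 * x + - (e^-1 * a)) * e^-1) by [].
by apply: DkM; [apply: Dk_affine; exact: bump_smooth|exact: Dk_cst].
Qed.

Lemma plateau_smooth n e a : Dk n (plateau e a).
Proof.
case: n => [//|n]; apply: Dk_deriv (plateau_deriv e a) _.
apply: DkM; last exact: Dk_cst.
by apply: Dk_affine; exact: bump_smooth.
Qed.

Lemma prim0_bump_ge1 x : 1 <= x -> prim0 (@bump R) x = Int (@bump R).
Proof.
move=> x1; rewrite prim0_bump_const; last first.
  by apply/negP => /andP[_]; rewrite ltNge x1.
by rewrite ifF//; apply/negbTE; rewrite -ltNge (lt_le_trans ltr01).
Qed.

Lemma prim0_bump_le0 x : x <= 0 -> prim0 (@bump R) x = 0.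
Proof.
move=> x0; rewrite prim0_bump_const ?x0//.
by apply/negP => /andP[]; rewrite ltNge x0.
Qed.

Lemma test_const w : L1loc w ->
  (forall phi, smoothR phi -> cpt_supp phi ->
     Int (fun x => w x * derive1 phi x) = 0) ->
  forall a b, lebesgue_pt w a -> lebesgue_pt w b -> w a = w b.
Proof.
move=> Lw w0.
(* The difference of two plateaus is a legitimate test function: far to the left both are 0, far to
   the right both equal the mass of [bump]. *)
have key e a b : 0 < e ->
    Int (fun x => w x * (bump (e^-1 * x + - (e^-1 * a)) * e^-1)) =
    Int (fun x => w x * (bump (e^-1 * x + - (e^-1 * b)) * e^-1)).
  move=> e0.
  have cs c : cpt_supp (fun x => @bump R (e^-1 * x + - (e^-1 * c)) * e^-1).
    exists (`|c| + e) => x hx; rewrite bump0 ?mul0r// -mulrBr.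
    apply/negP => /andP[]; rewrite pmulr_rgt0 ?invr_gt0// => h1.
    rewrite mulrC ltr_pdivrMr// mul1r => h2; move: hx; rewrite ltNge.
    apply/negP/negPn; rewrite ler_norml; have := ler_norm c.
    by have := ler_norm (- c); rewrite normrN => ? ?; apply/andP; split; lra.
  pose phi x := plateau e a x - plateau e b x.
  have dphi := derivB (plateau_deriv e a) (plateau_deriv e b).
  have sphi : cpt_supp phi.
    exists (`|a| + `|b| + e) => x hx; rewrite /phi /plateau -!mulrBr.
    have na := ler_norm a; have nb := ler_norm b.
    have na' := ler_norm (- a); have nb' := ler_norm (- b).
    rewrite normrN in na'; rewrite normrN in nb'.
    have pa : 0 <= `|a| by []. have pb : 0 <= `|b| by [].
    have e1 : 0 < e^-1 by rewrite invr_gt0.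
    have [x0|x0] := leP 0 x.
      rewrite (ger0_norm x0) in hx.
      have big c : e <= x - c -> 1 <= e^-1 * (x - c).
        by move=> ?; rewrite mulrC ler_pdivlMr// mul1r.
      have ca : 1 <= e^-1 * (x - a) by apply: big; lra.
      have cb : 1 <= e^-1 * (x - b) by apply: big; lra.
      by rewrite !prim0_bump_ge1// subrr.
    rewrite (ltr0_norm x0) in hx.
    have ca : e^-1 * (x - a) <= 0 by rewrite pmulr_rle0//; lra.
    have cb : e^-1 * (x - b) <= 0 by rewrite pmulr_rle0//; lra.
    by rewrite !prim0_bump_le0// subrr.
  have smphi : smoothR phi.
    by apply/smoothRP => n; apply: DkB; exact: plateau_smooth.
  have := w0 _ smphi sphi; rewrite (deriv_derive1 dphi).
  under eq_Int do rewrite mulrBr.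
  rewrite (IntB (L1_cpt Lw (@cont_plateau_deriv e a) (cs a))
                (L1_cpt Lw (@cont_plateau_deriv e b) (cs b))).
  by move=> /eqP; rewrite subr_eq0 => /eqP.
move=> a b la lb.
have c0 := @Int_bump_gt0 R; set c := Int _ in c0.
(* At a Lebesgue point the mollified value is close to [w a'] times the mass [c]. The mollifier is
   at most [r^-1] and lives on [[a', a' + r]], so the symmetric interval of [lebesgue_pt_small]
   covers it. *)
have near_val e a' : lebesgue_pt w a' -> 0 < e -> exists2 d, 0 < d &
    forall r, 0 < r -> r < d ->
  `|Int (fun x => w x * (bump (r^-1 * x + - (r^-1 * a')) * r^-1)) - w a' * c|
     <= e.
  move=> la' e0; have [d d0 hd] := lebesgue_pt_small Lw la' e0.
  exists d => // r' r0 rd; apply: le_trans (_ : r'^-1 * (r' * e) <= _); last first.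
    by rewrite mulrA mulVf ?mul1r// gt_eqF.
  apply: le_trans (_ : r'^-1 *
    Int (fun y => itvi (a' - r') (a' + r') y * `|w y - w a'|) <= _); last first.
    by apply: ler_wpM2l; [rewrite invr_ge0 ltW|exact: hd].
  have ri0 : 0 < r'^-1 by rewrite invr_gt0.
  have [Ls Is] := Int_scale ri0 (Int_shift (- (r'^-1 * a')) (@L1_bump R)).1.
  rewrite (Int_shift _ (@L1_bump R)).2 invrK -/c in Is.
  have csr : cpt_supp (fun x => @bump R (r'^-1 * x + - (r'^-1 * a')) * r'^-1).
    exists (`|a'| + r') => x hx; rewrite bump0 ?mul0r// -mulrBr.
    apply/negP => /andP[]; rewrite pmulr_rgt0// => h1.
    rewrite mulrC ltr_pdivrMr// mul1r => h2; move: hx; rewrite ltNge.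
    apply/negP/negPn; rewrite ler_norml; have := ler_norm a'.
    by have := ler_norm (- a'); rewrite normrN => ? ?; apply/andP; split; lra.
  have Lwb := L1_cpt Lw (@cont_plateau_deriv r' a') csr.
  have -> : w a' * c = Int (fun x => (w a' * r'^-1) *
      @bump R (r'^-1 * x + - (r'^-1 * a'))).
    by rewrite (IntZ _ Ls) Is mulrA -(mulrA (w a')) mulVf ?gt_eqF// mulr1.
  rewrite -(IntB Lwb (L1Z _ Ls)).
  have Lwn : L1 (fun y => itvi (a' - r') (a' + r') y * `|w y - w a'|).
    have := (L1locB Lw (L1loc_cst (w a'))).2 (a' - r') (a' + r') => /L1_norm.
    by apply: eq_L1 => y; rewrite normrM ger0_norm ?itvi_ge0.
  rewrite -(IntZ _ Lwn); apply: le_trans (le_norm_Int (L1B Lwb (L1Z _ Ls))) _.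
  apply: le_Int; [exact: L1_norm (L1B Lwb (L1Z _ Ls))|exact: L1Z|move=> x].
  set B := bump _.
  have -> : w x * (B * r'^-1) - w a' * r'^-1 * B = r'^-1 * (B * (w x - w a')).
    by ring.
  rewrite normrM (gtr0_norm ri0) ler_wpM2l ?(ltW ri0)// normrM.
  rewrite ler_wpM2r// ger0_norm ?bump_ge0// itviE.
  have [_|h] := boolP (_ && _); first exact: bump_le1.
  rewrite /B bump0// -mulrBr; apply: contra h => /andP[].
  rewrite pmulr_rgt0// => h1; rewrite mulrC ltr_pdivrMr// mul1r => h2.
  by apply/andP; split; lra.
suff : w a * c = w b * c by apply: mulIf; rewrite gt_eqF.
apply/eqP; rewrite -subr_eq0 -normr_eq0; apply/eqP/le_anti.
rewrite normr_ge0 andbT; apply/ler_addgt0Pl => e e0; rewrite addr0.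
have e20 : 0 < e / 2 by lra.
have [d1 d10 h1] := near_val _ a la e20.
have [d2 d20 h2] := near_val _ b lb e20.
pose r := Num.min d1 d2 / 2.
have m0 : 0 < Num.min d1 d2 by rewrite lt_min d10.
have m1 : Num.min d1 d2 <= d1 by rewrite ge_min lexx.
have m2 : Num.min d1 d2 <= d2 by rewrite ge_min lexx orbT.
have r0 : 0 < r by rewrite /r; lra.
have rd1 : r < d1 by rewrite /r; lra.
have rd2 : r < d2 by rewrite /r; lra.
have {h1} := h1 r r0 rd1; have {h2} := h2 r r0 rd2; rewrite (key r a b r0).
move: (Int _) (w a * c) (w b * c) => I A B hB hA.
have -> : A - B = (I - B) - (I - A) by ring.
by apply: le_trans (ler_normB _ _) _; rewrite (splitr e) lerD.
Qed.

Lemma L1loc_locally w : L1loc w -> @locally_integrable R setT w.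
Proof.
move=> [mw Lw]; split=> //; first exact: openT.
move=> K _ cK; have [B [_ hB]] := compact_bounded cK.
have /integrableP[_] := L1_norm (Lw (- (B + 1)) (B + 1)); apply: le_lt_trans.
rewrite integral_mkcond; apply: ge0_le_integral => //.
- by move=> x _; rewrite patchE; case: ifP => // _; rewrite lee_fin.
- apply/(measurable_restrictT _ (compact_measurable cK)).
  by apply: measurable_funTS; exact/measurable_EFinP/meas_norm.
- apply/measurable_EFinP; apply: meas_norm; apply: meas_norm.
  by apply: measurable_funM mw; exact: meas_itvi.
- move=> x _; rewrite patchE; case: ifP => [/set_mem Kx|_].
  + rewrite lee_fin normr_id itvi1 ?mul1r//= -ler_norml.
    by apply: (hB _ _ x Kx); rewrite ltrDl.
  + by rewrite lee_fin.
Qed.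

Lemma ae_inhabited (P : R -> Prop) : {ae mu, forall x, P x} -> exists x, P x.
Proof.
move=> /aeP[N [mN N0 NP]]; apply: contrapT => nP.
have NT : N = setT.
  by apply/seteqP; split=> // x _; apply: contrapT => /NP Px; apply: nP; exists x.
have : (mu `[0%R, 1%R] <= mu N)%E by apply: le_measure; rewrite ?inE ?NT.
rewrite N0 lebesgue_measure_itv/= lte_fin ltr01 oppr0 adde0 lee_fin.
by rewrite leNgt ltr01.
Qed.

Lemma cpt_supp_deriv phi : smoothR phi -> cpt_supp phi -> cpt_supp (derive1 phi).
Proof.
move=> sm [B hB]; exists B => x Bx; rewrite derive1E.
have h0 : is_derive x 1 (fun=> 0 : R) (0 : R) by exact: is_derive_cst.
suff h : is_derive x 1 phi 0 by exact: derive_val.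
apply: (near_eq_is_derive _ h0).
have : \forall y \near x, B < `|y|.
  have /cvgr_gt : `|y| @[y --> x] --> `|x| by exact: norm_continuous.
  exact.
by apply: filterS => y /hB ->.
Qed.

(** [f - prim0 g] has zero weak derivative, so by [test_const] it takes a single value at all of its
    Lebesgue points, that is, almost everywhere. *)
Lemma weak_prim f g : L1loc f -> L1loc g ->
  (forall phi, smoothR phi -> cpt_supp phi ->
     Int (fun x => f x * derive1 phi x) = - Int (fun x => g x * phi x)) ->
  exists2 F, prim F g & aeq f F.
Proof.
move=> Lf Lg fg; have pg := prim_prim0 Lg.
have Lp : L1loc (prim0 g) := L1loc_cont (prim_continuous pg).
pose w x := f x - prim0 g x; have Lw : L1loc w := L1locB Lf Lp.
have w0 phi : smoothR phi -> cpt_supp phi ->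
    Int (fun x => w x * derive1 phi x) = 0.
  move=> sm cs; have [dphi sm'] := smoothR_deriv sm.
  have cphi' := deriv_continuous (smoothR_deriv sm').1.
  have cs' := cpt_supp_deriv sm cs.
  under eq_Int do rewrite mulrBl.
  rewrite (IntB (L1_cpt Lf cphi' cs') (L1_cpt Lp cphi' cs')) fg//.
  by rewrite (prim_test pg dphi cphi' cs cs') subrr.
have cst := test_const Lw w0.
have lw := lebesgue_differentiation (L1loc_locally Lw).
have [a la] := ae_inhabited lw.
exists (fun x => prim0 g x + w a).
  have := primD pg (prim_cst (w a)); apply: eq_prim => // x.
  by rewrite addr0.
by apply: ae_imp lw => x lx; rewrite (cst a x la lx) /w addrC subrK.
Qed.

End DuBoisReymond.

(** * Hartley transform *)

Section Hartley.
Variable R : realType.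
Local Notation mu := (@lebesgue_measure R).
Local Notation T := (measurableTypeR R).
Local Notation meas := (measurable_fun [set: R]).
Local Notation meas2 := (measurable_fun [set: T * T]).
Implicit Types (P Q : R -> R) (x s xi : R).

Lemma Int_param_deriv (k k' : R -> R -> R) G :
  (forall xi, L1 (k xi)) -> (forall x, has_deriv (k ^~ x) (k' ^~ x)) ->
  L1 G -> (forall xi x, `|k' xi x| <= G x) ->
  has_deriv (fun xi => Int (k xi)) (fun xi => Int (k' xi)).
Proof.
move=> Lk dk LG kG xi.
have p1 z y : partial1of2 k z y = k' z y.
  by rewrite /partial1of2 (deriv_derive1 (dk y)).
have Ia : `]xi - 1, xi + 1[%classic xi.
  by rewrite /= in_itv/=; apply/andP; split; lra.
have df z y : `]xi - 1, xi + 1[%classic z -> [set: R] y -> derivable (k ^~ y) z 1.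
  by move=> _ _; exact: deriv_derivable (dk y) z.
have G0 y : 0 <= G y by rewrite (le_trans _ (kG xi y)).
have kG' z y : `]xi - 1, xi + 1[%classic z -> [set: R] y ->
    `|partial1of2 k z y| <= G y by move=> _ _; rewrite p1.
have Lk' z : `]xi - 1, xi + 1[%classic z -> mu.-integrable setT (EFin \o k z).
  by move=> _; exact: Lk.
have D := derivable_under_integral (mu := mu) measurableT Ia Lk' df G0 LG kG'.
have E := differentiation_under_integral (mu := mu) measurableT Ia Lk' df G0 LG kG'.
apply: DeriveDef; first exact: D.
rewrite -derive1E E; apply: eq_Rintegral => y _; exact: p1.
Qed.

(* The real kernel cos + sin replaces exp (i x xi), so that all Fourier analysis
   is done on real functions. *)
Definition cas x : R := cos x + sin x.

Lemma cas_le2 x : `|cas x| <= 2.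
Proof.
apply: le_trans (ler_normD _ _) _; rewrite [leRHS](_ : _ = 1 + 1) ?lerD//.
- exact: cos_max.
- exact: sin_max.
Qed.

Lemma casD x y : cas (x + y) = cos y * cas x + sin y * cas (- x).
Proof. by rewrite /cas cosD sinD cosN sinN; ring. Qed.

Lemma casM x y : cas x * cas y =
  2^-1 * (cas (x - y) + cas (y - x) + cas (x + y) - cas (- (x + y))).
Proof.
by rewrite /cas (cosN (x + y)) (sinN (x + y)) !cosD !sinD !cosN !sinN; field.
Qed.

Lemma cos_cas x : cos x = (cas x + cas (- x)) / 2.
Proof. by rewrite /cas cosN sinN; field. Qed.

Lemma sin_cas x : sin x = (cas x - cas (- x)) / 2.
Proof. by rewrite /cas cosN sinN; field. Qed.

Lemma cas0 : cas 0 = 1.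
Proof. by rewrite /cas cos0 sin0 addr0. Qed.

Lemma deriv_cos : has_deriv (@cos R) (fun x => - sin x).
Proof. by move=> x; exact: is_derive_cos. Qed.

Lemma deriv_sin : has_deriv (@sin R) (@cos R).
Proof. by move=> x; exact: is_derive_sin. Qed.

Lemma deriv_expR : has_deriv (@expR R) (@expR R).
Proof. by move=> x; exact: is_derive_expR. Qed.

Lemma deriv_cas : has_deriv cas (fun x => cas (- x)).
Proof.
have := derivD deriv_cos deriv_sin.
by congr has_deriv; apply/funext => x; rewrite /cas cosN sinN addrC.
Qed.

Lemma cont_cas : continuous cas.
Proof. exact: deriv_continuous deriv_cas. Qed.

Lemma deriv_scale s : has_deriv (fun x => s * x) (fun=> s).
Proof.
have := deriv_affine s 0.
by congr has_deriv; apply/funext => x; rewrite addr0.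
Qed.

Lemma deriv_cas_scale xi :
  has_deriv (fun x => cas (x * xi)) (fun x => xi * cas (- (x * xi))).
Proof.
have := deriv_comp deriv_cas (deriv_scale xi).
congr has_deriv; apply/funext => x; first by rewrite mulrC.
by rewrite mulrC (mulrC x).
Qed.

Lemma meas_cas : meas cas.
Proof. exact: cont_meas cont_cas. Qed.

Lemma meas_cas_scale xi : meas (fun x => cas (x * xi)).
Proof. exact: cont_meas (deriv_continuous (deriv_cas_scale xi)). Qed.

Lemma meas2_cas : meas2 (fun z : R * R => cas (z.1 * z.2)).
Proof.
apply: (measurableT_comp meas_cas).
by apply: measurable_funM.
Qed.

Definition H P xi := Int (fun x => P x * cas (x * xi)).

Lemma L1_cas P xi : L1 P -> L1 (fun x => P x * cas (x * xi)).
Proof. by move=> LP; exact: L1_bounded LP (meas_cas_scale xi) (fun=> cas_le2 _). Qed.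

Lemma H_swap P Q : L1 P -> L1 Q ->
  Int (fun x => P x * H Q x) = Int (fun x => Q x * H P x).
Proof.
move=> LP LQ; have := Int_swap LP LQ meas2_cas (fun=> cas_le2 _).
move=> E; transitivity (Int (fun x => P x * Int (fun y => Q y * cas (x * y)))).
  by apply: eq_Int => x; congr (_ * _); apply: eq_Int => y; rewrite (mulrC y).
exact: E.
Qed.

Lemma HD P Q : L1 P -> L1 Q -> forall xi,
  H (fun x => P x + Q x) xi = H P xi + H Q xi.
Proof.
move=> LP LQ xi; rewrite /H -(IntD (L1_cas xi LP) (L1_cas xi LQ)).
by apply: eq_Int => x; rewrite mulrDl.
Qed.

Lemma HZ k P : L1 P -> forall xi, H (fun x => k * P x) xi = k * H P xi.
Proof.
move=> LP xi; rewrite /H -(IntZ _ (L1_cas xi LP)).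
by apply: eq_Int => x; rewrite mulrA.
Qed.

Lemma H_opp P : L1 P -> forall xi, H (fun x => P (- x)) xi = H P (- xi).
Proof.
move=> LP xi; rewrite /H; have /= <- := (Int_opp (L1_cas xi (Int_opp LP).1)).2.
by apply: eq_Int => x; rewrite opprK mulrN mulNr.
Qed.

Lemma H_bound P xi : L1 P -> `|H P xi| <= 2 * Int (fun x => `|P x|).
Proof.
move=> LP; apply: le_trans (le_norm_Int (L1_cas xi LP)) _.
rewrite -(IntZ _ (L1_norm LP)); apply: le_Int; first exact: L1_norm (L1_cas xi LP).
  exact: L1Z (L1_norm LP).
by move=> x; rewrite normrM mulrC ler_wpM2r// cas_le2.
Qed.

(** Since [cas' x = cas (- x)], differentiation multiplies by [x] and reflects. The reflection is
    moved onto [P], so that the derivative is again a Hartley transform. *)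
Lemma H_deriv P : L1 P -> L1 (fun x => x * P x) ->
  has_deriv (H P) (H (fun x => - (x * P (- x)))).
Proof.
move=> LP LxP.
have LD : L1 (fun x => - (x * P (- x))).
  by apply: eq_L1 (Int_opp LxP).1 => x; rewrite mulNr.
have -> : H (fun x => - (x * P (- x))) =
    (fun xi => Int (fun x => P x * (x * cas (- (x * xi))))).
  apply/funext => xi; rewrite /H; have /= <- := (Int_opp (L1_cas xi LD)).2.
  by apply: eq_Int => x; rewrite !(opprK, mulNr); ring.
apply: (@Int_param_deriv (fun xi x => P x * cas (x * xi)) _
  (fun x => 2 * `|x * P x|)).
- by move=> xi; exact: L1_cas.
- move=> x; apply: derivZ; have := deriv_cas_scale x.
  by congr has_deriv; apply/funext => y; rewrite (mulrC y).
- exact: L1Z (L1_norm LxP).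
- move=> xi x /=.
  have -> : P x * (x * cas (- (x * xi))) = cas (- (x * xi)) * (x * P x) by ring.
  by rewrite normrM ler_wpM2r// cas_le2.
Qed.

Lemma H_continuous P : L1 P -> continuous (H P).
Proof.
move=> LP xi; have Ia : xi \in `]xi - 1, xi + 1[%classic.
  by rewrite inE/= in_itv/=; apply/andP; split; lra.
have mT : measurable [set: T] by exact: measurableT.
have Lk z : `]xi - 1, xi + 1[%classic z ->
    mu.-integrable setT (EFin \o (fun x => P x * cas (x * z))).
  by move=> _; exact: L1_cas.
have cf : {ae mu, forall y, [set: R] y ->
    {in `]xi - 1, xi + 1[%classic, continuous (fun z => P y * cas (y * z))}}.
  apply: aeW => y _ z _; apply: deriv_continuous.
  apply: derivZ; have := deriv_cas_scale y.
  by congr has_deriv; apply/funext => w; rewrite mulrC.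
have LG : mu.-integrable setT (EFin \o (fun x => 2 * `|P x|)).
  exact: L1Z (L1_norm LP).
have gub z : `]xi - 1, xi + 1[%classic z -> {ae mu, forall y, [set: R] y ->
    `|P y * cas (y * z)| <= 2 * `|P y|}.
  move=> _; apply: aeW => y _.
  by rewrite normrM mulrC ler_wpM2r// cas_le2.
exact: (continuity_under_integral (mu := mu) mT Lk cf LG gub Ia).
Qed.

(** [prim_Int0] for the product of [P] and [cas (x * xi)]; the reflected frequency again comes from
    [cas' x = cas (- x)]. *)
Lemma H_prim P P' xi : prim P P' -> L1 P -> L1 P' ->
  H P' xi = - xi * H P (- xi).
Proof.
move=> pP LP LP'.
have cd : continuous (fun x => xi * cas (- (x * xi))).
  have -> : (fun x => xi * cas (- (x * xi))) = (fun x => xi * cas (x * - xi)).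
    by apply/funext => x; rewrite mulrN.
  exact: deriv_continuous (derivZ xi (deriv_cas_scale (- xi))).
have pc := derive_prim cd (deriv_cas_scale xi).
have L2' : L1 (fun x => P x * (xi * cas (- (x * xi)))).
  apply: eq_L1 (L1Z xi (L1_cas (- xi) LP)) => x.
  by rewrite mulrN; ring.
have := prim_Int0 (primM pP pc) (L1_cas xi LP) (L1D (L1_cas xi LP') L2').
rewrite (IntD (L1_cas xi LP') L2') => /eqP; rewrite addr_eq0 => /eqP E.
rewrite /H E mulNr; congr (- _); rewrite -(IntZ _ (L1_cas (- xi) LP)).
by apply: eq_Int => x; rewrite mulrN; ring.
Qed.

End Hartley.

(** * Gaussians and their transforms *)

Section Gaussians.
Variable R : realType.
Local Notation T := (measurableTypeR R).
Local Notation meas := (measurable_fun [set: R]).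
Implicit Types (a b x t s xi : R).

Definition gs t x : R := expR (- (t * x ^+ 2)).

Lemma gs_ge0 t x : 0 <= gs t x. Proof. exact: expR_ge0. Qed.

Lemma gs_opp t x : gs t (- x) = gs t x.
Proof. by rewrite /gs sqrrN. Qed.

Lemma gs0 x : gs 0 x = 1.
Proof. by rewrite /gs mul0r oppr0 expR0. Qed.

Lemma gs_at0 t : gs t 0 = 1.
Proof. by rewrite /gs expr0n/= mulr0 oppr0 expR0. Qed.

Lemma gs_le1 t x : 0 <= t -> gs t x <= 1.
Proof.
by move=> t0; rewrite -expR0 ler_expR oppr_le0 mulr_ge0 ?sqr_ge0.
Qed.

Lemma gsD s t x : gs (s + t) x = gs s x * gs t x.
Proof. by rewrite /gs -expRD; congr expR; ring. Qed.

Lemma deriv_gs t : has_deriv (gs t) (fun x => - (2 * t) * (x * gs t x)).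
Proof.
have d2 : has_deriv (fun x => - (t * x ^+ 2)) (fun x => - (t * (2 * x))).
  apply: derivN; apply: derivZ => x.
  have -> : (fun y : R => y ^+ 2) = (fun y => (1 * y + 0) * (1 * y + 0)).
    by apply/funext => y; ring.
  have h := derivM (deriv_affine 1 0) (deriv_affine 1 0) x.
  by apply: (is_derive_eq h); ring.
have := deriv_comp (@deriv_expR R) d2.
by congr has_deriv; apply/funext => x; rewrite /gs; ring.
Qed.

Lemma cont_gs t : continuous (gs t).
Proof. exact: deriv_continuous (deriv_gs t). Qed.

Lemma meas_gs t : meas (gs t).
Proof. exact: cont_meas (@cont_gs t). Qed.

Lemma gs_int t : 0 < t -> L1 (gs t) /\ Int (gs t) = (Num.sqrt t)^-1 * Num.sqrt pi.
Proof.
move=> t0; have r0 : 0 < Num.sqrt t by rewrite sqrtr_gt0.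
have L1g : L1 (@gauss_fun R) by exact: integrableT_gauss.
have [L I] := Int_scale r0 L1g.
have E x : gauss_fun (Num.sqrt t * x) = gs t x.
  by rewrite /gauss_fun /gs exprMn sqr_sqrtr// ltW.
split; first exact: eq_L1 L.
rewrite -(eq_Int E) I; congr (_ * _).
by rewrite /Int /Rintegral integralT_gauss.
Qed.

Lemma L1_gs t : 0 < t -> L1 (gs t).
Proof. by move=> /gs_int[]. Qed.

Definition cg t := Int (gs t).

Lemma cg_gt0 t : 0 < t -> 0 < cg t.
Proof.
move=> t0; rewrite /cg (gs_int t0).2 mulr_gt0 ?invr_gt0 ?sqrtr_gt0//.
exact: pi_gt0.
Qed.

(** The constant of the inversion formula: [H] sends the parameter [t] to [(4 * t)^-1] and then back
    to [t], each time with the factor [cg]. *)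
Lemma cg_dual t : 0 < t -> cg t * cg (4 * t)^-1 = 2 * pi.
Proof.
move=> t0; have t1 : 0 < (4 * t)^-1 by rewrite invr_gt0 mulr_gt0.
rewrite /cg (gs_int t0).2 (gs_int t1).2 mulrACA -expr2 sqr_sqrtr ?pi_ge0//.
congr (_ * _); rewrite -invfM -sqrtrM ?ltW//.
have -> : t * (4 * t)^-1 = (2^-1) ^+ 2 by field; rewrite gt_eqF.
by rewrite sqrtr_sqr ger0_norm ?invr_ge0// invrK.
Qed.

Lemma pow_gs (n : nat) t : 0 < t -> exists2 C : R, 0 <= C &
  forall x, (1 + `|x|) ^+ n * gs t x <= C.
Proof.
move=> t0; have [C C0 hC] := @pow_expR R n.
(* [expR (4 * t)^-1] is the maximum of [expR (|x| - t x^2)], found by completing the square. *)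
exists (C * expR (4 * t)^-1) => [|x]; first by rewrite mulr_ge0 ?expR_ge0.
apply: le_trans (_ : C * expR `|x| * gs t x <= _).
  by rewrite ler_wpM2r ?gs_ge0//; exact: hC.
rewrite -mulrA ler_wpM2l// /gs -expRD ler_expR.
rewrite -[x ^+ 2]real_normK ?num_real//.
have -> : `|x| + - (t * `|x| ^+ 2) =
    (4 * t)^-1 - t * (`|x| - (2 * t)^-1) ^+ 2.
  by field; rewrite gt_eqF.
by rewrite lerBlDr lerDl mulr_ge0 ?sqr_ge0 ?ltW.
Qed.

Lemma poly_gs_bounded (p : {poly R}) t : 0 < t -> exists2 C : R, 0 <= C &
  forall x, `|p.[x]| * gs t x <= C.
Proof.
move=> t0; have [C C0 [n hC]] := poly_bound p; have [D D0 hD] := pow_gs n t0.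
exists (C * D) => [|x]; first exact: mulr_ge0.
apply: le_trans (_ : C * (1 + `|x|) ^+ n * gs t x <= _).
  by rewrite ler_wpM2r ?gs_ge0.
by rewrite -mulrA ler_wpM2l.
Qed.

Lemma L1_poly_gs (p : {poly R}) t : 0 < t -> L1 (fun x => p.[x] * gs t x).
Proof.
move=> t0; have t20 : 0 < t / 2 by lra.
have [C C0 hC] := poly_gs_bounded p t20.
have mp : meas (fun x => p.[x]).
  by apply: cont_meas; exact: continuous_horner.
apply: (L1_dom _ _ (L1Z C (L1_gs t20))).
  by apply: measurable_funM mp _; exact: meas_gs.
move=> x; rewrite [in gs t](splitr t) gsD mulrA normrM (ger0_norm (gs_ge0 _ _)).
by rewrite ler_wpM2r ?gs_ge0// normrM (ger0_norm (gs_ge0 _ _)).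
Qed.

(** [H_deriv] and [H_prim] together show that the transform solves [y' = - xi / (2 t) y]. Its
    product with the inverse Gaussian [gs (- (4 * t)^-1)] therefore has zero derivative, and the
    value at 0 is the mass [cg t]. *)
Lemma H_gs t : 0 < t -> forall xi, H (gs t) xi = cg t * gs (4 * t)^-1 xi.
Proof.
move=> t0.
have Lg := L1_gs t0.
have Lxg : L1 (fun x => x * gs t x).
  by apply: eq_L1 (L1_poly_gs 'X t0) => x; rewrite hornerX.
have gsE xi : H (gs t) (- xi) = H (gs t) xi.
  have E : (fun x => gs t (- x)) = gs t by apply/funext => x; exact: gs_opp.
  by rewrite -(H_opp Lg) E.
have pgs : prim (gs t) (fun x => - (2 * t) * (x * gs t x)).
  apply: derive_prim (deriv_gs t).
  move=> x; apply: cvgM; first exact: cvg_cst.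
  by apply: cvgM; [exact: cvg_id|exact: cont_gs].
have dH : has_deriv (H (gs t)) (fun xi => - (xi / (2 * t)) * H (gs t) xi).
  have := H_deriv Lg Lxg; congr has_deriv; apply/funext => xi.
  have := H_prim xi pgs Lg (L1Z _ Lxg); rewrite HZ// gsE => E.
  have -> : (fun x => - (x * gs t (- x))) = (fun x => (-1) * (x * gs t x)).
    by apply/funext => x; rewrite gs_opp mulN1r.
  rewrite HZ//; have t00 : t != 0 by rewrite gt_eqF.
  move: E; set A := H _ xi; set B := H _ xi => E.
  have -> : A = (xi * B) / (2 * t).
    apply: (mulfI (x := - (2 * t))); first by rewrite oppr_eq0 mulf_neq0.
    by rewrite E; field.
  by field.
pose F xi := H (gs t) xi * gs (- (4 * t)^-1) xi.
have dF : has_deriv F (fun=> 0).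
  have := derivM dH (deriv_gs (- (4 * t)^-1)).
  congr has_deriv; apply/funext => xi.
  by field; rewrite gt_eqF.
move=> xi; have E : F xi = F 0 by apply: is_derive_0_is_cst => y; exact: dF.
have -> : H (gs t) xi = F xi * gs (4 * t)^-1 xi.
  by rewrite /F -mulrA -gsD addNr gs0 mulr1.
rewrite E /F gs_at0 mulr1 /H; congr (_ * _).
by apply: eq_Int => x; rewrite mulr0 cas0 mulr1.
Qed.

(** Translated and modulated Gaussians. [H] exchanges the two families up to constants, so both are
    explicit on either side of the transform. *)
Definition gshift t b x := gs t (x - b).
Definition gwave t a x := gs t x * cas (x * a).

Lemma L1_gshift t b : 0 < t -> L1 (gshift t b).
Proof. by move=> /L1_gs Lg; exact: (Int_shift (- b) Lg).1. Qed.

Lemma L1_gwave t a : 0 < t -> L1 (gwave t a).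
Proof. by move=> /L1_gs Lg; exact: L1_cas. Qed.

Lemma H_gshift t b : 0 < t -> forall xi,
  H (gshift t b) xi = cg t * gwave (4 * t)^-1 b xi.
Proof.
move=> t0 xi; have Lg := L1_gs t0.
rewrite /H -(Int_shift b (L1_cas xi (L1_gshift b t0))).2.
have -> : (fun x => gshift t b (x + b) * cas ((x + b) * xi)) =
  (fun x => cos (xi * b) * (gs t x * cas (x * xi)) +
            sin (xi * b) * (gs t x * cas (x * - xi))).
  apply/funext => x; rewrite /gshift addrK mulrDl casD mulrN (mulrC b); ring.
rewrite (IntD (L1Z _ (L1_cas _ Lg)) (L1Z _ (L1_cas _ Lg))).
rewrite (IntZ _ (L1_cas _ Lg)) (IntZ _ (L1_cas _ Lg)).
rewrite -/(H (gs t) xi) -/(H (gs t) (- xi)) !H_gs// gs_opp /gwave /cas.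
by ring.
Qed.

Lemma H_gwave t a : 0 < t -> forall xi,
  H (gwave t a) xi = cg t * gshift (4 * t)^-1 a xi.
Proof.
move=> t0 xi; have Lg := L1_gs t0.
have Lc y : L1 (fun x => gs t x * cas (x * y)) := L1_cas y Lg.
have -> : H (gwave t a) xi = Int (fun x => 2^-1 *
   (((gs t x * cas (x * (a - xi)) + gs t x * cas (x * (xi - a))) +
    gs t x * cas (x * (a + xi))) - gs t x * cas (x * - (a + xi)))).
  apply: eq_Int => x; rewrite /gwave -mulrA casM.
  have -> : x * (a - xi) = x * a - x * xi by ring.
  have -> : x * (xi - a) = x * xi - x * a by ring.
  have -> : x * - (a + xi) = - (x * a + x * xi) by ring.
  have -> : x * (a + xi) = x * a + x * xi by ring.
  by ring.
have L12 := L1D (Lc (a - xi)) (Lc (xi - a)).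
have L123 := L1D L12 (Lc (a + xi)).
rewrite (IntZ _ (L1B L123 (Lc _))) (IntB L123 (Lc _)) (IntD L12 (Lc _)).
rewrite (IntD (Lc _) (Lc _)).
rewrite -!/(H (gs t) _) !H_gs// gs_opp /gshift.
by rewrite -(opprB xi a) gs_opp; field.
Qed.

Lemma HH_gshift t b : 0 < t -> forall xi,
  H (H (gshift t b)) xi = 2 * pi * gshift t b xi.
Proof.
move=> t0 xi; have t1 : 0 < (4 * t)^-1 by rewrite invr_gt0 mulr_gt0.
rewrite (_ : H (gshift t b) = fun y => cg t * gwave (4 * t)^-1 b y); last first.
  by apply/funext => y; exact: H_gshift.
rewrite HZ; last exact: L1_gwave.
have E : (4 * (4 * t)^-1)^-1 = t by field; rewrite gt_eqF.
by rewrite (H_gwave b t1) E mulrA (cg_dual t0).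
Qed.

Lemma HH_gwave t b : 0 < t -> forall xi,
  H (H (gwave t b)) xi = 2 * pi * gwave t b xi.
Proof.
move=> t0 xi; have t1 : 0 < (4 * t)^-1 by rewrite invr_gt0 mulr_gt0.
rewrite (_ : H (gwave t b) = fun y => cg t * gshift (4 * t)^-1 b y); last first.
  by apply/funext => y; exact: H_gwave.
rewrite HZ; last exact: L1_gshift.
have E : (4 * (4 * t)^-1)^-1 = t by field; rewrite gt_eqF.
by rewrite (H_gshift b t1) E mulrA (cg_dual t0).
Qed.

End Gaussians.

(** * Functions determined by their pairings with Gaussians *)

Section Uniqueness.
Variable R : realType.
Local Notation mu := (@lebesgue_measure R).
Local Notation T := (measurableTypeR R).
Local Notation meas := (measurable_fun [set: R]).
Local Notation meas2 := (measurable_fun [set: T * T]).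
Implicit Types (g V : R -> R) (a b x t : R).

(* Wide enough for L1, L2, bounded functions and their polynomial multiples,
   and tested by translated Gaussians alone. *)
Definition gauss_tempered V := meas V /\ forall t, 0 < t -> L1 (fun x => V x * gs t x).

Lemma gauss_tempered_L1 V : L1 V -> gauss_tempered V.
Proof.
move=> LV; split=> [|t t0]; first exact: L1_meas.
apply: (@L1_bounded _ _ _ 1) => //; first exact: meas_gs.
by move=> x; rewrite ger0_norm ?gs_ge0// gs_le1// ltW.
Qed.

(** The identity [t (x - b)^2 + t b^2 - (t / 2) x^2 = (t / 2) (x - 2 b)^2] bounds the translate by
    [expR (t * b ^+ 2)] times the centred Gaussian of parameter [t / 2]. *)
Lemma gauss_tempered_L1M V t : gauss_tempered V -> 0 < t -> forall b,
  L1 (fun x => V x * gshift t b x).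
Proof.
move=> [mV LV] t0 b; have t20 : 0 < t / 2 by lra.
apply: (L1_dom _ _ (L1Z (expR (t * b ^+ 2)) (L1_norm (LV _ t20)))).
  apply: measurable_funM mV _; rewrite /gshift.
  by apply: (measurableT_comp (meas_gs t)); apply: measurable_funB.
move=> x; rewrite !normrM (ger0_norm (gs_ge0 _ _)) (ger0_norm (gs_ge0 _ _)).
rewrite mulrCA ler_wpM2l// /gshift /gs -expRD ler_expR.
have : 0 <= t * (x - 2 * b) ^+ 2 by rewrite mulr_ge0 ?sqr_ge0 ?ltW.
by rewrite !expr2 => h; lra.
Qed.

Lemma gauss_temperedB V W : gauss_tempered V -> gauss_tempered W ->
  gauss_tempered (fun x => V x - W x).
Proof.
move=> [mV LV] [mW LW]; split=> [|t t0]; first exact: measurable_funB.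
by apply: eq_L1 (L1B (LV t t0) (LW t t0)) => x; rewrite mulrBl.
Qed.

Lemma gauss_temperedD V W : gauss_tempered V -> gauss_tempered W ->
  gauss_tempered (fun x => V x + W x).
Proof.
move=> [mV LV] [mW LW]; split=> [|t t0]; first exact: measurable_funD.
by apply: eq_L1 (L1D (LV t t0) (LW t t0)) => x; rewrite mulrDl.
Qed.

Lemma gauss_temperedZ k V : gauss_tempered V -> gauss_tempered (fun x => k * V x).
Proof.
move=> [mV LV]; split=> [|t t0]; first exact: measurable_funM.
by apply: eq_L1 (L1Z k (LV t t0)) => x; rewrite mulrA.
Qed.

Lemma gauss_temperedM V (k : R -> R) C : gauss_tempered V -> meas k ->
  {ae mu, forall x, `|k x| <= C} -> gauss_tempered (fun x => k x * V x).
Proof.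
move=> [mV LV] mk kC; split=> [|t t0]; first exact: measurable_funM.
apply: (L1_domae _ _ (L1Z C (L1_norm (LV t t0)))).
  by apply: measurable_funM; [exact: measurable_funM|exact: meas_gs].
by apply: ae_imp kC => x kx; rewrite -mulrA normrM ler_wpM2r.
Qed.

Lemma gauss_tempered_bounded V C : meas V -> {ae mu, forall x, `|V x| <= C} ->
  gauss_tempered V.
Proof.
move=> mV VC; split=> // t t0; apply: (L1_domae _ _ (L1Z C (L1_gs t0))).
  by apply: measurable_funM mV _; exact: meas_gs.
by apply: ae_imp VC => x Vx; rewrite normrM (ger0_norm (gs_ge0 _ _))
  ler_wpM2r ?gs_ge0.
Qed.

Lemma gauss_tempered_sq V : meas V -> L1 (fun x => V x ^+ 2) -> gauss_tempered V.
Proof.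
move=> mV LV; split=> // t t0; apply: (L1_dom _ _ (L1D LV (L1_gs t0))).
  by apply: measurable_funM mV _; exact: meas_gs.
move=> x; rewrite normrM (ger0_norm (gs_ge0 _ _)).
rewrite -[V x ^+ 2]real_normK ?num_real//.
have := gs_le1 x (ltW t0); have := gs_ge0 t x; have := normr_ge0 (V x).
move: `|V x| (gs t x) => A g A0 g0 g1.
have h : 0 <= (A - g) ^+ 2 by exact: sqr_ge0.
by rewrite !expr2 in h *; nra.
Qed.

Lemma gauss_tempered_poly (p : {poly R}) V : gauss_tempered V ->
  gauss_tempered (fun x => p.[x] * V x).
Proof.
move=> [mV LV]; have mp : meas (fun x => p.[x]).
  by apply: cont_meas; exact: continuous_horner.
split=> [|t t0]; first exact: measurable_funM.
have t20 : 0 < t / 2 by lra.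
have [C C0 hC] := poly_gs_bounded p t20.
apply: (L1_dom _ _ (L1Z C (L1_norm (LV _ t20)))).
  by apply: measurable_funM; [exact: measurable_funM|exact: meas_gs].
move=> x; have -> : p.[x] * V x * gs t x = (p.[x] * gs (t / 2) x) * (V x * gs (t / 2) x).
  by rewrite [in LHS](splitr t) gsD; ring.
by rewrite normrM ler_wpM2r// normrM (ger0_norm (gs_ge0 _ _)).
Qed.

Lemma itvi_norm_bound a b y : itvi a b y != 0 -> `|y| <= `|a| + `|b|.
Proof.
rewrite itviE; case: (boolP (_ && _)) => [/andP[ay yb] _|_]; last by rewrite eqxx.
have h1 := ler_norm b; have h2 := ler_norm (- a); rewrite normrN in h2.
have h3 := normr_ge0 a; have h4 := normr_ge0 b.
by rewrite ler_norml; apply/andP; split; lra.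
Qed.

Lemma itvi_norm1 a b y : `|itvi a b y| <= 1.
Proof. by rewrite ger0_norm ?itvi_ge0// itvi_le1. Qed.

Lemma itvi01 a b y : itvi a b y = 0 \/ itvi a b y = 1.
Proof. by rewrite itviE; case: (_ && _); [right|left]. Qed.

Lemma meas_gs_sub t x : meas (fun y => gs t (x - y)).
Proof. by apply: (measurableT_comp (meas_gs t)); apply: measurable_funB. Qed.

(** The Gaussian [gs t (x - y)], for [y] in [[a, b]], divided by [gs (t / 2) x]. The quotient is
    bounded while [V] times [gs (t / 2)] is integrable, which is the situation of [Int_swap]. *)
Definition gkernel a b t (z : R * R) :=
  itvi a b z.2 * expR (t / 2 * z.1 ^+ 2 - t * (z.1 - z.2) ^+ 2).

Lemma meas_gkernel a b t : meas2 (gkernel a b t).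
Proof.
have m1 : meas2 (fun z : R * R => z.1) by exact: measurable_fst.
have m2 : meas2 (fun z : R * R => z.2) by exact: measurable_snd.
apply: measurable_funM; first exact: meas2_snd (meas_itvi a b).
apply: (measurableT_comp (@measurable_expR R)).
by apply: measurable_funB; solve_meas.
Qed.

Lemma gkernel_bound a b t z : 0 < t ->
  `|gkernel a b t z| <= expR (t * (`|a| + `|b|) ^+ 2).
Proof.
move=> t0; rewrite normrM (ger0_norm (expR_ge0 _)).
have [->|Xz] := eqVneq (itvi a b z.2) 0.
  by rewrite normr0 mul0r expR_ge0.
apply: le_trans (_ : expR (t / 2 * z.1 ^+ 2 - t * (z.1 - z.2) ^+ 2) <= _).
  by rewrite ler_piMl ?expR_ge0 ?itvi_norm1.
rewrite ler_expR; have zB := itvi_norm_bound Xz.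
have h : z.2 ^+ 2 <= (`|a| + `|b|) ^+ 2.
  by rewrite -[z.2 ^+ 2]real_normK ?num_real// lerXn2r// nnegrE addr_ge0.
have h2 : 0 <= t * (z.1 - 2 * z.2) ^+ 2.
  by rewrite mulr_ge0 ?sqr_ge0 ?(ltW t0).
have h3 : t * z.2 ^+ 2 <= t * (`|a| + `|b|) ^+ 2 by rewrite ler_wpM2l// ltW.
by move: h3; set D := t * (_ + _) ^+ 2 => h3; rewrite !expr2 in h2 h3 *; lra.
Qed.

Lemma gkernelE a b t x y :
  gs (t / 2) x * (itvi a b y * gkernel a b t (x, y)) = itvi a b y * gs t (x - y).
Proof.
have <- : gs (t / 2) x * expR (t / 2 * x ^+ 2 - t * (x - y) ^+ 2) = gs t (x - y).
  by rewrite /gs -expRD; congr expR; ring.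
rewrite /gkernel /=; have [->|->] := itvi01 a b y; ring.
Qed.

Lemma L1_gkernel a b t x : 0 < t -> L1 (fun y => itvi a b y * gkernel a b t (x, y)).
Proof.
move=> t0; apply: (L1_bounded (L1_itvi a b) _ (fun y => gkernel_bound a b (x, y) t0)).
exact: (measurable_fun_pair2 x (meas_gkernel a b t)).
Qed.

Lemma gauss_average V a b t : gauss_tempered V ->
  (forall t b, 0 < t -> Int (fun x => V x * gshift t b x) = 0) -> 0 < t ->
  L1 (fun x => V x * Int (fun y => itvi a b y * gs t (x - y))) /\
  Int (fun x => V x * Int (fun y => itvi a b y * gs t (x - y))) = 0.
Proof.
move=> gV V0 t0; have t20 : 0 < t / 2 by lra.
have LV := gV.2 _ t20.
have VE x : V x * gs (t / 2) x * Int (fun y => itvi a b y * gkernel a b t (x, y)) =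
    V x * Int (fun y => itvi a b y * gs t (x - y)).
  rewrite -mulrA -(IntZ _ (L1_gkernel a b x t0)); congr (_ * _).
  by apply: eq_Int => y; exact: gkernelE.
have Esw := Int_swap LV (L1_itvi a b) (meas_gkernel a b t)
  (fun z => gkernel_bound a b z t0).
have [L _ _] := Int_Fubini (L1prod_kernel LV (L1_itvi a b) (meas_gkernel a b t)
  (fun z => gkernel_bound a b z t0)).
split.
  apply: eq_L1 L => x /=; rewrite -VE -(IntZ _ (L1_gkernel a b x t0)).
  by apply: eq_Int => y; rewrite mulrA.
transitivity (Int (fun x => V x * gs (t / 2) x *
    Int (fun y => itvi a b y * gkernel a b t (x, y)))).
  by apply: eq_Int => x; rewrite VE.
rewrite {}Esw -[RHS](@Int0 R); apply: eq_Int => y.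
have -> : Int (fun x => V x * gs (t / 2) x * gkernel a b t (x, y)) =
    itvi a b y * Int (fun x => V x * gshift t y x).
  rewrite -(IntZ _ (gauss_tempered_L1M gV t0 y)); apply: eq_Int => x.
  have := gkernelE a b t x y; rewrite /gshift.
  have [E|->] := itvi01 a b y.
    by move=> _; rewrite /gkernel /= E !mul0r mulr0.
  by rewrite !mul1r -mulrA => ->.
by rewrite (V0 t y t0) !mulr0.
Qed.

(** The indicator of [[a, b]] convolved with a Gaussian of width of order [r^-1] and mass [cg 1].
    After the substitution the Gaussian is fixed, ready for dominated convergence in [r]. *)
Definition gblur a b (r x : R) := Int (fun y => itvi a b (x + r^-1 * y) * gs 1 y).

Lemma meas_itvi_affine a b (r x : R) : meas (fun y => itvi a b (x + r^-1 * y)).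
Proof. by apply: (measurableT_comp (meas_itvi a b)); solve_meas. Qed.

Lemma L1_gblur a b (r x : R) : L1 (fun y => itvi a b (x + r^-1 * y) * gs 1 y).
Proof.
have L := L1_bounded (L1_gs (@ltr01 R)) (meas_itvi_affine a b r x)
  (fun y => itvi_norm1 a b _).
by apply: eq_L1 L => y; rewrite mulrC.
Qed.

Lemma gblurE a b (r x : R) : 0 < r ->
  gblur a b r x = r * Int (fun y => itvi a b y * gs (r ^+ 2) (x - y)).
Proof.
move=> r0; have r20 : 0 < r ^+ 2 by rewrite exprn_gt0.
have gb y : `|gs (r ^+ 2) (x - y)| <= 1.
  by rewrite ger0_norm ?gs_ge0// gs_le1// ltW.
have Lxg := L1_bounded (L1_itvi a b) (meas_gs_sub (r ^+ 2) x) gb.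
have ri0 : 0 < r^-1 by rewrite invr_gt0.
have [_ I2] := Int_scale ri0 (Int_shift x Lxg).1.
rewrite (Int_shift x Lxg).2 invrK in I2.
rewrite -I2; apply: eq_Int => y; rewrite addrC; congr (_ * _).
by rewrite /gs; congr (expR (- _)); field; rewrite gt_eqF.
Qed.

(** On the support, [z = x + r^-1 * y] has [|z| <= |a| + |b|], and [y^2 >= (z - x)^2] because
    [r >= 1]. Half of the exponent of [gs 1 y] then pays for Gaussian decay in [x], uniformly in
    [r]. *)
Lemma gblur_dom a b (r x y : R) : 1 <= r ->
  `|itvi a b (x + r^-1 * y) * gs 1 y| <=
  (expR ((`|a| + `|b|) ^+ 2 / 2) * gs 4^-1 x) * gs 2^-1 y.
Proof.
move=> r1; rewrite normrM (ger0_norm (gs_ge0 _ _)).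
have [->|Xz] := eqVneq (itvi a b (x + r^-1 * y)) 0.
  by rewrite normr0 mul0r !mulr_ge0 ?expR_ge0.
apply: le_trans (_ : gs 1 y <= _).
  by rewrite ler_piMl ?gs_ge0 ?itvi_norm1.
rewrite /gs -!expRD ler_expR; have := itvi_norm_bound Xz.
set z := x + _; set B := `|a| + `|b| => zB.
have r0 : r != 0 by rewrite gt_eqF// (lt_le_trans ltr01).
have yE : y = r * (z - x) by rewrite /z; field.
have h1 : z ^+ 2 <= B ^+ 2.
  by rewrite -[z ^+ 2]real_normK ?num_real// lerXn2r// nnegrE addr_ge0.
have h2 : (z - x) ^+ 2 <= y ^+ 2.
  by rewrite yE exprMn ler_peMl ?sqr_ge0// exprn_ege1.
have h3 : 0 <= (x - 2 * z) ^+ 2 by exact: sqr_ge0.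
clear -h1 h2 h3; rewrite !expr2 in h1 h2 h3 *; lra.
Qed.

Lemma gblur_bound a b (r x : R) : 1 <= r ->
  `|gblur a b r x| <= expR ((`|a| + `|b|) ^+ 2 / 2) * cg 2^-1 * gs 4^-1 x.
Proof.
move=> r1; apply: le_trans (le_norm_Int (L1_gblur a b r x)) _.
have L2' : L1 (gs (2^-1 : R)) by apply: L1_gs; rewrite invr_gt0.
rewrite mulrAC -(IntZ _ L2'); apply: le_Int.
- exact: L1_norm (L1_gblur a b r x).
- exact: L1Z.
- by move=> y; exact: gblur_dom.
Qed.

Lemma itvi_locally_const a b x : x != a -> x != b ->
  exists2 d, 0 < d & forall z, `|z - x| < d -> itvi a b z = itvi a b x.
Proof.
move=> xa xb; exists (Num.min `|x - a| `|x - b|).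
  by rewrite lt_min !normr_gt0 !subr_eq0 xa.
move=> z; rewrite lt_min !ltr_norml => /andP[za zb]; rewrite !itviE.
congr (_ %:R); congr nat_of_bool; congr andb.
  move: za; have [ax|ax|E] := ltgtP a x; last by rewrite E eqxx in xa.
    rewrite gtr0_norm ?subr_gt0// => /andP[? ?]; apply/idP; lra.
  rewrite ltr0_norm ?subr_lt0// => /andP[? ?]; apply/negbTE.
  by rewrite -ltNge; lra.
move: zb; have [ax|ax|E] := ltgtP x b; last by rewrite E eqxx in xb.
  rewrite ltr0_norm ?subr_lt0// => /andP[? ?]; apply/idP; lra.
rewrite gtr0_norm ?subr_gt0// => /andP[? ?]; apply/negbTE.
by rewrite -ltNge; lra.
Qed.

Lemma gblur_cvg a b x : x != a -> x != b ->
  gblur a b n.+1%:R x @[n --> \oo] --> itvi a b x * cg 1.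
Proof.
move=> xa xb; have L1' := L1_gs (@ltr01 R).
have -> : itvi a b x * cg 1 = Int (fun y => itvi a b x * gs 1 y) by rewrite IntZ.
apply: (Int_dct _ _ _ L1' _).2.
- by move=> n; exact: L1_meas (L1_gblur a b _ x).
- exact: L1_meas (L1Z _ L1').
- apply: aeW => y; apply: cvg_near_cst.
  have [d d0 hd] := itvi_locally_const xa xb.
  near=> n; rewrite hd// addrAC subrr add0r normrM normfV normr_nat.
  rewrite ltr_pdivrMl//; have : `|y| / d < n.+1%:R.
    apply: (@le_lt_trans _ _ n%:R); last by rewrite ltr_nat.
    by near: n; exact: nbhs_infty_ger.
  by rewrite ltr_pdivrMr.
- move=> n; apply: aeW => y; rewrite normrM (ger0_norm (gs_ge0 _ _)).
  by rewrite ler_piMl ?gs_ge0 ?itvi_norm1.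
Unshelve. all: by end_near. Qed.

(* Averaging the hypothesis over centres in [a, b] replaces the Gaussian by a
   smoothed indicator, which tends to the indicator as the width shrinks. *)
Lemma gauss_Int_itvi V a b : gauss_tempered V ->
  (forall t b, 0 < t -> Int (fun x => V x * gshift t b x) = 0) ->
  Int (fun x => itvi a b x * V x) = 0.
Proof.
move=> gV V0; have mV := gV.1.
have r0 n : 0 < n.+1%:R :> R by [].
have r1 n : 1 <= n.+1%:R :> R by rewrite ler1n.
have r20 n : 0 < n.+1%:R ^+ 2 :> R by rewrite exprn_gt0.
have E0 n : L1 (fun x => V x * gblur a b n.+1%:R x) /\
    Int (fun x => V x * gblur a b n.+1%:R x) = 0.
  have [L I0] := gauss_average a b gV V0 (r20 n).
  have E x : V x * gblur a b n.+1%:R x = n.+1%:R *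
      (V x * Int (fun y => itvi a b y * gs (n.+1%:R ^+ 2) (x - y))).
    by rewrite (gblurE a b x (r0 n)) mulrCA.
  split; first by apply: eq_L1 (L1Z n.+1%:R L) => x; rewrite E.
  by rewrite (eq_Int E) (IntZ _ L) I0 mulr0.
have L4 : L1 (fun x => V x * gs 4^-1 x) by apply: gV.2; rewrite invr_gt0.
set C := expR ((`|a| + `|b|) ^+ 2 / 2) * cg 2^-1.
have mX := meas_itvi a b.
have VX : L1 (fun x => itvi a b x * V x).
  have t1 : 0 < 1 :> R by [].
  apply: (L1_dom _ _ (L1Z (expR ((`|a| + `|b|) ^+ 2)) (L1_norm (gV.2 1 t1)))).
    exact: measurable_funM.
  move=> x; rewrite !normrM (ger0_norm (gs_ge0 _ _)).
  have [->|Xx] := eqVneq (itvi a b x) 0.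
    by rewrite normr0 mul0r !mulr_ge0 ?expR_ge0.
  rewrite mulrCA mulrC ler_wpM2l//.
  apply: le_trans (itvi_norm1 a b x) _.
  rewrite /gs -expRD -[leLHS]expR0 ler_expR mul1r subr_ge0.
  rewrite -[x ^+ 2]real_normK ?num_real// lerXn2r ?nnegrE ?addr_ge0//.
  exact: itvi_norm_bound.
have hF n := L1_meas (E0 n).1.
have E1 x : itvi a b x * V x * cg 1 = V x * (itvi a b x * cg 1).
  by rewrite mulrCA mulrA.
have hf : meas (fun x => V x * (itvi a b x * cg 1)) by solve_meas.
have hc : {ae mu, forall x, (fun n => V x * gblur a b n.+1%:R x) @ \oo -->
    V x * (itvi a b x * cg 1)}.
  apply/aeP; exists ([set a] `|` [set b]); split.
  - by apply: measurableU; exact: measurable_set1.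
  - by apply: null_set_setU; [exact: measurable_set1|exact: measurable_set1|
      exact: lebesgue_measure_set1|exact: lebesgue_measure_set1].
  - move=> x /= /not_orP[/eqP xa /eqP xb]; apply: cvgM; first exact: cvg_cst.
    exact: gblur_cvg.
have hb n : {ae mu, forall x,
    `|V x * gblur a b n.+1%:R x| <= C * `|V x * gs 4^-1 x|}.
  apply: aeW => x; rewrite !normrM (ger0_norm (gs_ge0 _ _)) mulrCA ler_wpM2l//.
  exact: gblur_bound.
have [_] := Int_dct hF hf hc (L1Z C (L1_norm L4)) hb.
have -> : (fun n => Int (fun x => V x * gblur a b n.+1%:R x)) = (fun=> 0).
  by apply/funext => n; exact: (E0 n).2.
move=> /(cvg_lim (@Rhausdorff R)); rewrite (cvg_lim (@Rhausdorff R) (cvg_cst _)) => h.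
have c1 : cg 1 != 0 :> R by rewrite gt_eqF// cg_gt0.
apply: (mulfI c1); rewrite mulr0 -(IntZ _ VX) h; apply: eq_Int => x.
by rewrite -E1 mulrC.
Qed.

(** The integral of [V] over every interval vanishes, so [V] is zero at its Lebesgue points.
    Transforms are identified through this lemma below. *)
Lemma gauss_unique V : gauss_tempered V ->
  (forall t b, 0 < t -> Int (fun x => V x * gshift t b x) = 0) ->
  aeq V (fun=> 0).
Proof.
move=> gV V0.
have LV : L1loc V.
  split=> [|a b]; first exact: gV.1.
  have [B B0 hB] := cont_bounded a b (@cont_gs R (-1)).
  have t1 : 0 < 1 :> R by [].
  have mV := gV.1.
  apply: (L1_dom _ _ (L1Z B (L1_norm (gV.2 1 t1)))).
    by apply: measurable_funM => //; exact: meas_itvi.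
  move=> x; rewrite itviE; have [/hB xB|_] := boolP (_ && _); last first.
    by rewrite mul0r normr0 mulr_ge0.
  have -> : true%:R * V x = gs (-1) x * (V x * gs 1 x).
    by rewrite mulrCA -gsD addNr gs0 mulr1 mul1r.
  by rewrite normrM ler_wpM2r.
have IV a b : Int (fun x => itvi a b x * V x) = 0 by exact: gauss_Int_itvi.
apply: ae_imp (lebesgue_differentiation (L1loc_locally LV)) => a la.
apply/eqP; rewrite -normr_eq0; apply/eqP/le_anti; rewrite normr_ge0 andbT.
apply/ler_addgt0Pl => e e0; rewrite addr0.
have [d d0 hd] := lebesgue_pt_small LV la e0.
have d20 : 0 < d / 2 by lra.
have dd : d / 2 < d by lra.
have := hd _ d20 dd; set r := d / 2 in d20 dd *.
have LVa : L1 (fun y => itvi (a - r) (a + r) y * (V y - V a)).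
  exact: (L1locB LV (L1loc_cst (V a))).2.
have E : Int (fun y => itvi (a - r) (a + r) y * (V y - V a)) = - (2 * r * V a).
  under eq_Int do rewrite mulrBr.
  rewrite (IntB (LV.2 _ _) ((L1loc_cst (V a)).2 _ _)) IV sub0r; congr (- _).
  under eq_Int do rewrite mulrC.
  rewrite (IntZ _ (L1_itvi _ _)) Int_itvi; first by ring.
  by lra.
have h1 : `|2 * r * V a| <= Int (fun y => itvi (a - r) (a + r) y * `|V y - V a|).
  rewrite -normrN -E; apply: le_trans (le_norm_Int LVa) _.
  rewrite le_eqVlt; apply/orP; left; apply/eqP; apply: eq_Int => y.
  by rewrite normrM ger0_norm ?itvi_ge0.
move=> /(le_trans h1); rewrite normrM (gtr0_norm (_ : 0 < 2 * r)); last by lra.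
rewrite -mulrA mulrCA ler_pM2l//; have := normr_ge0 (V a); lra.
Qed.

End Uniqueness.

(** * Inversion and weighted Wiener algebras *)

Section WienerClass.
Variable R : realType.
Local Notation mu := (@lebesgue_measure R).
Local Notation T := (measurableTypeR R).
Local Notation meas := (measurable_fun [set: R]).
Local Notation meas2 := (measurable_fun [set: T * T]).
Implicit Types (f g P Q : R -> R) (a b x t s xi : R).

Lemma L1prod_meas (F : R * R -> R) : L1prod F -> meas2 F.
Proof. by move=> /integrableP[/measurable_EFinP]. Qed.

Lemma Int_H_gshift P t b : L1 P -> 0 < t ->
  Int (fun x => H P x * H (gshift t b) x) = 2 * pi * Int (fun x => P x * gshift t b x).
Proof.
move=> LP t0; have t1 : 0 < (4 * t)^-1 by rewrite invr_gt0 mulr_gt0.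
have LH : L1 (H (gshift t b)).
  by apply: eq_L1 (L1Z (cg t) (L1_gwave b t1)) => x; rewrite H_gshift.
under eq_Int do rewrite mulrC.
rewrite -(H_swap LP LH) -IntZ.
  by apply: eq_Int => x; rewrite (HH_gshift b t0); ring.
exact: gauss_tempered_L1M (gauss_tempered_L1 LP) t0 b.
Qed.

Lemma Int_H_gwave P t b : L1 P -> 0 < t ->
  Int (fun x => H P x * H (gwave t b) x) = 2 * pi * Int (fun x => P x * gwave t b x).
Proof.
move=> LP t0; have t1 : 0 < (4 * t)^-1 by rewrite invr_gt0 mulr_gt0.
have LH : L1 (H (gwave t b)).
  by apply: eq_L1 (L1Z (cg t) (L1_gshift b t1)) => x; rewrite H_gwave.
under eq_Int do rewrite mulrC.
rewrite -(H_swap LP LH) -IntZ.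
  by apply: eq_Int => x; rewrite (HH_gwave b t0); ring.
apply: eq_L1 (L1_cas b ((gauss_tempered_L1 LP).2 t t0)) => x.
by rewrite /gwave mulrA.
Qed.

Lemma twopi_neq0 : 2 * pi != 0 :> R.
Proof. by rewrite mulf_neq0// gt_eqF// pi_gt0. Qed.

Lemma H_meas P : L1 P -> meas (H P).
Proof. by move=> LP; exact: cont_meas (H_continuous LP). Qed.

Lemma gauss_tempered_H P : L1 P -> gauss_tempered (H P).
Proof.
move=> LP; apply: (gauss_tempered_bounded (C := 2 * Int (fun x => `|P x|))).
  exact: H_meas.
by apply: aeW => x; exact: H_bound.
Qed.

(** The hypothesis states weakly that [P] is the transform of [f], which need not be integrable.
    Under [H] the tests [gwave s b] with [s = (4 * t)^-1] become multiples of [gshift t b], so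
    [gauss_unique] applies. *)
Lemma hartley_inversion f P : gauss_tempered f -> L1 P ->
  (forall s a, 0 < s ->
     Int (fun xi => P xi * gwave s a xi) = Int (fun x => f x * H (gwave s a) x)) ->
  aeq f (fun x => (2 * pi)^-1 * H P x).
Proof.
move=> gf LP fP.
have gH := gauss_temperedZ (2 * pi)^-1 (gauss_tempered_H LP).
suff : aeq (fun x => f x - (2 * pi)^-1 * H P x) (fun=> 0).
  by apply: ae_imp => x /eqP; rewrite subr_eq0 => /eqP.
apply: gauss_unique; first exact: gauss_temperedB.
move=> t b t0; pose s : R := (4 * t)^-1.
have s0 : 0 < s by rewrite invr_gt0 mulr_gt0.
have ts : (4 * s)^-1 = t by rewrite /s; field; rewrite gt_eqF.
have cs : cg s != 0 by rewrite gt_eqF// cg_gt0.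
have L1f := gauss_tempered_L1M gf t0 b.
have L1H := gauss_tempered_L1M gH t0 b.
under eq_Int do rewrite mulrBl.
rewrite (IntB L1f L1H); apply: (mulfI cs); rewrite mulr0 mulrBr -!IntZ//.
have E1 : Int (fun x => cg s * (f x * gshift t b x)) =
    Int (fun x => P x * gwave s b x).
  rewrite fP//; apply: eq_Int => x; rewrite (H_gwave b s0) ts; ring.
have E2 : Int (fun x => cg s * ((2 * pi)^-1 * H P x * gshift t b x)) =
    Int (fun x => P x * gwave s b x).
  apply: (mulfI twopi_neq0); rewrite -(Int_H_gwave b LP s0) -IntZ; last first.
    by apply: L1Z.
  have p0 : pi != 0 :> R by rewrite gt_eqF// pi_gt0.
  by apply: eq_Int => x; rewrite (H_gwave b s0) ts; move: pi p0 => q q0; field.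
by rewrite E1 E2 subrr.
Qed.

Lemma H_of_H f Q : L1 f -> L1 Q -> f =1 H Q -> aeq (H f) (fun xi => 2 * pi * Q xi).
Proof.
move=> Lf LQ fQ; have gHf := gauss_tempered_H Lf.
have gQ := gauss_temperedZ (2 * pi) (gauss_tempered_L1 LQ).
suff : aeq (fun x => H f x - 2 * pi * Q x) (fun=> 0).
  by apply: ae_imp => x /eqP; rewrite subr_eq0 => /eqP.
apply: gauss_unique; first exact: gauss_temperedB.
move=> t b t0; under eq_Int do rewrite mulrBl.
rewrite (IntB (gauss_tempered_L1M gHf t0 b) (gauss_tempered_L1M gQ t0 b)).
have -> : Int (fun x => 2 * pi * Q x * gshift t b x) =
    Int (fun x => H Q x * H (gshift t b) x).
  rewrite (Int_H_gshift b LQ t0) -IntZ.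
    by apply: eq_Int => x; rewrite mulrA.
  exact: gauss_tempered_L1M (gauss_tempered_L1 LQ) t0 b.
have := H_swap Lf (L1_gshift b t0) => E.
apply/eqP; rewrite subr_eq0; apply/eqP.
transitivity (Int (fun x => gshift t b x * H f x)).
  by apply: eq_Int => x; rewrite mulrC.
by rewrite -E; apply: eq_Int => x; rewrite fQ.
Qed.

(** This weight is submultiplicative ([wtM]), which makes the weighted spaces [Lw k] convolution
    algebras. *)
Definition wt (k : nat) x : R := (1 + `|x|) ^+ k.

Lemma wt_ge1 k x : 1 <= wt k x.
Proof. by rewrite exprn_ege1// lerDl. Qed.

Lemma wt_ge0 k x : 0 <= wt k x.
Proof. exact: le_trans (wt_ge1 k x). Qed.

Lemma wt_opp k x : wt k (- x) = wt k x.
Proof. by rewrite /wt normrN. Qed.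

Lemma wtS k x : wt k.+1 x = (1 + `|x|) * wt k x.
Proof. by rewrite /wt exprS. Qed.

Lemma meas_wt k : meas (wt k).
Proof. by apply: measurable_funX; solve_meas. Qed.

Lemma wtM k x y : wt k (x + y) <= wt k x * wt k y.
Proof.
rewrite /wt -exprMn lerXn2r ?nnegrE ?mulr_ge0 ?addr_ge0//.
have := ler_normD x y; have := normr_ge0 x; have := normr_ge0 y; nra.
Qed.

Definition Lw (k : nat) P := meas P /\ L1 (fun x => wt k x * P x).

Lemma Lw_dom k P Q : meas P -> {ae mu, forall x, `|P x| <= `|Q x|} -> Lw k Q -> Lw k P.
Proof.
move=> mP PQ [mQ LQ]; split=> //; apply: (L1_domae _ _ (L1_norm LQ)).
  by apply: measurable_funM mP; exact: meas_wt.
by apply: ae_imp PQ => x h; rewrite !normrM ler_wpM2l.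
Qed.

Lemma LwP k P : meas P -> L1 (fun x => wt k x * `|P x|) -> Lw k P.
Proof.
move=> mP L; split=> //; apply: (L1_dom _ _ L).
  by apply: measurable_funM mP; exact: meas_wt.
by move=> x; rewrite normrM (ger0_norm (wt_ge0 _ _)).
Qed.

Lemma Lw_norm k P : Lw k P -> L1 (fun x => wt k x * `|P x|).
Proof.
move=> [mP L]; apply: eq_L1 (L1_norm L) => x.
by rewrite normrM (ger0_norm (wt_ge0 _ _)).
Qed.

Lemma Lw_le j k P : (j <= k)%N -> Lw k P -> Lw j P.
Proof.
move=> jk LP; have mP := LP.1; apply: LwP => //.
apply: (L1_dom _ _ (Lw_norm LP)).
  by apply: measurable_funM; [exact: meas_wt|exact: meas_norm].
move=> x; rewrite ger0_norm ?mulr_ge0 ?wt_ge0// ler_wpM2r//.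
by rewrite /wt ler_weXn2l// lerDl.
Qed.

Lemma Lw0 P : Lw 0 P <-> L1 P.
Proof.
split=> [[_]|LP]; first by apply: eq_L1 => x; rewrite /wt expr0 mul1r.
split; first exact: L1_meas.
by apply: eq_L1 LP => x; rewrite /wt expr0 mul1r.
Qed.

Lemma Lw_L1 k P : Lw k P -> L1 P.
Proof. by move=> LP; apply/Lw0; exact: Lw_le LP. Qed.

Lemma LwD k P Q : Lw k P -> Lw k Q -> Lw k (fun x => P x + Q x).
Proof.
move=> [mP LP] [mQ LQ]; split; first exact: measurable_funD.
by apply: eq_L1 (L1D LP LQ) => x; rewrite mulrDr.
Qed.

Lemma LwZ k c P : Lw k P -> Lw k (fun x => c * P x).
Proof.
move=> [mP LP]; split; first exact: measurable_funM.
by apply: eq_L1 (L1Z c LP) => x; rewrite mulrCA.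
Qed.

Lemma LwB k P Q : Lw k P -> Lw k Q -> Lw k (fun x => P x - Q x).
Proof.
move=> LP /(LwZ (-1)) LQ; have := LwD LP LQ.
by under eq_fun do rewrite mulN1r.
Qed.

Lemma Lw_opp k P : Lw k P -> Lw k (fun x => P (- x)).
Proof.
move=> [mP LP]; split; first by apply: (measurableT_comp mP); exact: meas_opp.
by apply: eq_L1 (Int_opp LP).1 => x; rewrite wt_opp.
Qed.

Lemma Lw_mulx k P : Lw k.+1 P -> Lw k (fun x => x * P x).
Proof.
move=> LP; have mP := LP.1; apply: LwP; first by solve_meas.
apply: (L1_dom _ _ (Lw_norm LP)).
  by apply: measurable_funM; [exact: meas_wt|solve_meas].
move=> x; rewrite ger0_norm ?mulr_ge0 ?wt_ge0// wtS normrM mulrCA mulrA.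
by rewrite ler_wpM2r// ler_wpM2r ?wt_ge0// lerDr.
Qed.

Lemma L1prod_shift P Q : L1 P -> L1 Q -> L1prod (fun z => P (z.1 - z.2) * Q z.2).
Proof.
move=> LP LQ.
have m : meas2 (fun z : R * R => P (z.1 - z.2) * Q z.2).
  apply: measurable_funM; last exact: meas2_snd (L1_meas LQ).
  apply: (measurableT_comp (L1_meas LP)); apply: measurable_funB.
    exact: measurable_fst.
  exact: measurable_snd.
apply: L1prod_tonelli => //= [y|].
  by apply: eq_L1 (L1Z (Q y) (Int_shift (- y) LP).1) => x; rewrite mulrC.
apply: eq_L1 (L1Z (Int (fun x => `|P x|)) (L1_norm LQ)) => y.
have [L I] := Int_shift (- y) (L1_norm LP).
rewrite -I mulrC -(IntZ _ L); apply: eq_Int => x.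
by rewrite normrM mulrC.
Qed.

Definition conv P Q x := Int (fun y => P (x - y) * Q y).

Lemma Lw_conv k P Q : Lw k P -> Lw k Q -> Lw k (conv P Q).
Proof.
move=> LP LQ; have LP0 := Lw_L1 LP; have LQ0 := Lw_L1 LQ.
have [Lc _ _] := Int_Fubini (L1prod_shift LP0 LQ0).
have mc : meas (conv P Q) := L1_meas Lc.
have LPn := Lw_norm LP; have LQn := Lw_norm LQ.
have LN := L1prod_shift LPn LQn.
have [LNi _ _] := Int_Fubini LN.
have m : meas2 (fun z : R * R => wt k z.1 * (P (z.1 - z.2) * Q z.2)).
  apply: measurable_funM; first exact: meas2_fst (meas_wt k).
  exact: L1prod_meas (L1prod_shift LP0 LQ0).
have LF : L1prod (fun z => wt k z.1 * (P (z.1 - z.2) * Q z.2)).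
  apply: (L1prod_dom m _ LN) => z /=.
  rewrite !normrM (ger0_norm (wt_ge0 _ _)).
  have -> : wt k (z.1 - z.2) * `|P (z.1 - z.2)| * (wt k z.2 * `|Q z.2|) =
    (wt k (z.1 - z.2) * wt k z.2) * (`|P (z.1 - z.2)| * `|Q z.2|) by ring.
  rewrite ler_wpM2r ?mulr_ge0//.
  by apply: le_trans (wtM k _ _); rewrite subrK.
have [L1F _ _] := Int_Fubini LF.
have F1 := ae_integrable1 (L1prod_shift LP0 LQ0).
split=> //.
apply: (aeq_L1 _ _ _ L1F).
- exact: L1_meas L1F.
- by apply: measurable_funM mc; exact: meas_wt.
(* The weight can be taken out of the inner integral only where the section is integrable, hence for
   almost every [x]. *)
- by apply: ae_imp F1 => x Lx; rewrite /conv -(IntZ _ Lx).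
Qed.

Lemma L1_cos Q x : L1 Q -> Int (fun y => Q y * cos (y * x)) = (H Q x + H Q (- x)) / 2 /\
  Int (fun y => Q y * sin (y * x)) = (H Q x - H Q (- x)) / 2.
Proof.
move=> LQ; have L1' := L1_cas x LQ; have L2' := L1_cas (- x) LQ; split.
  rewrite /H mulrC -(IntD L1' L2') -(IntZ _ (L1D L1' L2')).
  by apply: eq_Int => y; rewrite cos_cas mulrN; field.
rewrite /H mulrC -(IntB L1' L2') -(IntZ _ (L1B L1' L2')).
by apply: eq_Int => y; rewrite sin_cas mulrN; field.
Qed.

(** By [casD] the frequencies [x] and [- x] mix, so the convolution theorem is not a plain product
    for [H]. It becomes one when [H Q] is even. *)
Lemma H_conv P Q x : L1 P -> L1 Q -> H (conv P Q) x =
  2^-1 * (H P x * (H Q x + H Q (- x)) + H P (- x) * (H Q x - H Q (- x))).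
Proof.
move=> LP LQ; have LS := L1prod_shift LP LQ.
have mS := L1prod_meas LS.
have mc2 : meas2 (fun z : R * R => cas (z.1 * x)).
  apply: (measurableT_comp (@meas_cas R)); apply: measurable_funM.
    exact: measurable_fst.
  exact: measurable_cst.
have LF : L1prod (fun z => (P (z.1 - z.2) * Q z.2) * cas (z.1 * x)).
  have := integrable_norm LS => LSn.
  have LS2 : L1prod (fun z => 2 * `|P (z.1 - z.2) * Q z.2|).
    exact: (integrableZl _ _ LSn).
  apply: (L1prod_dom _ _ LS2); first exact: measurable_funM.
  by move=> z; rewrite normrM mulrC ler_wpM2r// cas_le2.
have [_ _ E] := Int_Fubini LF.
have F1 := ae_integrable1 LS.
have [Lc _ _] := Int_Fubini LS.
have -> : H (conv P Q) x =
    Int (fun y => Int (fun z => P (y - z) * Q z * cas (y * x))).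
  apply: aeq_Int.
  - exact: L1_meas (L1_cas x Lc).
  - by have [L _ _] := Int_Fubini LF; exact: L1_meas L.
  - apply: ae_imp F1 => y Ly; rewrite /conv mulrC -(IntZ _ Ly).
    by apply: eq_Int => z; rewrite mulrC.
rewrite E.
have inner z : Int (fun y => P (y - z) * Q z * cas (y * x)) =
    H P x * (Q z * cos (z * x)) + H P (- x) * (Q z * sin (z * x)).
  have Lx := L1_cas x LP; have Lx' := L1_cas (- x) LP.
  have Lz : L1 (fun y => P (y - z) * Q z * cas (y * x)).
    apply: eq_L1 (L1Z (Q z) (L1_cas x (Int_shift (- z) LP).1)) => y.
    by ring.
  rewrite -(Int_shift z Lz).2.
  have -> : H P x * (Q z * cos (z * x)) + H P (- x) * (Q z * sin (z * x)) =
      (Q z * cos (z * x)) * H P x + (Q z * sin (z * x)) * H P (- x) by ring.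
  rewrite /H -(IntZ _ Lx) -(IntZ _ Lx') -(IntD (L1Z _ Lx) (L1Z _ Lx')).
  by apply: eq_Int => y; rewrite addrK mulrDl casD mulrN; ring.
rewrite (eq_Int inner).
have L1' := L1_cas x LQ; have L2' := L1_cas (- x) LQ.
have LQc : L1 (fun z => Q z * cos (z * x)).
  apply: eq_L1 (L1Z 2^-1 (L1D L1' L2')) => z.
  by rewrite cos_cas mulrN; field.
have LQs : L1 (fun z => Q z * sin (z * x)).
  apply: eq_L1 (L1Z 2^-1 (L1B L1' L2')) => z.
  by rewrite sin_cas mulrN; field.
rewrite (IntD (L1Z _ LQc) (L1Z _ LQs)) (IntZ _ LQc) (IntZ _ LQs).
have [-> ->] := L1_cos x LQ; by field.
Qed.

Definition wiener k f := exists2 P, Lw k P & f =1 H P.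

(** Following [casM], a product of two Hartley transforms is the transform of a combination of four
    convolutions, of [P] or its reflection with [Q] or its reflection. *)
Lemma wienerM k f g : wiener k f -> wiener k g -> wiener k (fun x => f x * g x).
Proof.
move=> [P LP fP] [Q LQ gQ].
have LP0 := Lw_L1 LP; have LQ0 := Lw_L1 LQ.
have LP' := Lw_opp LP; have LQ' := Lw_opp LQ.
have L1' := Lw_conv LP LQ'; have L2' := Lw_conv LP' LQ.
have L3 := Lw_conv LP LQ; have L4 := Lw_conv LP' LQ'.
have L12 := LwD L1' L2'; have L123 := LwD L12 L3; have L1234 := LwB L123 L4.
exists (fun x => 2^-1 * (conv P (fun x => Q (- x)) x + conv (fun x => P (- x)) Q x +
    conv P Q x - conv (fun x => P (- x)) (fun x => Q (- x)) x)); first exact: LwZ.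
move=> x; rewrite (HZ _ (Lw_L1 L1234)).
have HN A : L1 A -> H (fun x => - A x) x = - H A x.
  move=> LA; rewrite -mulN1r -(HZ _ LA); apply: eq_Int => y; rewrite mulN1r//.
rewrite (HD (Lw_L1 L123) (L1N (Lw_L1 L4))) (HD (Lw_L1 L12) (Lw_L1 L3)).
rewrite (HD (Lw_L1 L1') (Lw_L1 L2')) (HN _ (Lw_L1 L4)).
rewrite !H_conv ?(Lw_L1 LP') ?(Lw_L1 LQ')//.
rewrite (H_opp LP0) (H_opp LQ0) !(H_opp LP0) !(H_opp LQ0) opprK fP gQ.
by field.
Qed.

Lemma wiener_le j k f : (j <= k)%N -> wiener k f -> wiener j f.
Proof. by move=> jk [P LP fP]; exists P => //; exact: Lw_le LP. Qed.

Lemma wiener_deriv k f : wiener k.+1 f -> exists2 g, wiener k g & has_deriv f g.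
Proof.
move=> [P LP fP]; have LxP := Lw_mulx LP.
have -> : f = H P by apply/funext.
exists (H (fun x => - (x * P (- x)))); last first.
  by apply: H_deriv; [exact: Lw_L1 LP|exact: Lw_L1 LxP].
exists (fun x => - (x * P (- x))) => //.
have := Lw_opp LxP.
by under eq_fun do rewrite mulNr.
Qed.

Lemma wiener_bounded k f : wiener k f -> exists C, forall x, `|f x| <= C.
Proof.
move=> [P LP fP]; exists (2 * Int (fun x => `|P x|)) => x.
by rewrite fP; apply: H_bound; exact: Lw_L1 LP.
Qed.

Lemma wiener_continuous k f : wiener k f -> continuous f.
Proof.
move=> [P LP fP]; have -> : f = H P by apply/funext.
by apply: H_continuous; exact: Lw_L1 LP.
Qed.

Lemma wiener_Dk n f : wiener n f -> Dk n f.
Proof.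
elim: n f => [//|n IH] f /wiener_deriv[g wg fg].
by apply: Dk_deriv fg _; exact: IH.
Qed.

End WienerClass.

(** * Fourier data of the equation *)

Section RealParts.
Variable R : realType.
Local Notation mu := (@lebesgue_measure R).
Local Notation meas := (measurable_fun [set: R]).
Implicit Types (f g : R -> R) (F : R -> R[i]) (phi : R -> R).

Lemma cabsE F x : cabs F x = Num.sqrt (re F x ^+ 2 + im F x ^+ 2).
Proof. by rewrite /cabs /re /im; case: (F x). Qed.

Lemma cabs_sq F x : cabs F x ^+ 2 = re F x ^+ 2 + im F x ^+ 2.
Proof. by rewrite cabsE sqr_sqrtr// addr_ge0 ?sqr_ge0. Qed.

Lemma cabs_ge0 F x : 0 <= cabs F x.
Proof. by rewrite cabsE sqrtr_ge0. Qed.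

Lemma re_le_cabs F x : `|re F x| <= cabs F x.
Proof.
by rewrite -(sqrtr_sqr (re F x)) cabsE ler_wsqrtr// lerDl sqr_ge0.
Qed.

Lemma im_le_cabs F x : `|im F x| <= cabs F x.
Proof.
by rewrite -(sqrtr_sqr (im F x)) cabsE ler_wsqrtr// lerDr sqr_ge0.
Qed.

Lemma cabs_le F x : cabs F x <= `|re F x| + `|im F x|.
Proof.
rewrite cabsE -[leRHS]ger0_norm ?addr_ge0// -sqrtr_sqr ler_wsqrtr//.
rewrite sqrrD !real_normK ?num_real// lerD2r lerDl.
by rewrite mulrn_wge0// mulr_ge0.
Qed.

Lemma meas_cabs F : cmeasurable F -> meas (cabs F).
Proof.
move=> [m1 m2]; rewrite (_ : cabs F = fun x => Num.sqrt (re F x ^+ 2 + im F x ^+ 2)).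
  apply: (measurableT_comp (cont_meas (@sqrt_continuous R))).
  by apply: measurable_funD; apply: measurable_funX.
by apply/funext => x; exact: cabsE.
Qed.

Lemma in_Lp_fin (p : R) F : 0 < p -> in_Lp p%:E F -> L1 (fun x => cabs F x `^ p).
Proof.
move=> p0 [mF]; rewrite unlock => /lty_poweRy h.
have mc := meas_cabs mF.
apply/integrableP; split.
  by apply/measurable_EFinP; exact: (measurableT_comp (measurable_powR p) mc).
have pi0 : p^-1 != 0 by rewrite invr_eq0 gt_eqF.
apply: le_lt_trans (h pi0); rewrite le_eqVlt; apply/orP; left; apply/eqP.
apply: eq_integral => x _ /=.
by rewrite !ger0_norm ?powR_ge0 ?cabs_ge0.
Qed.

Lemma in_L2 F : in_Lp 2%:E F ->
  [/\ meas (re F), meas (im F), L1 (fun x => re F x ^+ 2) & L1 (fun x => im F x ^+ 2)].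
Proof.
move=> LF; have [m1 m2] := LF.1; have L := in_Lp_fin (ltr0Sn _ 1) LF.
have E x : cabs F x `^ 2 = re F x ^+ 2 + im F x ^+ 2.
  by rewrite powR_mulrn ?cabs_ge0// cabs_sq.
split=> //; apply: (L1_dom _ _ L).
- exact: measurable_funX.
- by move=> x; rewrite E ger0_norm ?sqr_ge0// lerDl sqr_ge0.
- exact: measurable_funX.
- by move=> x; rewrite E ger0_norm ?sqr_ge0// lerDr sqr_ge0.
Qed.

Lemma in_Loo F : in_Lp +oo%E F -> [/\ meas (re F), meas (im F) &
  exists B, {ae mu, forall x, `|re F x| <= B /\ `|im F x| <= B}].
Proof.
move=> [[m1 m2]]; rewrite unlock.
have muT : (0 < mu [set: R])%E.
  apply: (@lt_le_trans _ _ (mu `[0%R, 1%R])).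
    by rewrite lebesgue_measure_itv/= lte_fin ltr01 oppr0 adde0 lte_fin ltr01.
  by apply: le_measure; rewrite ?inE.
case: ifP => [_|]; last by rewrite muT.
move=> h; split=> //.
have := @ess_sup_ge _ _ _ mu (abse \o (EFin \o cabs F)).
move: h; case: (ess_sup _ _) => [B| |]//= _ h; last first.
  (* An essential supremum [-oo] makes the bound false almost everywhere, so any constant will
     do. *)
  by exists 0; apply: ae_imp h => x /=.
exists B; apply: ae_imp h => x /=; rewrite lee_fin ger0_norm ?cabs_ge0// => h.
by split; apply: le_trans h; [exact: re_le_cabs|exact: im_le_cabs].
Qed.

Definition cosT phi xi := Int (fun x => phi x * cos (x * xi)).
Definition sinT phi xi := Int (fun x => phi x * sin (x * xi)).

Lemma cosTE phi xi : L1 phi -> cosT phi xi = (H phi xi + H phi (- xi)) / 2.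
Proof. by move=> Lphi; exact: (L1_cos xi Lphi).1. Qed.

Lemma sinTE phi xi : L1 phi -> sinT phi xi = (H phi xi - H phi (- xi)) / 2.
Proof. by move=> Lphi; exact: (L1_cos xi Lphi).2. Qed.

Lemma fourier_real phi xi :
  fourier (fun x => (phi x)%:C) xi = cosT phi xi +i* Int (fun x => - (phi x * sin (x * xi))).
Proof.
rewrite /fourier /cint; congr Complex; apply: eq_Int => x; rewrite /re /im /cexpi /=.
  by rewrite cosN sinN !mulr0 subr0 mulrC.
by rewrite cosN sinN !mulr0 add0r mulNr mulrC.
Qed.

Lemma L1_sin phi xi : L1 phi -> L1 (fun x => phi x * sin (x * xi)).
Proof.
move=> Lp; apply: eq_L1 (L1Z 2^-1 (L1B (L1_cas xi Lp) (L1_cas (- xi) Lp))) => z.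
by rewrite sin_cas mulrN; field.
Qed.

Lemma fourier_realE phi xi : L1 phi ->
  fourier (fun x => (phi x)%:C) xi = cosT phi xi +i* - sinT phi xi.
Proof. by move=> Lp; rewrite fourier_real IntN//; exact: L1_sin. Qed.

Lemma cintE F : cint F = Int (re F) +i* Int (im F).
Proof. by []. Qed.

Lemma cintegrableP F : cintegrable F <-> L1 (re F) /\ L1 (im F).
Proof. by []. Qed.

Lemma cint_mul_real F phi : cint (fun x => F x * (phi x)%:C) =
  Int (fun x => re F x * phi x) +i* Int (fun x => im F x * phi x).
Proof.
rewrite cintE; congr Complex; apply: eq_Int => x; rewrite /re /im; case: (F x) => a b /=.
  by rewrite mulr0 subr0.
by rewrite mulr0 add0r.
Qed.

Lemma cint_mul_fourier F phi : L1 phi -> cint (fun x => F x * fourier (fun y => (phi y)%:C) x) =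
  Int (fun x => re F x * cosT phi x + im F x * sinT phi x) +i*
  Int (fun x => im F x * cosT phi x - re F x * sinT phi x).
Proof.
move=> Lp; rewrite cintE; congr Complex; apply: eq_Int => x; rewrite /re /im fourier_realE//.
  by case: (F x) => a b /=; ring.
by case: (F x) => a b /=; ring.
Qed.

Definition schwartzR phi := smoothR phi /\
  forall j k : nat, exists B : R, forall x, `|x| ^+ j * `|derive1n k phi x| <= B.

Lemma schwartz_pair phi1 phi2 : schwartzR phi1 -> schwartzR phi2 ->
  schwartz (fun x => phi1 x +i* phi2 x).
Proof.
move=> [s1 b1] [s2 b2]; split=> [k x|j k].
  by split; [exact: s1|exact: s2].
have [B1 h1] := b1 j k; have [B2 h2] := b2 j k; exists (B1 + B2) => x.
apply: le_trans (_ : `|x| ^+ j * (`|derive1n k phi1 x| + `|derive1n k phi2 x|) <= _).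
  by rewrite ler_wpM2l ?exprn_ge0//; exact: cabs_le.
by rewrite mulrDr lerD.
Qed.

Lemma derive1n0fun k : derive1n k (fun=> 0 : R) = (fun=> 0 : R).
Proof.
elim: k => [//|k IH]; rewrite derive1nS IH.
exact: deriv_derive1 (deriv_cst 0).
Qed.

Lemma schwartzR0 : schwartzR (fun=> 0).
Proof.
split=> [k x|j k]; first by rewrite derive1n0fun; exact: derivable_cst.
by exists 0 => x; rewrite derive1n0fun normr0 mulr0.
Qed.

Lemma schwartz_real phi : schwartzR phi -> schwartz (fun x => (phi x)%:C).
Proof. by move=> sp; exact: schwartz_pair sp schwartzR0. Qed.

(** A family stable under differentiation that contains the translated Gaussians, through
    [expR (b * x)], the modulated ones, and their polynomial multiples. It puts all tests in the
    Schwartz class at once. *)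
Definition gpacket (P Q : {poly R}) (a t b : R) x :=
  (P.[x] * cos (a * x) + Q.[x] * sin (a * x)) * (gs t x * expR (b * x)).

Lemma deriv_poly (P : {poly R}) : has_deriv (horner P) (horner (P^`())).
Proof. by move=> x; exact: is_derive_poly. Qed.

Lemma gpacket_deriv P Q a t b : has_deriv (gpacket P Q a t b)
  (gpacket (P^`() + a *: Q + (b%:P - (2 * t) *: 'X) * P)
           (Q^`() - a *: P + (b%:P - (2 * t) *: 'X) * Q) a t b).
Proof.
have dc := deriv_comp (@deriv_cos R) (deriv_scale a).
have ds := deriv_comp (@deriv_sin R) (deriv_scale a).
have de := deriv_comp (@deriv_expR R) (deriv_scale b).
have := derivM (derivD (derivM (deriv_poly P) dc) (derivM (deriv_poly Q) ds))
  (derivM (deriv_gs t) de).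
congr has_deriv; apply/funext => x; rewrite /gpacket !hornerE /=; ring.
Qed.

Lemma gs_expR_bound (t b : R) : 0 < t -> exists2 C : R, 0 <= C &
  forall x, gs t x * expR (b * x) <= C.
Proof.
move=> t0; exists (expR (b ^+ 2 / (4 * t))) => [|x]; first exact: expR_ge0.
rewrite /gs -expRD ler_expR.
have -> : - (t * x ^+ 2) + b * x = b ^+ 2 / (4 * t) - t * (x - b / (2 * t)) ^+ 2.
  by field; rewrite gt_eqF.
by rewrite lerBlDr lerDl mulr_ge0 ?sqr_ge0 ?(ltW t0).
Qed.

Lemma gpacket_bound P Q a t b : 0 < t -> exists2 C : R, 0 <= C &
  forall x, `|gpacket P Q a t b x| <= C.
Proof.
move=> t0; have t20 : 0 < t / 2 by lra.
have [C C0 hC] := poly_gs_bounded P t20; have [D D0 hD] := poly_gs_bounded Q t20.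
have [E E0 hE] := gs_expR_bound b t20.
exists ((C + D) * E) => [|x]; first by rewrite mulr_ge0 ?addr_ge0.
have -> : gpacket P Q a t b x = ((P.[x] * cos (a * x) + Q.[x] * sin (a * x)) *
    gs (t / 2) x) * (gs (t / 2) x * expR (b * x)).
  by rewrite /gpacket [in LHS](splitr t) gsD; ring.
rewrite normrM.
have gE0 : 0 <= gs (t / 2) x * expR (b * x) by rewrite mulr_ge0 ?expR_ge0 ?gs_ge0.
apply: ler_pM; rewrite ?normr_ge0//; last by rewrite (ger0_norm gE0).
rewrite normrM (ger0_norm (gs_ge0 _ _)).
apply: le_trans (_ : (`|P.[x]| + `|Q.[x]|) * gs (t / 2) x <= _); last first.
  by rewrite mulrDl lerD.
rewrite ler_wpM2r ?gs_ge0//; apply: le_trans (ler_normD _ _) _.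
by rewrite !normrM lerD// ler_piMr// ?cos_max ?sin_max.
Qed.

Lemma gpacket_schwartz P Q a t b : 0 < t -> schwartzR (gpacket P Q a t b).
Proof.
move=> t0.
have cl f : (exists P Q, f = gpacket P Q a t b) ->
    exists2 g, exists P Q, g = gpacket P Q a t b & has_deriv f g.
  move=> [P' [Q' ->]]; eexists; last exact: gpacket_deriv.
  by do 2 eexists.
have f1 : exists P' Q', gpacket P Q a t b = gpacket P' Q' a t b by exists P, Q.
have [sm dk] := smooth_class cl f1; split=> // j k.
have [P' [Q' E]] := dk k.
have [C C0 hC] := gpacket_bound ('X^j * P') ('X^j * Q') a b t0.
exists C => x; rewrite E; apply: le_trans (hC x).
rewrite -normrX -normrM le_eqVlt; apply/orP; left; apply/eqP; congr (`|_|).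
rewrite /gpacket !hornerM hornerXn; move: (x ^+ j) => y; ring.
Qed.

Lemma gshiftE (t b x : R) :
  gshift t b x = expR (- (t * b ^+ 2)) * (gs t x * expR (2 * t * b * x)).
Proof. rewrite /gshift /gs -!expRD; congr (@expR R _); ring. Qed.

Lemma schwartz_gshift t b : 0 < t -> schwartzR (gshift t b).
Proof.
move=> t0; rewrite (_ : gshift t b = gpacket (expR (- (t * b ^+ 2)))%:P 0 0 t (2 * t * b)).
  exact: gpacket_schwartz.
by apply/funext => x; rewrite gshiftE /gpacket hornerC horner0 !mul0r cos0 mulr1 addr0.
Qed.

Lemma schwartz_sqgshift t b : 0 < t -> schwartzR (fun x => x ^+ 2 * gshift t b x).
Proof.
move=> t0; rewrite (_ : (fun x => _) =
    gpacket ((expR (- (t * b ^+ 2))) *: 'X^2) 0 0 t (2 * t * b)).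
  exact: gpacket_schwartz.
apply/funext => x; rewrite gshiftE /gpacket hornerZ hornerXn horner0 !mul0r cos0 mulr1 addr0.
by rewrite mulrCA mulrA.
Qed.

Lemma schwartz_gcos t a : 0 < t -> schwartzR (fun x => gs t x * cos (x * a)).
Proof.
move=> t0; rewrite (_ : (fun x => _) = gpacket 1 0 a t 0).
  exact: gpacket_schwartz.
apply/funext => x; rewrite /gpacket horner0 hornerC !mul0r expR0 mulr1 addr0 mul1r.
by rewrite mulrC (mulrC x).
Qed.

Lemma schwartz_gsin t a : 0 < t -> schwartzR (fun x => gs t x * sin (x * a)).
Proof.
move=> t0; rewrite (_ : (fun x => _) = gpacket 0 1 a t 0).
  exact: gpacket_schwartz.
apply/funext => x; rewrite /gpacket horner0 hornerC !mul0r expR0 mulr1 add0r mul1r.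
by rewrite mulrC (mulrC x).
Qed.

Lemma schwartz_gwave t a : 0 < t -> schwartzR (gwave t a).
Proof.
move=> t0; rewrite (_ : gwave t a = gpacket 1 1 a t 0).
  exact: gpacket_schwartz.
apply/funext => x; rewrite /gpacket /gwave /cas hornerC !mul0r expR0 mulr1.
by rewrite mulrC (mulrC x) !mul1r.
Qed.

End RealParts.

(** * Duality with Gaussian tests *)

Section FourierTests.
Variable R : realType.
Local Notation mu := (@lebesgue_measure R).
Local Notation meas := (measurable_fun [set: R]).
Implicit Types (f h P Q V : R -> R) (F : R -> R[i]) (a b x t s xi : R).

Lemma gauss_dom V (k : R -> R) (C s : R) : gauss_tempered V -> meas k -> 0 < s ->
  (forall x, `|k x| <= C * gs s x) -> L1 (fun x => V x * k x).
Proof.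
move=> [mV LV] mk s0 hk; apply: (L1_dom _ _ (L1Z C (L1_norm (LV s s0)))).
  exact: measurable_funM.
move=> x; rewrite !normrM (ger0_norm (gs_ge0 _ _)) mulrCA ler_wpM2l//.
Qed.

Lemma gshift_bound t b : 0 < t -> exists C : R, forall x, gshift t b x <= C * gs (t / 2) x.
Proof.
move=> t0; have t20 : 0 < t / 2 by lra.
have [C C0 hC] := gs_expR_bound (2 * t * b) t20.
exists (expR (- (t * b ^+ 2)) * C) => x.
have -> : gshift t b x =
    expR (- (t * b ^+ 2)) * ((gs (t / 2) x * expR (2 * t * b * x)) * gs (t / 2) x).
  by rewrite gshiftE [in gs t x](splitr t) gsD; ring.
rewrite -[leRHS]mulrA; apply: ler_wpM2l; first exact: expR_ge0.
by rewrite ler_wpM2r ?gs_ge0.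
Qed.

Lemma gshift_ge0 t b x : 0 <= gshift t b x.
Proof. exact: gs_ge0. Qed.

Lemma gshift_opp t b x : gshift t b (- x) = gshift t (- b) x.
Proof. by rewrite /gshift -gs_opp; congr gs; ring. Qed.

(* Schwartz functions whose transform has Gaussian decay: pairings with a
   [gauss_tempered] function converge on both sides of the duality formula. *)
Definition gtest P := [/\ schwartzR P, L1 P &
  exists C s, 0 < s /\ forall xi, `|H P xi| <= C * gs s xi].

Lemma gtest_H V P : gauss_tempered V -> gtest P -> L1 (fun x => V x * H P x).
Proof.
move=> tV [_ LP [C [s [s0 hC]]]].
exact: (gauss_dom tV (H_meas LP) s0 hC).
Qed.

Lemma gtest_cosT V P : gauss_tempered V -> gtest P ->
  L1 (fun x => V x * cosT P x) /\ L1 (fun x => V x * sinT P x).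
Proof.
move=> tV [_ LP [C [s [s0 hC]]]].
have mH := H_meas LP.
have mH' : meas (fun x => H P (- x)) by exact: (measurableT_comp mH (@meas_opp R)).
have E1 : cosT P = fun xi => (H P xi + H P (- xi)) / 2 by apply/funext => xi; exact: cosTE.
have E2 : sinT P = fun xi => (H P xi - H P (- xi)) / 2 by apply/funext => xi; exact: sinTE.
have B x : `|H P x| + `|H P (- x)| <= C * gs s x *+ 2.
  by rewrite mulr2n lerD// -(gs_opp s x).
split; apply: (gauss_dom (C := C) (s := s) tV _ s0).
- by rewrite E1; solve_meas.
- move=> x; rewrite E1 normrM (ger0_norm (_ : 0 <= 2^-1)) ?invr_ge0// ler_pdivrMr//.
  by rewrite mulr_natr; apply: le_trans (ler_normD _ _) (B x).
- by rewrite E2; solve_meas.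
- move=> x; rewrite E2 normrM (ger0_norm (_ : 0 <= 2^-1)) ?invr_ge0// ler_pdivrMr//.
  by rewrite mulr_natr; apply: le_trans (ler_normB _ _) (B x).
Qed.

Lemma gtest_gshift t b : 0 < t -> gtest (gshift t b).
Proof.
move=> t0; split; [exact: schwartz_gshift|exact: L1_gshift|].
exists (cg t * 2), (4 * t)^-1; split; first by rewrite invr_gt0 mulr_gt0.
move=> xi; rewrite H_gshift// normrM (ger0_norm (ltW (cg_gt0 t0))) -(mulrA (cg t)).
apply: ler_wpM2l; first exact: ltW (cg_gt0 t0).
rewrite /gwave normrM (ger0_norm (gs_ge0 _ _)) mulrC.
by rewrite ler_wpM2r ?gs_ge0// cas_le2.
Qed.

Lemma gtest_gwave t a : 0 < t -> gtest (gwave t a).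
Proof.
move=> t0; split; [exact: schwartz_gwave|exact: L1_gwave|].
have s0 : 0 < (4 * t)^-1 by rewrite invr_gt0 mulr_gt0.
have [C hC] := gshift_bound a s0.
exists (cg t * C), ((4 * t)^-1 / 2); split; first by rewrite divr_gt0.
move=> xi; rewrite H_gwave// normrM (ger0_norm (ltW (cg_gt0 t0))) -(mulrA (cg t)).
apply: ler_wpM2l; first exact: ltW (cg_gt0 t0).
by rewrite (ger0_norm (gshift_ge0 _ _ _)).
Qed.

Lemma gcosE t a x : gs t x * cos (x * a) = 2^-1 * (gwave t a x + gwave t (- a) x).
Proof. by rewrite /gwave cos_cas mulrN; field. Qed.

Lemma gsinE t a x : gs t x * sin (x * a) = 2^-1 * (gwave t a x - gwave t (- a) x).
Proof. by rewrite /gwave sin_cas mulrN; field. Qed.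

Lemma L1_gcos t a : 0 < t ->
  L1 (fun x => gs t x * cos (x * a)) /\ L1 (fun x => gs t x * sin (x * a)).
Proof.
move=> t0; split.
  exact: eq_L1 (fun x => esym (gcosE t a x)) (L1Z 2^-1 (L1D (L1_gwave a t0) (L1_gwave (- a) t0))).
exact: eq_L1 (fun x => esym (gsinE t a x)) (L1Z 2^-1 (L1B (L1_gwave a t0) (L1_gwave (- a) t0))).
Qed.

Lemma HB P Q : L1 P -> L1 Q -> forall xi, H (fun x => P x - Q x) xi = H P xi - H Q xi.
Proof.
move=> LP LQ xi; rewrite -[- H Q xi]mulN1r -HZ// -HD//; last exact: L1Z.
by apply: eq_Int => x; rewrite mulN1r.
Qed.

Lemma eq_H P Q : P =1 Q -> H P =1 H Q.
Proof. by move=> E xi; apply: eq_Int => x; rewrite E. Qed.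

Lemma H_gcos t a xi : 0 < t -> let s := (4 * t)^-1 in
  H (fun x => gs t x * cos (x * a)) xi =
    cg t / 2 * (gshift s a xi + gshift s (- a) xi) /\
  H (fun x => gs t x * sin (x * a)) xi =
    cg t / 2 * (gshift s a xi - gshift s (- a) xi).
Proof.
move=> t0 s; have L1' := L1_gwave a t0; have L2' := L1_gwave (- a) t0; split.
  rewrite (eq_H (gcosE t a)) HZ; last exact: L1D.
  by rewrite HD// !H_gwave//; field.
rewrite (eq_H (gsinE t a)) HZ; last exact: L1B.
by rewrite HB// !H_gwave//; field.
Qed.

Lemma gtest_gcos t a : 0 < t -> gtest (fun x => gs t x * cos (x * a)) /\
  gtest (fun x => gs t x * sin (x * a)).
Proof.
move=> t0; have c0 := cg_gt0 t0.
have s0 : 0 < (4 * t)^-1 by rewrite invr_gt0 mulr_gt0.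
have [C hC] := gshift_bound a s0; have [D hD] := gshift_bound (- a) s0.
have B xi : `|gshift (4 * t)^-1 a xi| + `|gshift (4 * t)^-1 (- a) xi| <=
    (C + D) * gs ((4 * t)^-1 / 2) xi.
  rewrite (ger0_norm (gshift_ge0 _ a _)) (ger0_norm (gshift_ge0 _ (- a) _)) (mulrDl C D).
  exact: lerD (hC xi) (hD xi).
split; split.
- exact: schwartz_gcos.
- exact: (L1_gcos a t0).1.
- exists (cg t / 2 * (C + D)), ((4 * t)^-1 / 2); split; first by rewrite divr_gt0.
  move=> xi; rewrite (H_gcos a xi t0).1 normrM (ger0_norm (_ : 0 <= cg t / 2)); last first.
    by rewrite divr_ge0// (ltW c0).
  rewrite -mulrA ler_wpM2l ?divr_ge0// ?(ltW c0)//.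
  exact: le_trans (ler_normD _ _) (B xi).
- exact: schwartz_gsin.
- exact: (L1_gcos a t0).2.
- exists (cg t / 2 * (C + D)), ((4 * t)^-1 / 2); split; first by rewrite divr_gt0.
  move=> xi; rewrite (H_gcos a xi t0).2 normrM (ger0_norm (_ : 0 <= cg t / 2)); last first.
    by rewrite divr_ge0// (ltW c0).
  rewrite -mulrA ler_wpM2l ?divr_ge0// ?(ltW c0)//.
  exact: le_trans (ler_normB _ _) (B xi).
Qed.

Lemma is_function_real (T : distribution_on_schwartz R) F P : is_function T F -> schwartzR P ->
  [/\ L1 (fun x => re F x * P x), L1 (fun x => im F x * P x) &
      T (fun x => (P x)%:C) = Int (fun x => re F x * P x) +i* Int (fun x => im F x * P x)].
Proof.
move=> [_ hT] sP; have [iP ->] := hT _ (schwartz_real sP).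
rewrite /dist_of cint_mul_real; move/cintegrableP: iP => [i1 i2]; split=> //.
  by apply: eq_L1 i1 => x; rewrite /re; case: (F x) => a b /=; rewrite mulr0 subr0.
by apply: eq_L1 i2 => x; rewrite /im; case: (F x) => a b /=; rewrite mulr0 add0r.
Qed.

(** The complex duality formula separated into real and imaginary parts; the transform of a real
    test [P] is [cosT P - i sinT P]. *)
Lemma fourier_extract (f F : R -> R[i]) P : gauss_tempered (re f) -> gauss_tempered (im f) ->
  is_function (fourier_dist (dist_of f)) F -> gtest P ->
  Int (fun x => re F x * P x) =
    Int (fun x => re f x * cosT P x) + Int (fun x => im f x * sinT P x) /\
  Int (fun x => im F x * P x) =
    Int (fun x => im f x * cosT P x) - Int (fun x => re f x * sinT P x).
Proof.
move=> t1 t2 hF gP; have [sP LP _] := gP.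
have [_ _] := is_function_real hF sP.
have [c1 s1] := gtest_cosT t1 gP; have [c2 s2] := gtest_cosT t2 gP.
rewrite /fourier_dist /dist_of cint_mul_fourier// IntD// IntB//.
by case=> -> ->.
Qed.

Lemma Int_odd (k : R -> R) : L1 k -> {ae mu, forall x, k (- x) = - k x} -> Int k = 0.
Proof.
move=> Lk hk; have [Lk' Ek] := Int_opp Lk.
have : Int k = - Int k.
  rewrite -{1}Ek -(IntN Lk); apply: aeq_Int => //; first exact: L1_meas.
  exact: meas_opp_fun (L1_meas Lk).
by lra.
Qed.

(** Reflecting [V] amounts to reflecting the centre of the test Gaussian, so parity, even or odd
    according to the sign [e], can be read off the pairings. *)
Lemma gauss_symmetric V (e : R) : gauss_tempered V ->
  (forall t b, 0 < t -> Int (fun x => V x * gshift t b x) =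
     e * Int (fun x => V x * gshift t (- b) x)) ->
  aeq V (fun x => e * V (- x)).
Proof.
move=> tV hV; have [mV LV] := tV.
have tV' : gauss_tempered (fun x => V (- x)).
  split=> [|t t0]; first exact: (measurableT_comp mV (@meas_opp R)).
  by apply: eq_L1 (Int_opp (LV t t0)).1 => x; rewrite gs_opp.
have := gauss_unique (gauss_temperedB tV (gauss_temperedZ e tV')).
move=> U; apply: ae_imp (U _) => [x /subr0_eq //|t b t0].
have L1' := gauss_tempered_L1M tV t0 b; have L2' := gauss_tempered_L1M tV t0 (- b).
have [L3 E3] := Int_opp L2'.
rewrite -[RHS](subrr (Int (fun x => V x * gshift t b x))) {2}(hV t b t0) -E3 -(IntZ e L3).
rewrite -(IntB L1' (L1Z e L3)); apply: eq_Int => x.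
by rewrite gshift_opp opprK mulrBl mulrA.
Qed.

Lemma cosT_gshift_opp t b xi : 0 < t ->
  cosT (gshift t (- b)) xi = cosT (gshift t b) xi /\
  sinT (gshift t (- b)) xi = - sinT (gshift t b) xi.
Proof.
move=> t0; have Lb := L1_gshift b t0; have Lb' := L1_gshift (- b) t0.
have E y : H (gshift t (- b)) y = H (gshift t b) (- y).
  by rewrite -(H_opp Lb); apply: eq_H => x; rewrite gshift_opp.
rewrite (cosTE xi Lb') (cosTE xi Lb) (sinTE xi Lb') (sinTE xi Lb) !E opprK; split; first by rewrite addrC.
by field.
Qed.

Lemma fourier_extract_real f F P : gauss_tempered f ->
  is_function (fourier_dist (dist_of (fun x => (f x)%:C))) F -> gtest P ->
  Int (fun x => re F x * P x) = Int (fun x => f x * cosT P x) /\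
  Int (fun x => im F x * P x) = - Int (fun x => f x * sinT P x).
Proof.
move=> tf hF gP.
have E0 (k : R -> R) : Int (fun x => im (fun x => (f x)%:C) x * k x) = 0.
  by rewrite -[RHS]Int0; apply: eq_Int => x; rewrite /im /= mul0r.
have t0' : gauss_tempered (im (fun x => (f x)%:C)).
  by apply: gauss_tempered_L1; exact: L1_0.
have [-> ->] := @fourier_extract (fun x => (f x)%:C) F P tf t0' hF gP.
by rewrite (E0 (sinT P)) (E0 (cosT P)) addr0 add0r.
Qed.

Lemma fourier_parity f F : gauss_tempered f -> gauss_tempered (re F) ->
  gauss_tempered (im F) -> is_function (fourier_dist (dist_of (fun x => (f x)%:C))) F ->
  aeq (re F) (fun x => re F (- x)) /\ aeq (im F) (fun x => - im F (- x)).
Proof.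
move=> tf t1 t2 hF.
have X P := @fourier_extract_real f F P tf hF.
split.
  apply: ae_imp (gauss_symmetric (e := 1) t1 _) => [x ->|t b t0]; first by rewrite mul1r.
  have [X1 _] := X _ (gtest_gshift b t0); have [X2 _] := X _ (gtest_gshift (- b) t0).
  refine (etrans X1 _); rewrite mul1r; refine (etrans _ (esym X2)).
  by apply: eq_Int => x; rewrite (cosT_gshift_opp b x t0).1.
apply: ae_imp (gauss_symmetric (e := -1) t2 _) => [x ->|t b t0]; first by rewrite mulN1r.
have [_ X1] := X _ (gtest_gshift b t0); have [_ X2] := X _ (gtest_gshift (- b) t0).
refine (etrans X1 _); rewrite mulN1r; congr (- _); refine (etrans _ (esym X2)).
have Ls := (gtest_cosT tf (gtest_gshift b t0)).2.
refine (etrans _ (IntN (gtest_cosT tf (gtest_gshift (- b) t0)).2)).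
by apply: eq_Int => x; rewrite (cosT_gshift_opp b x t0).2 mulrN opprK.
Qed.

(* A real even symbol preserves real functions: [gs * cos] and [gs * sin] isolate
   the even and odd parts of [im h]. *)
Lemma fourier_real_valued (h Q : R -> R[i]) :
  gauss_tempered (re h) -> gauss_tempered (im h) ->
  is_function (fourier_dist (dist_of h)) Q ->
  aeq (re Q) (fun x => re Q (- x)) -> aeq (im Q) (fun x => - im Q (- x)) ->
  aeq (im h) (fun=> 0).
Proof.
move=> t1 t2 hQ e1 e2; apply: (gauss_unique t2) => s b s0.
(* With this [t] the transforms of the two tests are combinations of the Gaussians of parameter [s]
   centred at [b] and [- b]. *)
set t := (4 * s)^-1.
have t0 : 0 < t by rewrite invr_gt0 mulr_gt0.
have st : (4 * t)^-1 = s by rewrite /t; field; rewrite gt_eqF.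
have [gc gsn] := gtest_gcos b t0.
have [Lc Ls] := L1_gcos b t0.
have X := fourier_extract t1 t2 hQ.
have [Qc1 Qc2 _] := is_function_real hQ (let: And3 sP _ _ := gc in sP).
have [Qs1 Qs2 _] := is_function_real hQ (let: And3 sP _ _ := gsn in sP).
have [_ Xc] := X _ gc; have [Xs _] := X _ gsn.
have Z1 : Int (fun x => im Q x * (gs t x * cos (x * b))) = 0.
  apply: (Int_odd Qc2); apply: ae_imp e2 => x E.
  by rewrite gs_opp mulNr cosN E; ring.
have Z2 : Int (fun x => re Q x * (gs t x * sin (x * b))) = 0.
  apply: (Int_odd Qs1); apply: ae_imp e1 => x E.
  by rewrite gs_opp mulNr sinN -E; ring.
have C1 y : cosT (fun x => gs t x * cos (x * b)) y =
    cg t / 2 * (gshift s b y + gshift s (- b) y).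
  by rewrite cosTE// !(H_gcos b _ t0).1 st !gshift_opp opprK; field.
have C2 y : sinT (fun x => gs t x * cos (x * b)) y = 0.
  by rewrite sinTE// !(H_gcos b _ t0).1 st !gshift_opp opprK; field.
have S1 y : cosT (fun x => gs t x * sin (x * b)) y = 0.
  by rewrite cosTE// !(H_gcos b _ t0).2 st !gshift_opp opprK; field.
have S2 y : sinT (fun x => gs t x * sin (x * b)) y =
    cg t / 2 * (gshift s b y - gshift s (- b) y).
  by rewrite sinTE// !(H_gcos b _ t0).2 st !gshift_opp opprK; field.
have I0 (k k' : R -> R) : (forall y, k' y = 0) -> Int (fun x => k x * k' x) = 0.
  by move=> E; rewrite -[RHS]Int0; apply: eq_Int => x; rewrite E mulr0.
have A1 := gauss_tempered_L1M t2 s0 b; have A2 := gauss_tempered_L1M t2 s0 (- b).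
have K0 := cg_gt0 t0.
have EA : Int (fun x => im h x * cosT (fun x => gs t x * cos (x * b)) x) =
    cg t / 2 * (Int (fun x => im h x * gshift s b x) + Int (fun x => im h x * gshift s (- b) x)).
  rewrite -(IntD A1 A2) -(IntZ _ (L1D A1 A2)); apply: eq_Int => x.
  by rewrite C1; ring.
have EB : Int (fun x => im h x * sinT (fun x => gs t x * sin (x * b)) x) =
    cg t / 2 * (Int (fun x => im h x * gshift s b x) - Int (fun x => im h x * gshift s (- b) x)).
  rewrite -(IntB A1 A2) -(IntZ _ (L1B A1 A2)); apply: eq_Int => x.
  by rewrite S2; ring.
have := etrans (etrans (esym Z1) Xc) (etrans (congr1 (fun z => _ - z) (I0 (re h) _ C2)) (subr0 _)).
have := etrans (etrans (esym Z2) Xs) (etrans (congr1 (fun z => z + _) (I0 (re h) _ S1)) (add0r _)).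
move=> /(fun E => etrans E EB); move=> + /(fun E => etrans E EA).
move: (Int _) (Int _) => A B /esym/eqP; rewrite mulf_eq0 gt_eqF ?divr_gt0//= => /eqP AB.
move=> /esym/eqP; rewrite mulf_eq0 gt_eqF ?divr_gt0//= => /eqP AB'.
by clear -AB AB'; lra.
Qed.

End FourierTests.

(** * The symbol, the convolution and the kernel *)

Section SpectralData.
Variable R : realType.
Local Notation mu := (@lebesgue_measure R).
Local Notation meas := (measurable_fun [set: R]).
Implicit Types (f P w : R -> R) (F h : R -> R[i]) (a b x t s xi : R).
Implicit Types (T W L : distribution_on_schwartz R).

Lemma Mc_gt0 F c xi : 0 < Mc F c xi ->
  [/\ im F xi = 0, 0 < xi ^+ 2 + 2 * re F xi - c ^+ 2 &
    Mc F c xi = (xi ^+ 2 + 2 * re F xi - c ^+ 2)%:C].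
Proof.
have -> : Mc F c xi = (xi ^+ 2 + 2 * re F xi - c ^+ 2) +i* (2 * im F xi).
  rewrite /Mc /re /im; case: (F xi) => a b /=.
  by apply/eqP; rewrite eq_complex /=; apply/andP; split; apply/eqP; ring.
rewrite ltcE /= => /andP[/eqP h1 h2].
have i0 : im F xi = 0 by clear -h1; lra.
by split=> //; rewrite i0 mulr0.
Qed.

Lemma inv_real (x : R) : (x%:C)^-1 = (x^-1)%:C.
Proof. exact: esym (fmorphV (real_complex R) x). Qed.

(** The indicator of a null set has integral zero, and so has its reflection. *)
Lemma ae_opp (S : R -> Prop) : {ae mu, forall x, S x} -> {ae mu, forall x, S (- x)}.
Proof.
move=> /aeP[N [mN N0 hN]].
have mi : meas (\1_N : R -> R) by exact: measurable_indic.
have i0 : aeq (\1_N : R -> R) (fun=> 0).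
  apply/aeP; exists N; split=> // x Nx; rewrite indicE.
  by case: (boolP (x \in N)) => //; rewrite inE.
have Li : L1 (\1_N : R -> R).
  apply: aeq_L1 mi _ (L1_0 R); first exact: measurable_cst.
  by apply: ae_imp i0 => x ->.
have [Lo Eo] := Int_opp Li.
have i_ge0 x : 0 <= (\1_N (- x) : R) by rewrite indicE ler0n.
have Io : Int (fun x => \1_N (- x) : R) = 0.
  by rewrite Eo (aeq_Int mi (measurable_cst _) i0) Int0.
apply: ae_imp (Int_ae0 Lo i_ge0 Io) => x /eqP.
rewrite indicE pnatr_eq0 eqb0 => Nx; apply: hN => N'; move: Nx.
by rewrite mem_set.
Qed.

Lemma is_function_tempered T F : is_function T F ->
  gauss_tempered (re F) /\ gauss_tempered (im F).
Proof.
move=> hT; have [[m1 m2] _] := hT.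
have E t : gshift t 0 =1 gs t by move=> x; rewrite /gshift subr0.
split; split=> // t t0; have [i1 i2 _] := is_function_real hT (schwartz_gshift 0 t0).
  by apply: eq_L1 i1 => x; rewrite E.
by apply: eq_L1 i2 => x; rewrite E.
Qed.

Lemma is_function_unique T F G : is_function T F -> is_function T G ->
  aeq (re F) (re G) /\ aeq (im F) (im G).
Proof.
move=> hF hG; have [f1 f2] := is_function_tempered hF; have [g1 g2] := is_function_tempered hG.
have X t b : 0 < t ->
    Int (fun x => re F x * gshift t b x) = Int (fun x => re G x * gshift t b x) /\
    Int (fun x => im F x * gshift t b x) = Int (fun x => im G x * gshift t b x).
  move=> t0; have [_ _ E1] := is_function_real hF (schwartz_gshift b t0).
  by have [_ _] := is_function_real hG (schwartz_gshift b t0); rewrite E1 => -[-> ->].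
split.
  apply: ae_imp (gauss_unique (gauss_temperedB f1 g1) _) => [x /subr0_eq //|t b t0].
  rewrite -[RHS](subrr (Int (fun x => re F x * gshift t b x))) {2}(X t b t0).1.
  rewrite -(IntB (gauss_tempered_L1M f1 t0 b) (gauss_tempered_L1M g1 t0 b)).
  by apply: eq_Int => x; rewrite mulrBl.
apply: ae_imp (gauss_unique (gauss_temperedB f2 g2) _) => [x /subr0_eq //|t b t0].
rewrite -[RHS](subrr (Int (fun x => im F x * gshift t b x))) {2}(X t b t0).2.
rewrite -(IntB (gauss_tempered_L1M f2 t0 b) (gauss_tempered_L1M g2 t0 b)).
by apply: eq_Int => x; rewrite mulrBl.
Qed.

(** [fourier_dist] sees a test through its transform. Evenness of [W] and the representation of [L]
    by a function can be applied there only once that transform is known to be Schwartz. *)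
Lemma schwartz_fourier_gshift t b : 0 < t ->
  schwartz (fourier (fun x => (gshift t b x)%:C)).
Proof.
move=> t0; set s := (4 * t)^-1.
have s0 : 0 < s by rewrite invr_gt0 mulr_gt0.
have Lg := L1_gshift b t0.
rewrite (_ : fourier _ = fun xi => gpacket (cg t)%:P 0 b s 0 xi +i* gpacket 0 (- cg t)%:P b s 0 xi).
  by apply: schwartz_pair; exact: gpacket_schwartz.
apply/funext => xi; rewrite (fourier_realE xi Lg) (cosTE xi Lg) (sinTE xi Lg).
rewrite !H_gshift// -/s /gpacket /gwave !horner0 !hornerC !mul0r expR0 addr0 add0r.
rewrite gs_opp mulNr /cas cosN sinN (mulrC b) mulr1.
by congr Complex; field.
Qed.

(** The transform of the Gaussian centred at [- b] is the reflection of the one centred at [b], so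
    an even [W] gives both the same pairing. *)
Lemma symbol_even W F : even_dist W -> is_function (fourier_dist W) F ->
  aeq (re F) (fun x => re F (- x)).
Proof.
move=> eW hF; have [t1 _] := is_function_tempered hF.
apply: ae_imp (gauss_symmetric (e := 1) t1 _) => [x ->|t b t0]; first by rewrite mul1r.
have [_ _ E1] := is_function_real hF (schwartz_gshift b t0).
have [_ _ E2] := is_function_real hF (schwartz_gshift (- b) t0).
have Lb := L1_gshift b t0; have Lb' := L1_gshift (- b) t0.
have X : (fun xi => fourier (fun x => (gshift t b x)%:C) (- xi)) =
    fourier (fun x => (gshift t (- b) x)%:C).
  apply/funext => xi; rewrite (fourier_realE _ Lb) (fourier_realE _ Lb').
  rewrite (cosT_gshift_opp b xi t0).1 (cosT_gshift_opp b xi t0).2 opprK.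
  rewrite (cosTE xi Lb) (cosTE (- xi) Lb) (sinTE xi Lb) (sinTE (- xi) Lb) opprK.
  by congr Complex; [rewrite addrC|field].
have Y : fourier_dist W (fun x => (gshift t b x)%:C) =
    fourier_dist W (fun x => (gshift t (- b) x)%:C).
  by rewrite /fourier_dist -X; exact: esym (eW _ (schwartz_fourier_gshift b t0)).
by have [e _] := etrans (etrans (esym E1) Y) E2; rewrite mul1r; exact: e.
Qed.

(** [Phi = re F - im F] is the Hartley transform of [f] when [F] is its Fourier transform. A real
    symbol multiplies [Phi] as it multiplies [F]; being even as well, it keeps [h] real. *)
Lemma convolution_data W (w : R -> R[i]) c f h :
  even_dist W -> in_Lp +oo%E w -> is_function (fourier_dist W) w ->
  {ae mu, forall xi, 0 < Mc w c xi} ->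
  is_convolution W (fun x => (f x)%:C) h ->
  exists Phi, [/\ gauss_tempered Phi, meas (re h) /\ L1 (fun x => re h x ^+ 2),
    aeq (im h) (fun=> 0) &
    forall P, gtest P -> Int (fun x => Phi x * P x) = Int (fun x => f x * H P x) /\
      Int (fun x => re w x * Phi x * P x) = Int (fun x => re h x * H P x)].
Proof.
move=> eW wL hw M0 [w' [F [w'L hw' [/in_L2[mf _ Lf _] /in_L2[mF1 mF2 LF1 LF2] hF]]]].
move=> [/in_L2[mh1 mh2 Lh1 Lh2] /in_L2[mQ1 mQ2 LQ1 LQ2] hQ].
have [mw1 mw2 [B hB]] := in_Loo wL.
have tf : gauss_tempered f by exact: (gauss_tempered_sq mf Lf).
have tF1 := gauss_tempered_sq mF1 LF1; have tF2 := gauss_tempered_sq mF2 LF2.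
have th1 := gauss_tempered_sq mh1 Lh1; have th2 := gauss_tempered_sq mh2 Lh2.
have tQ1 := gauss_tempered_sq mQ1 LQ1; have tQ2 := gauss_tempered_sq mQ2 LQ2.
have [ww1 ww2] := is_function_unique hw hw'.
have we := symbol_even eW hw.
have [e1 e2] := fourier_parity tf tF1 tF2 hF.
(* The convolution carries a symbol [w'] of its own, which agrees with [w] almost everywhere by
   uniqueness; the positivity of [M_c] makes it real. *)
have QE : {ae mu, forall x, re (fun xi => w' xi * F xi) x = re w x * re F x /\
    im (fun xi => w' xi * F xi) x = re w x * im F x}.
  apply: ae_imp3 ww1 ww2 M0 => x; rewrite /re /im /=.
  move=> + + /Mc_gt0[]; rewrite /re /im; case: (w x) => a b; case: (w' x) => a' b'.
  case: (F x) => p q /= <- <- -> _ _; split; ring.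
have h0 : aeq (im h) (fun=> 0).
  apply: (fourier_real_valued th1 th2 hQ).
    apply: ae_imp3 (ae_imp2 (fun x A B => conj A B) QE (ae_opp QE)) we e1.
    by move=> x [[-> _] [-> _]] <- <-.
  apply: ae_imp3 (ae_imp2 (fun x A B => conj A B) QE (ae_opp QE)) we e2.
  by move=> x [[_ ->] [_ ->]] <- ->; rewrite mulrN.
exists (fun x => re F x - im F x); split=> //; first exact: gauss_temperedB.
move=> P gP; have [sP LP _] := gP.
have HE x : H P x = cosT P x + sinT P x by rewrite (cosTE x LP) (sinTE x LP); field.
have [F1i F2i _] := is_function_real hF sP; have [Q1i Q2i _] := is_function_real hQ sP.
split.
  have [X1 X2] := fourier_extract_real tf hF gP.
  have [c1 s1] := gtest_cosT tf gP.
  transitivity (Int (fun x => re F x * P x) - Int (fun x => im F x * P x)).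
    by rewrite -(IntB F1i F2i); apply: eq_Int => x; rewrite mulrBl.
  apply: etrans (congr2 (fun y z => y - z) X1 X2) _; rewrite opprK -(IntD c1 s1).
  by apply: eq_Int => x; rewrite HE mulrDr.
have [X1 X2] := fourier_extract th1 th2 hQ gP.
have [c1 s1] := gtest_cosT th1 gP; have [c2 s2] := gtest_cosT th2 gP.
have Z (k : R -> R) : L1 (fun x => im h x * k x) -> Int (fun x => im h x * k x) = 0.
  move=> Lk; rewrite -[RHS]Int0; apply: aeq_Int; first exact: L1_meas Lk.
    exact: measurable_cst.
  by apply: ae_imp h0 => x ->; rewrite mul0r.
transitivity (Int (fun x => re (fun xi => w' xi * F xi) x * P x) -
    Int (fun x => im (fun xi => w' xi * F xi) x * P x)).
  rewrite -(IntB Q1i Q2i); apply: aeq_Int.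
  - apply: measurable_funM; last exact: L1_meas.
    by apply: measurable_funM => //; exact: measurable_funB.
  - exact: (L1_meas (L1B Q1i Q2i)).
  - by apply: ae_imp QE => x [-> ->]; ring.
apply: etrans (congr2 (fun y z => y - z) X1 X2) _.
apply: etrans (congr2 (fun y z => _ + y - (z - _)) (Z _ s2) (Z _ c2)) _.
rewrite addr0 sub0r opprK -(IntD c1 s1).
by apply: eq_Int => x; rewrite HE mulrDr.
Qed.

(** As [re r] is even, the pairings with the centres [b] and [- b] coincide; comparing them removes
    the sine terms. The cosine terms see only the even part of [re l]. *)
Lemma kernel_data L (r l : R -> R[i]) :
  is_function (fourier_dist L) r -> is_function L l ->
  L1 (re l) -> L1 (im l) -> aeq (re r) (fun x => re r (- x)) ->
  aeq (re r) (H (fun x => (re l x + re l (- x)) / 2)).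
Proof.
move=> hr hl L1' L2' er.
have [tr _] := is_function_tempered hr.
have tl1 := gauss_tempered_L1 L1'; have tl2 := gauss_tempered_L1 L2'.
have [Lo _] := Int_opp L1'.
have Le : L1 (fun x => (re l x + re l (- x)) / 2).
  by apply: eq_L1 (L1Z 2^-1 (L1D L1' Lo)) => x; rewrite mulrC.
have tH := gauss_tempered_H Le.
apply: ae_imp (gauss_unique (gauss_temperedB tr tH) _) => [x /subr0_eq //|t b t0].
have gb := gtest_gshift b t0; have Lb := L1_gshift b t0.
have A t' b' (t0' : 0 < t') : Int (fun x => re r x * gshift t' b' x) =
    Int (fun x => re l x * cosT (gshift t' b') x) +
    Int (fun x => im l x * sinT (gshift t' b') x).
  have [_ _] := is_function_real hr (schwartz_gshift b' t0').
  have [_ E] := hl.2 _ (schwartz_fourier_gshift b' t0').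
  rewrite /fourier_dist E /dist_of (cint_mul_fourier _ (L1_gshift b' t0')).
  case=> <- _; have [c1 _] := gtest_cosT tl1 (gtest_gshift b' t0').
  have [_ s2] := gtest_cosT tl2 (gtest_gshift b' t0').
  by rewrite (IntD c1 s2).
have [c1 _] := gtest_cosT tl1 gb.
have E1 : Int (fun x => re r x * gshift t b x) =
    Int (fun x => re l x * cosT (gshift t b) x).
  have I1 := gauss_tempered_L1M tr t0 b; have I2 := gauss_tempered_L1M tr t0 (- b).
  have [I3 E3] := Int_opp I2.
  have S : Int (fun x => re r x * gshift t b x) = Int (fun x => re r x * gshift t (- b) x).
    rewrite -E3; apply: aeq_Int; [exact: L1_meas I1|exact: L1_meas I3|].
    by apply: ae_imp er => x E; rewrite gshift_opp opprK -E.
  have S1 : Int (fun x => re l x * cosT (gshift t (- b)) x) =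
      Int (fun x => re l x * cosT (gshift t b) x).
    by apply: eq_Int => x; rewrite (cosT_gshift_opp b x t0).1.
  have S2 : Int (fun x => im l x * sinT (gshift t (- b)) x) =
      - Int (fun x => im l x * sinT (gshift t b) x).
    have [_ s2] := gtest_cosT tl2 gb.
    by rewrite -(IntN s2); apply: eq_Int => x; rewrite (cosT_gshift_opp b x t0).2 mulrN.
  have A1 := A t b t0; have A2 := etrans (A t (- b) t0) (congr2 (fun y z => y + z) S1 S2).
  move: S A1 A2; move: (Int _) (Int _) (Int _) (Int _) => x1 x2 x3 x4 h1 h2 h3.
  by clear -h1 h2 h3; lra.
have E2 : Int (fun x => re l x * cosT (gshift t b) x) =
    Int (fun x => H (fun x => (re l x + re l (- x)) / 2) x * gshift t b x).
  transitivity (Int (fun x => (re l x + re l (- x)) / 2 * H (gshift t b) x)); last first.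
    by rewrite -(H_swap Lb Le); apply: eq_Int => x; rewrite mulrC.
  have J1 := gtest_H tl1 gb.
  have mo : gauss_tempered (fun x => re l (- x)) by exact: gauss_tempered_L1.
  have J2 := gtest_H mo gb.
  have [J3 E3] := Int_opp J2.
  transitivity (2^-1 * (Int (fun x => re l x * H (gshift t b) x) +
      Int (fun x => re l (- x) * H (gshift t b) x))).
    rewrite -E3 -(IntD J1 J3) -(IntZ _ (L1D J1 J3)); apply: eq_Int => x.
    by rewrite (cosTE x Lb) opprK; field.
  by rewrite -(IntD J1 J2) -(IntZ _ (L1D J1 J2)); apply: eq_Int => x; field.
have I1 := gauss_tempered_L1M tr t0 b; have I2 := gauss_tempered_L1M tH t0 b.
transitivity (Int (fun x => re r x * gshift t b x) -
    Int (fun x => H (fun x => (re l x + re l (- x)) / 2) x * gshift t b x)).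
  by rewrite -(IntB I1 I2); apply: eq_Int => x; rewrite mulrBl.
by apply/eqP; rewrite subr_eq0; apply/eqP; exact: etrans E1 E2.
Qed.

End SpectralData.

(** * The travelling wave system *)

Section Ode.
Variable R : realType.
Local Notation meas := (measurable_fun [set: R]).
Implicit Types (f g h phi A B : R -> R) (u v : R -> R[i]) (c x : R).

Definition L2 f := meas f /\ L1 (fun x => f x ^+ 2).

Lemma L2_mul f g : L2 f -> L2 g -> L1 (fun x => f x * g x).
Proof.
move=> [mf Lf] [mg Lg]; apply: (L1_dom _ _ (L1D Lf Lg)); first exact: measurable_funM.
move=> x; rewrite normrM -(real_normK (num_real (f x))) -(real_normK (num_real (g x))).
have := sqr_ge0 (`|f x| - `|g x|); rewrite sqrrB.
have := mulr_ge0 (normr_ge0 (f x)) (normr_ge0 (g x)).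
by move: (`|f x| ^+ 2) (`|g x| ^+ 2) (`|f x| * `|g x|) => p q r; rewrite mulr2n; lra.
Qed.

Lemma L2D f g : L2 f -> L2 g -> L2 (fun x => f x + g x).
Proof.
move=> Lf Lg; have L := L2_mul Lf Lg; split.
  exact: measurable_funD Lf.1 Lg.1.
by apply: eq_L1 (L1D (L1D Lf.2 Lg.2) (L1Z 2 L)) => x; ring.
Qed.

Lemma L2Z k f : L2 f -> L2 (fun x => k * f x).
Proof.
move=> [mf Lf]; split; first by solve_meas.
by apply: eq_L1 (L1Z (k ^+ 2) Lf) => x; ring.
Qed.

Lemma L2M_bounded f g C : (forall x, `|f x| <= C) -> meas f -> L2 g ->
  L2 (fun x => f x * g x).
Proof.
move=> hC mf [mg Lg]; split; first exact: measurable_funM.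
apply: (L1_dom _ _ (L1Z (C ^+ 2) Lg)).
  by apply: measurable_funX; exact: measurable_funM.
move=> x; rewrite ger0_norm ?sqr_ge0// exprMn ler_wpM2r ?sqr_ge0//.
by rewrite -(real_normK (num_real (f x))) lerXn2r ?nnegrE// (le_trans _ (hC x)).
Qed.

Lemma L2_loc f : L2 f -> L1loc f.
Proof. by move=> [mf Lf]; exact: L1loc_sq. Qed.

Lemma eq_L2 f g : f =1 g -> L2 f -> L2 g.
Proof. by move=> /funext ->. Qed.

Lemma aeq_L2 f g : meas g -> aeq f g -> L2 f -> L2 g.
Proof.
move=> mg E [mf Lf]; split=> //; apply: aeq_L1 Lf; try exact: measurable_funX.
by apply: ae_imp E => x ->.
Qed.

Lemma test_real phi : smoothR phi -> cpt_supp phi -> test_function (fun x => (phi x)%:C).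
Proof.
move=> sphi [B hB]; split=> [k x|]; last by exists B => x /hB ->.
split; first exact: sphi.
by rewrite (_ : im _ = fun=> 0)// derive1n0fun; exact: derivable_cst.
Qed.

Lemma cderiv_real k phi x : cderiv k (fun x => (phi x)%:C) x = (derive1n k phi x)%:C.
Proof.
rewrite /cderiv (_ : re _ = phi)// (_ : im _ = fun=> 0)//.
by rewrite derive1n0fun.
Qed.

Lemma weak_derivative_prim u v : weak_derivative u v ->
  L1loc (re u) -> L1loc (im u) -> L1loc (re v) -> L1loc (im v) ->
  (exists2 A, prim A (re v) & aeq (re u) A) /\
  (exists2 B, prim B (im v) & aeq (im u) B).
Proof.
move=> huv l1 l2 l3 l4.
have X phi : smoothR phi -> cpt_supp phi ->
    Int (fun x => re u x * derive1 phi x) = - Int (fun x => re v x * phi x) /\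
    Int (fun x => im u x * derive1 phi x) = - Int (fun x => im v x * phi x).
  move=> sphi cphi; have := huv _ (test_real sphi cphi).
  rewrite (_ : (fun x => u x * cderiv 1 _ x) = fun x => u x * (derive1 phi x)%:C).
    by rewrite !cint_mul_real => -[-> ->].
  by apply/funext => x; rewrite cderiv_real.
split; apply: weak_prim => // phi sphi cphi; first exact: (X _ sphi cphi).1.
exact: (X _ sphi cphi).2.
Qed.

Lemma solution_real u (h : R -> R[i]) c phi :
  L1loc (re u) -> L1loc (im u) ->
  L1loc (fun x => re u x * re h x) -> L1loc (fun x => im u x * re h x) ->
  meas (im h) -> aeq (im h) (fun=> 0) ->
  (forall phi : R -> R[i], test_function phi ->
      - (0 +i* c) * cint (fun x => u x * cderiv 1 phi x)
      + cint (fun x => u x * cderiv 2 phi x)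
      + cint (fun x => u x * h x * phi x) = 0) ->
  smoothR phi -> cpt_supp phi ->
  c * Int (fun x => im u x * derive1 phi x) +
    Int (fun x => re u x * derive1 (derive1 phi) x) +
    Int (fun x => re u x * re h x * phi x) = 0 /\
  - c * Int (fun x => re u x * derive1 phi x) +
    Int (fun x => im u x * derive1 (derive1 phi) x) +
    Int (fun x => im u x * re h x * phi x) = 0.
Proof.
move=> l1 l2 l3 l4 mh h0 eqn sphi cphi; have := eqn _ (test_real sphi cphi).
rewrite (_ : (fun x => u x * cderiv 1 _ x) = fun x => u x * (derive1 phi x)%:C); last first.
  by apply/funext => x; rewrite cderiv_real.
rewrite (_ : (fun x => u x * cderiv 2 _ x) = fun x => u x * (derive1 (derive1 phi) x)%:C); last first.
  by apply/funext => x; rewrite cderiv_real.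
have mphi : meas phi by apply: cont_meas; exact: deriv_continuous (smoothR_deriv sphi).1.
have E1 : Int (fun x => re (fun x => u x * h x) x * phi x) = Int (fun x => re u x * re h x * phi x).
  apply: aeq_Int.
  - rewrite (_ : re _ = fun x => re u x * re h x - im u x * im h x); last first.
      by apply/funext => x; rewrite /re /im; case: (u x) (h x) => a b [].
    by apply: measurable_funM => //; apply: measurable_funB; [exact: l3.1|apply: measurable_funM l2.1 mh].
  - by apply: measurable_funM => //; exact: l3.1.
  - by apply: ae_imp h0 => x; rewrite /re /im; case: (u x) (h x) => a b [p q] /= ->; ring.
have E2 : Int (fun x => im (fun x => u x * h x) x * phi x) = Int (fun x => im u x * re h x * phi x).
  apply: aeq_Int.
  - rewrite (_ : im _ = fun x => re u x * im h x + im u x * re h x); last first.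
      by apply/funext => x; rewrite /re /im; case: (u x) (h x) => a b [].
    by apply: measurable_funM => //; apply: measurable_funD; [apply: measurable_funM l1.1 mh|exact: l4.1].
  - by apply: measurable_funM => //; exact: l4.1.
  - by apply: ae_imp h0 => x; rewrite /re /im; case: (u x) (h x) => a b [p q] /= ->; ring.
rewrite !cint_mul_real E1 E2 => -[].
rewrite !(mul0r, oppr0, sub0r, subr0, add0r, addr0) mulNr opprK => X1 X2.
by split; [exact: X1|exact: X2].
Qed.

Definition bounded f := exists C, forall x, `|f x| <= C.

Lemma bounded_ge0 f : bounded f -> exists2 C, 0 <= C & forall x, `|f x| <= C.
Proof.
by move=> [C hC]; exists C => //; exact: le_trans (normr_ge0 _) (hC 0).
Qed.

Lemma norm_le_sq (z : R) : `|z| <= 1 + z ^+ 2.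
Proof.
have := sqr_ge0 (`|z| - 1); rewrite sqrrB1 real_normK ?num_real//.
have := normr_ge0 z; rewrite mulr2n; move: (z ^+ 2) (`|z|) => p q; lra.
Qed.

(** [|A| <= 1 + A^2 <= 3 + e^2] and [|V| <= 1 + V^2]: both exceed a constant by an integrable
    function only, so [prim_mean_bounded] turns energy bounds into a uniform one. *)
Lemma L2_primary A V : prim A V -> L2 V -> (exists2 e, L2 e & forall x, A x ^+ 2 <= 1 - e x) ->
  bounded A.
Proof.
move=> pA [mV LV] [e [me Le] he].
apply: (prim_mean_bounded pA Le LV).
  exists 3 => x; apply: le_trans (norm_le_sq _) _.
  have := he x; have := norm_le_sq (e x); have := ler_norm (- e x); rewrite normrN.
  by move: (A x ^+ 2) (e x ^+ 2) (`|e x|) (e x) => p q r z; lra.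
by exists 1; apply: aeW => x; exact: norm_le_sq.
Qed.

Lemma velocity_bounded V W A h c : prim V (fun x => c * W x - A x * h x) -> L2 V -> L2 W ->
  bounded A -> L2 h -> bounded V.
Proof.
move=> pV [mV LV] [mW LW] /bounded_ge0[C C0 hC] [mh Lh].
apply: (prim_mean_bounded pV LV (L1D (L1Z `|c| LW) (L1Z C Lh))).
  by exists 1 => x; exact: norm_le_sq.
exists (`|c| + C); apply: aeW => x; apply: le_trans (ler_normB _ _) _.
rewrite !normrM.
have h1 := ler_wpM2l (normr_ge0 c) (norm_le_sq (W x)).
have h2 := ler_pM (normr_ge0 _) (normr_ge0 _) (hC x) (norm_le_sq (h x)).
apply: le_trans (lerD h1 h2) _; rewrite !mulrDr !mulr1.
by rewrite addrACA.
Qed.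

(** [weak_prim], used for [u] and then for its weak derivative, turns the real and imaginary parts
    of the distributional equation into a first-order system for absolutely continuous functions. *)
Lemma ode_data u (h : R -> R[i]) c : energy_space u -> L2 (re h) ->
  meas (im h) -> aeq (im h) (fun=> 0) ->
  (forall phi : R -> R[i], test_function phi ->
      - (0 +i* c) * cint (fun x => u x * cderiv 1 phi x)
      + cint (fun x => u x * cderiv 2 phi x)
      + cint (fun x => u x * h x * phi x) = 0) ->
  exists A B V1 V2, [/\ aeq (re u) A /\ aeq (im u) B, prim A V1 /\ prim B V2,
    prim V1 (fun x => c * V2 x - A x * re h x) /\
    prim V2 (fun x => - c * V1 x - B x * re h x),
    [/\ L2 V1, L2 V2 & L2 (fun x => 1 - A x ^+ 2 - B x ^+ 2)] &
    [/\ bounded A, bounded B, bounded V1 & bounded V2]].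
Proof.
move=> [[[[mu1 mu2] _] _] /in_L2[me _ Le _] [v [_ wv /in_L2[mv1 mv2 Lv1 Lv2]]]] Lh mh2 h0 eqn.
have [mh _] := Lh.
have {}me : meas (eta_of u) := me; have {}Le : L1 (fun x => eta_of u x ^+ 2) := Le.
have etaE x : eta_of u x = 1 - re u x ^+ 2 - im u x ^+ 2.
  by rewrite /eta_of cabs_sq opprD addrA.
have L3 : L1loc (fun x => 3 + eta_of u x ^+ 2).
  by apply: L1locD; [exact: L1loc_cst|exact: L1_L1loc].
have bu x : `|re u x| <= 3 + eta_of u x ^+ 2 /\ `|im u x| <= 3 + eta_of u x ^+ 2.
  have := norm_le_sq (re u x); have := norm_le_sq (im u x).
  have := norm_le_sq (eta_of u x); have := ler_norm (- eta_of u x); rewrite normrN.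
  have := sqr_ge0 (re u x); have := sqr_ge0 (im u x); have := etaE x.
  move: (re u x ^+ 2) (im u x ^+ 2) (`|re u x|) (`|im u x|) => p q r1 r2.
  move: (`|eta_of u x|) (eta_of u x ^+ 2) (eta_of u x) => n s e h1 h2 h3 h4 h5 h6 h7.
  by clear -h1 h2 h3 h4 h5 h6 h7; split; lra.
have lu1 : L1loc (re u) by exact: (L1loc_dom mu1 (fun x => (bu x).1) L3).
have lu2 : L1loc (im u) by exact: (L1loc_dom mu2 (fun x => (bu x).2) L3).
have LV1 : L2 (re v) by []. have LV2 : L2 (im v) by [].
have [[A pA eA] [B pB eB]] := weak_derivative_prim wv lu1 lu2 (L2_loc LV1) (L2_loc LV2).
have mA : meas A := cont_meas (prim_continuous pA).
have mB : meas B := cont_meas (prim_continuous pB).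
have Leta : L2 (fun x => 1 - A x ^+ 2 - B x ^+ 2).
  apply: (aeq_L2 _ _ (conj me Le)); first by solve_meas.
  by apply: ae_imp2 eA eB => x <- <-; exact: etaE.
have bA : bounded A.
  apply: (L2_primary pA LV1); exists (fun x => 1 - A x ^+ 2 - B x ^+ 2) => // x.
  by have := sqr_ge0 (B x); move: (A x ^+ 2) (B x ^+ 2) => p q; lra.
have bB : bounded B.
  apply: (L2_primary pB LV2); exists (fun x => 1 - A x ^+ 2 - B x ^+ 2) => // x.
  by have := sqr_ge0 (A x); move: (A x ^+ 2) (B x ^+ 2) => p q; lra.
have [CA hCA] := bA; have [CB hCB] := bB.
have LAh := L2M_bounded hCA mA Lh; have LBh := L2M_bounded hCB mB Lh.
have mu1h : meas (fun x => re u x * re h x) by exact: measurable_funM.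
have mu2h : meas (fun x => im u x * re h x) by exact: measurable_funM.
have eAh : aeq (fun x => A x * re h x) (fun x => re u x * re h x).
  by apply: ae_imp eA => x ->.
have eBh : aeq (fun x => B x * re h x) (fun x => im u x * re h x).
  by apply: ae_imp eB => x ->.
have l3 := L2_loc (aeq_L2 mu1h eAh LAh); have l4 := L2_loc (aeq_L2 mu2h eBh LBh).
have X phi (sp : smoothR phi) (cp : cpt_supp phi) :=
  solution_real lu1 lu2 l3 l4 mh2 h0 eqn sp cp.
have W phi : smoothR phi -> cpt_supp phi ->
    Int (fun x => re u x * derive1 phi x) = - Int (fun x => re v x * phi x) /\
    Int (fun x => im u x * derive1 phi x) = - Int (fun x => im v x * phi x).
  move=> sphi cphi; have := wv _ (test_real sphi cphi).
  rewrite (_ : (fun x => u x * cderiv 1 _ x) = fun x => u x * (derive1 phi x)%:C).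
    by rewrite !cint_mul_real => -[-> ->].
  by apply/funext => x; rewrite cderiv_real.
have lg1 : L1loc (fun x => c * im v x - re u x * re h x).
  by apply: L1locB => //; apply: L1locZ; exact: L2_loc.
have lg2 : L1loc (fun x => - c * re v x - im u x * re h x).
  by apply: L1locB => //; apply: L1locZ; exact: L2_loc.
have cph phi (sp : smoothR phi) : continuous phi := deriv_continuous (smoothR_deriv sp).1.
have [V1 pV1 eV1] : exists2 V1, prim V1 (fun x => c * im v x - re u x * re h x) &
    aeq (re v) V1.
  apply: (weak_prim (L2_loc LV1) lg1) => phi sp cp.
  have [x1 _] := X _ sp cp; have [_ w2] := W _ sp cp.
  have sp' := (smoothR_deriv sp).2; have cp' := cpt_supp_deriv sp cp.
  have [w1 _] := W _ sp' cp'.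
  have i1 := L1_cpt (L1locZ c (L2_loc LV2)) (cph _ sp) cp; have i2 := L1_cpt l3 (cph _ sp) cp.
  have i3 := L1_cpt (L2_loc LV2) (cph _ sp) cp.
  have -> : Int (fun x => (c * im v x - re u x * re h x) * phi x) =
      c * Int (fun x => im v x * phi x) - Int (fun x => re u x * re h x * phi x).
    rewrite -(IntZ c i3) -(IntB (L1Z c i3) i2); apply: eq_Int => x; ring.
  move: x1; rewrite w1 w2; move: (Int _) (Int _) (Int _) => p q r.
  by clear; rewrite mulrN; move: (c * p) => z; lra.
have [V2 pV2 eV2] : exists2 V2, prim V2 (fun x => - c * re v x - im u x * re h x) &
    aeq (im v) V2.
  apply: (weak_prim (L2_loc LV2) lg2) => phi sp cp.
  have [_ x1] := X _ sp cp; have [w2 _] := W _ sp cp.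
  have sp' := (smoothR_deriv sp).2; have cp' := cpt_supp_deriv sp cp.
  have [_ w1] := W _ sp' cp'.
  have i2 := L1_cpt l4 (cph _ sp) cp.
  have i3 := L1_cpt (L2_loc LV1) (cph _ sp) cp.
  have -> : Int (fun x => (- c * re v x - im u x * re h x) * phi x) =
      - c * Int (fun x => re v x * phi x) - Int (fun x => im u x * re h x * phi x).
    rewrite -(IntZ (- c) i3) -(IntB (L1Z (- c) i3) i2); apply: eq_Int => x; ring.
  move: x1; rewrite w1 w2; move: (Int _) (Int _) (Int _) => p q r.
  by clear; rewrite !mulNr mulrN; move: (c * p) => z; lra.
have mV1 : meas V1 := cont_meas (prim_continuous pV1).
have mV2 : meas V2 := cont_meas (prim_continuous pV2).
have pV1' : prim V1 (fun x => c * V2 x - A x * re h x).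
  apply: prim_aeq pV1; first by solve_meas.
  by apply: ae_imp2 eV2 eA => x -> ->.
have pV2' : prim V2 (fun x => - c * V1 x - B x * re h x).
  apply: prim_aeq pV2; first by solve_meas.
  by apply: ae_imp2 eV1 eB => x -> ->.
have LV1' := aeq_L2 mV1 eV1 LV1; have LV2' := aeq_L2 mV2 eV2 LV2.
exists A, B, V1, V2; split=> //.
- by split; [exact: prim_aeq pA|exact: prim_aeq pB].
- by split=> //; [exact: velocity_bounded pV1' LV1' LV2' bA Lh
                 |exact: velocity_bounded pV2' LV2' LV1' bB Lh].
Qed.

End Ode.

(** * Conserved quantities of the travelling wave system *)

Section Travelling.
Variable R : realType.
Local Notation mu := (@lebesgue_measure R).
Local Notation meas := (measurable_fun [set: R]).
Implicit Types (f : R -> R) (x b : R).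

Lemma L1_inv1sq : L1 (fun x : R => (1 + x ^+ 2)^-1).
Proof.
pose k (x : R) := (0 <= x)%R%:R * (1 + x ^+ 2)^-1.
have k0 x : 0 <= k x by rewrite mulr_ge0// invr_ge0 addr_ge0// sqr_ge0.
have m1 : meas (fun x : R => (1 + x ^+ 2)^-1).
  exact: cont_meas (@continuous_oneDsqrV R).
have mk : meas k.
  apply: measurable_funM => //.
  rewrite (_ : (fun x => _) = (\1_(`[0, +oo[%classic) : R -> R)); first exact: measurable_indic.
  apply/funext => x; rewrite indicE; congr (nat_of_bool _)%:R.
  by rewrite mem_setE in_itv/= andbT.
have Lk : L1 k.
  apply/integrableP; split; first exact/measurable_EFinP.
  have -> : (\int[mu]_x `|(EFin \o k) x| = \int[mu]_(x in `[0%R, +oo[) (oneDsqr x)^-1%:E)%E.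
    rewrite [RHS]integral_mkcond; apply: eq_integral => x _ /=.
    rewrite (ger0_norm (k0 x)) patchE mem_setE in_itv/= andbT /k.
    by case: ifP => _; rewrite ?mul1r ?mul0r.
  by rewrite integral0y_oneDsqr ltry.
have [Lk' _] := Int_opp Lk.
apply: (L1_dom _ _ (L1D Lk Lk')) => // x.
rewrite ger0_norm; last by rewrite invr_ge0 addr_ge0// sqr_ge0.
have [x0|x0] := leP 0 x.
  by apply: le_trans (_ : k x <= _); rewrite ?lerDl ?k0// /k x0 mul1r.
apply: le_trans (_ : k (- x) <= _); rewrite ?lerDr ?k0//.
by rewrite /k oppr_ge0 (ltW x0) mul1r sqrrN.
Qed.

Lemma expR_decay (d : R) : 0 < d -> L1 (fun x => expR (- (d * `|x|))).
Proof.
move=> d0; have [C C0 hC] := @pow_expR R 2.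
have D0 : 0 <= C * (1 + d^-1) ^+ 2 by rewrite mulr_ge0 ?sqr_ge0.
apply: (L1_dom _ _ (L1Z (C * (1 + d^-1) ^+ 2) L1_inv1sq)).
  apply: cont_meas => x; apply: continuous_comp; last exact: continuous_expR.
  apply: continuousN; apply: continuousM; first exact: cvg_cst.
  exact: norm_continuous.
move=> x; rewrite ger0_norm ?expR_ge0// expRN.
have e0 := expR_gt0 (d * `|x|).
have s0 : 0 < 1 + x ^+ 2 by rewrite ltr_wpDr// sqr_ge0.
rewrite -(ler_pM2r e0) mulVf ?gt_eqF// -(ler_pM2r s0) mul1r.
have -> : C * (1 + d^-1) ^+ 2 / (1 + x ^+ 2) * expR (d * `|x|) * (1 + x ^+ 2) =
  (1 + d^-1) ^+ 2 * (C * expR (d * `|x|)) by field; rewrite !gt_eqF.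
have dx : 0 <= d * `|x| by rewrite mulr_ge0 ?(ltW d0).
apply: le_trans (ler_wpM2l (sqr_ge0 _) (hC _ dx)).
rewrite -exprMn.
apply: le_trans (_ : (1 + `|x|) ^+ 2 <= _).
  rewrite -[x ^+ 2]real_normK ?num_real//.
  have -> : (1 + `|x|) ^+ 2 = 1 + `|x| ^+ 2 + 2 * `|x| by ring.
  by rewrite lerDl mulr_ge0.
rewrite lerXn2r ?nnegrE ?addr_ge0// ?mulr_ge0 ?addr_ge0 ?invr_ge0 ?(ltW d0)//.
have -> : (1 + d^-1) * (1 + d * `|x|) = 1 + `|x| + (d * `|x| + d^-1).
  by field; rewrite gt_eqF.
by rewrite lerDl addr_ge0// invr_ge0 ltW.
Qed.

Lemma prim0_const_L2 f : prim f (fun=> 0) -> L2 f -> f =1 (fun=> 0).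
Proof.
move=> pf [mf Lf] x.
have cst y : f y = f 0.
  have E a b : a <= b -> f b = f a.
    move=> ab; have := pf.2 a b ab.
    rewrite (_ : Int _ = 0); first by move/subr0_eq.
    by rewrite -[RHS]Int0; apply: eq_Int => z; rewrite mulr0.
  by have [/E ->|/ltW/E ->] := leP 0 y.
have Lc : L1 (fun=> f 0 ^+ 2) by apply: eq_L1 Lf => y; rewrite cst.
have V := prim_vanishes (prim_cst (f 0 ^+ 2)) Lc (L1_0 R).
rewrite cst; apply/eqP; rewrite -sqrf_eq0 eq_le sqr_ge0 andbT.
rewrite leNgt; apply/negP => h.
have [X hX] := V _ (divr_gt0 h (ltr0Sn _ 1)).
have := hX `|X|; rewrite normr_id => /(_ (ler_norm _)).
by rewrite ger0_norm ?sqr_ge0//; move: (f 0 ^+ 2) h => z h; clear -h; lra.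
Qed.

Variables (A B V1 V2 h : R -> R) (c : R).
Definition defect x := 1 - A x ^+ 2 - B x ^+ 2.
Local Notation eta := defect.

Definition travelling := [/\ prim A V1 /\ prim B V2,
  prim V1 (fun x => c * V2 x - A x * h x) /\ prim V2 (fun x => - c * V1 x - B x * h x),
  [/\ L2 V1, L2 V2, L2 h & L2 eta] & [/\ bounded A, bounded B, bounded V1 & bounded V2]].

Hypothesis sys : travelling.

(** These are [eta'], then [|u'|^2] as [kin], and the right-hand side [G] of the equation for [eta]
    as [src]. *)
Definition deta x := - 2 * (A x * V1 x + B x * V2 x).
Definition kin x := V1 x ^+ 2 + V2 x ^+ 2.
Definition src x := 2 * kin x + 2 * (eta x * h x).

Lemma prim_eta : prim eta deta.
Proof.
have [[pA pB] _ _ _] := sys.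
have := primB (primB (prim_cst 1) (primM pA pA)) (primM pB pB).
by apply: eq_prim => x; rewrite /defect /deta; ring.
Qed.

(** The terms in [c] cancel. No derivative of [u'] remains on the right, and this is the source of
    the power gained in the bootstrap. *)
Lemma prim_kin : prim kin (fun x => deta x * h x).
Proof.
have [_ [p1 p2] _ _] := sys.
have := primD (primM p1 p1) (primM p2 p2).
by apply: eq_prim => x; rewrite /kin /deta; ring.
Qed.

Lemma bounded_meas : [/\ meas A, meas B, meas V1 & meas V2].
Proof.
have [[pA pB] [p1 p2] _ _] := sys.
by split; apply: cont_meas; apply: prim_continuous; eassumption.
Qed.

(* Both sides have the same derivative, so they differ by a constant, which is
   in L2 and hence zero. *)
Lemma angular_momentum x : A x * V2 x - B x * V1 x = c / 2 * eta x.
Proof.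
have [[pA pB] [p1 p2] [L1' L2' Lh Le] [[CA bA] [CB bB] _ _]] := sys.
have [mA mB m1 m2] := bounded_meas.
apply/eqP; rewrite -subr_eq0; apply/eqP.
apply: (@prim0_const_L2 (fun x => A x * V2 x - B x * V1 x - c / 2 * eta x)).
  have := primB (primB (primM pA p2) (primM pB p1)) (primZ (c / 2) prim_eta).
  by apply: eq_prim => y //; rewrite /deta; field.
have := L2D (L2D (L2M_bounded bA mA L2') (L2Z (-1) (L2M_bounded bB mB L1'))) (L2Z (- (c / 2)) Le).
by apply: eq_L2 => y; ring.
Qed.

Lemma prim_deta : prim deta (fun x => - c ^+ 2 * eta x + 2 * h x - src x).
Proof.
have [[pA pB] [p1 p2] _ _] := sys.
have := primZ (- 2) (primD (primM pA p1) (primM pB p2)).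
apply: eq_prim => x; first by rewrite /deta.
have J := angular_momentum x.
have -> : - c ^+ 2 * eta x = - 2 * c * (A x * V2 x - B x * V1 x) by rewrite J; field.
by rewrite /src /kin /defect; ring.
Qed.

Lemma L2_deta : L2 deta.
Proof.
have [_ _ [L1' L2' Lh Le] [[CA bA] [CB bB] _ _]] := sys.
have [mA mB m1 m2] := bounded_meas.
have := L2Z (-2) (L2D (L2M_bounded bA mA L1') (L2M_bounded bB mB L2')).
exact: eq_L2.
Qed.

Lemma L1_kin : L1 kin.
Proof. by have [_ _ [[_ L1'] [_ L2'] _ _] _] := sys; exact: L1D. Qed.

Lemma L1_eta_h : L1 (fun x => eta x * h x).
Proof. by have [_ _ [_ _ Lh Le] _] := sys; exact: L2_mul. Qed.

Lemma L1_deta_h : L1 (fun x => deta x * h x).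
Proof. by have [_ _ [_ _ Lh Le] _] := sys; exact: L2_mul L2_deta Lh. Qed.

Lemma L1_src : L1 src.
Proof. exact: L1D (L1Z 2 L1_kin) (L1Z 2 L1_eta_h). Qed.

Lemma bounded_eta : bounded eta.
Proof.
have [_ _ _ [[CA bA] [CB bB] _ _]] := sys.
exists (1 + CA ^+ 2 + CB ^+ 2) => x; apply: le_trans (ler_normB _ _) _.
rewrite !normrX; apply: lerD; last first.
  by rewrite lerXn2r ?nnegrE// (le_trans _ (bB x)).
apply: le_trans (ler_normB _ _) _; rewrite normr1 normrX lerD2l.
by rewrite lerXn2r ?nnegrE// (le_trans _ (bA x)).
Qed.

(** [prim_vanishes] is applied to [eta^2], because [eta] itself is only known to be square
    integrable. *)
Lemma eta_vanishes : vanishes eta.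
Proof.
have [_ _ [_ _ _ [me Le]] _] := sys; have Ld := L2_deta.
have p2 := primM prim_eta prim_eta.
have L : L1 (fun x => eta x * eta x) by apply: eq_L1 Le => x; rewrite expr2.
have L' : L1 (fun x => deta x * eta x + eta x * deta x).
  by apply: L1D; apply: L2_mul.
move=> e e0; have [X hX] := prim_vanishes p2 L L' (exprn_gt0 2 e0).
exists X => x /hX; rewrite -expr2 normrX => h2.
by rewrite -(@ler_pXn2r _ 2) ?nnegrE ?(ltW e0).
Qed.

(** Lagrange's identity [|u|^2 |u'|^2 = (A V1 + B V2)^2 + (A V2 - B V1)^2], with the last term
    evaluated by [angular_momentum]. *)
Lemma kin_identity x : (1 - eta x) * kin x = (deta x ^+ 2 + c ^+ 2 * eta x ^+ 2) / 4.
Proof.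
have J := angular_momentum x.
have -> : c ^+ 2 * eta x ^+ 2 = 4 * (A x * V2 x - B x * V1 x) ^+ 2 by rewrite J; field.
by rewrite /deta /kin /defect; field.
Qed.

End Travelling.

(** * Spectral identity and regularity *)

Section Spectral.
Variable R : realType.
Local Notation mu := (@lebesgue_measure R).
Local Notation meas := (measurable_fun [set: R]).
Implicit Types (P Q V : R -> R) (x xi t b : R).

Lemma gpacket_gs_bound (P Q : {poly R}) a t : 0 < t -> exists C : R,
  forall x, `|gpacket P Q a t 0 x| <= C * gs (t / 2) x.
Proof.
move=> t0; have t20 : 0 < t / 2 by lra.
have [C C0 hC] := gpacket_bound P Q a 0 t20; exists C => x.
have -> : gpacket P Q a t 0 x = gpacket P Q a (t / 2) 0 x * gs (t / 2) x.
  by rewrite /gpacket [in LHS](splitr t) gsD; ring.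
by rewrite normrM (ger0_norm (gs_ge0 _ _)) ler_wpM2r ?gs_ge0.
Qed.

Lemma gpacket_cont (P Q : {poly R}) a t b : continuous (gpacket P Q a t b).
Proof. exact: deriv_continuous (gpacket_deriv P Q a t b). Qed.

Lemma gtempered_gpacket V (P Q : {poly R}) a t : gauss_tempered V -> 0 < t ->
  L1 (fun x => V x * gpacket P Q a t 0 x).
Proof.
move=> tV t0; have [C hC] := gpacket_gs_bound P Q a t0.
have t20 : 0 < t / 2 by lra.
exact: (gauss_dom tV (cont_meas (@gpacket_cont P Q a t 0)) t20 hC).
Qed.

Lemma L1_poly_gshift (P : {poly R}) t b : 0 < t -> L1 (fun x => P.[x] * gshift t b x).
Proof.
move=> t0.
have t1 : gauss_tempered (fun=> 1 : R).
  apply: (gauss_tempered_bounded (C := 1)); first exact: measurable_cst.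
  by apply: aeW => x; rewrite normr1.
have := gauss_tempered_L1M (gauss_tempered_poly P t1) t0 b.
by apply: eq_L1 => x; rewrite mulr1.
Qed.

(** The second derivative of [eta] will be moved onto the transformed test, where it becomes the
    multiplier [- x^2] on the test itself. Writing the transform as a packet makes every product
    involved integrable. *)
Lemma H_gshift_packet t b : 0 < t -> exists g0 g1 g2 : R -> R,
  [/\ g0 =1 H (gshift t b), has_deriv g0 g1, has_deriv g1 g2 /\ continuous g2,
      g2 =1 (fun xi => - H (fun x => x ^+ 2 * gshift t b x) xi) &
      gtest (fun x => x ^+ 2 * gshift t b x) /\ forall V, gauss_tempered V ->
        [/\ L1 (fun x => V x * g0 x), L1 (fun x => V x * g1 x) & L1 (fun x => V x * g2 x)]].
Proof.
move=> t0; set s := (4 * t)^-1; have s0 : 0 < s by rewrite invr_gt0 mulr_gt0.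
pose p := (cg t)%:P : {poly R}.
have step (P Q : {poly R}) : exists P' Q' : {poly R},
    has_deriv (gpacket P Q b s 0) (gpacket P' Q' b s 0).
  by do 2 eexists; exact: gpacket_deriv.
have [p1 [q1 d0]] := step p p; have [p2 [q2 d1]] := step p1 q1.
have E0 : gpacket p p b s 0 =1 H (gshift t b).
  move=> x; rewrite H_gshift// /gpacket /gwave /cas /p hornerC mul0r expR0 (mulrC b).
  by rewrite -/s; ring.
have Lg := L1_gshift b t0.
have Lx : L1 (fun x => x * gshift t b x).
  by apply: eq_L1 (L1_poly_gshift 'X b t0) => x; rewrite hornerX.
have Lx2 : L1 (fun x => x ^+ 2 * gshift t b x).
  by apply: eq_L1 (L1_poly_gshift 'X^2 b t0) => x; rewrite hornerXn.
have E1 : gpacket p1 q1 b s 0 = H (fun x => - (x * gshift t b (- x))).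
  rewrite -(deriv_derive1 d0) (funext E0).
  exact: deriv_derive1 (H_deriv Lg Lx).
have L1' : L1 (fun x => - (x * gshift t b (- x))).
  by apply: eq_L1 (Int_opp Lx).1 => x; rewrite mulNr.
have L2' : L1 (fun x => x * - (x * gshift t b (- x))).
  by apply: eq_L1 (L1N (Int_opp Lx2).1) => x; ring.
have E2 : gpacket p2 q2 b s 0 =1 (fun xi => - H (fun x => x ^+ 2 * gshift t b x) xi).
  move=> xi; rewrite -(deriv_derive1 d1) E1 (deriv_derive1 (H_deriv L1' L2')).
  rewrite -mulN1r -HZ//; apply: eq_Int => x; rewrite opprK; congr (_ * _); ring.
exists (gpacket p p b s 0), (gpacket p1 q1 b s 0), (gpacket p2 q2 b s 0).
split=> //; first by split=> //; exact: gpacket_cont.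
split; last by move=> V tV; split; exact: gtempered_gpacket.
split=> //; first exact: schwartz_sqgshift.
have [C hC] := gpacket_gs_bound p2 q2 b s0.
exists C, (s / 2); split; first by rewrite divr_gt0.
by move=> xi; rewrite -normrN -E2.
Qed.

Variables (A B V1 V2 h w Phi : R -> R) (c Bw : R).
Local Notation eta := (defect A B).
Local Notation deta := (deta A B V1 V2).
Local Notation kin := (kin V1 V2).
Local Notation src := (src A B V1 V2 h).
(** The last clause says weakly that [Phi] and [w * Phi] are the Hartley transforms of [eta] and
    [h]. *)
Definition spectral :=
  [/\ travelling A B V1 V2 h c, meas w, {ae mu, forall x, `|w x| <= Bw}, gauss_tempered Phi &
     forall P, gtest P -> Int (fun x => Phi x * P x) = Int (fun x => eta x * H P x) /\
       Int (fun x => w x * Phi x * P x) = Int (fun x => h x * H P x)].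
Hypothesis S : spectral.

Lemma spectral_identity :
  aeq (fun xi => (xi ^+ 2 + 2 * w xi - c ^+ 2) * Phi xi) (H src).
Proof.
have [sys mw bw tP X] := S.
have [_ _ [L2V1 L2V2 L2h L2e] _] := sys.
have te : gauss_tempered eta := gauss_tempered_sq L2e.1 L2e.2.
have th : gauss_tempered h := gauss_tempered_sq L2h.1 L2h.2.
have L2d := L2_deta sys.
have td : gauss_tempered deta := gauss_tempered_sq L2d.1 L2d.2.
have Ls := L1_src sys; have ts := gauss_tempered_L1 Ls.
have twP := gauss_temperedM tP mw bw.
have tM : gauss_tempered (fun xi => (xi ^+ 2 + 2 * w xi - c ^+ 2) * Phi xi).
  have := gauss_temperedB (gauss_temperedD (gauss_tempered_poly 'X^2 tP)
    (gauss_temperedZ 2 twP)) (gauss_temperedZ (c ^+ 2) tP).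
  by congr gauss_tempered; apply/funext => x; rewrite hornerXn; ring.
have tH := gauss_tempered_H Ls.
apply: ae_imp (gauss_unique (gauss_temperedB tM tH) _) => [x /subr0_eq //|t b t0].
have [g0 [g1 [g2 [E0 d0 [d1 c2] E2 [gt2 LV]]]]] := H_gshift_packet b t0.
have gt0 := gtest_gshift b t0.
have Lg := L1_gshift b t0.
have [e0 e1 e2] := LV _ te; have [h0 _ _] := LV _ th; have [dt0 dt1 _] := LV _ td.
have [s0 _ _] := LV _ ts.
have p0 := deriv_prim (deriv_continuous d1) d0.
have p1 := deriv_prim c2 d1.
(* Green's formula: the derivative of [eta g1 - eta' g0] is [eta g2 - eta'' g0], and there is no
   boundary term. *)
have pp := primB (primM (prim_eta sys) p1) (primM (prim_deta sys) p0).
have Lpp : L1 (fun x => eta x * g1 x - deta x * g0 x) := L1B e1 dt0.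
have L1s := L1B (L1D (L1Z (- c ^+ 2) e0) (L1Z 2 h0)) s0.
have Lpp' : L1 (fun x => eta x * g2 x -
    (- c ^+ 2 * (eta x * g0 x) + 2 * (h x * g0 x) - src x * g0 x)) := L1B e2 L1s.
have Z : Int (fun x => eta x * g2 x -
    (- c ^+ 2 * (eta x * g0 x) + 2 * (h x * g0 x) - src x * g0 x)) = 0.
  apply: prim_Int0 Lpp Lpp'; apply: eq_prim pp => x //; ring.
have Z' := etrans (esym Z) (IntB e2 L1s).
have {}Z' := etrans Z' (congr1 (fun z => _ - z) (IntB (L1D (L1Z (- c ^+ 2) e0) (L1Z 2 h0)) s0)).
have {}Z' := etrans Z' (congr1 (fun z => _ - (z - _)) (IntD (L1Z (- c ^+ 2) e0) (L1Z 2 h0))).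
have {}Z' := etrans Z' (congr2 (fun y z => _ - (y + z - _)) (IntZ (- c ^+ 2) e0) (IntZ 2 h0)).
have [X1 X2] := X _ gt0; have [X3 _] := X _ gt2.
have E0' (V : R -> R) : Int (fun x => V x * H (gshift t b) x) = Int (fun x => V x * g0 x).
  by apply: eq_Int => x; rewrite E0.
have E2' : Int (fun x => eta x * H (fun x => x ^+ 2 * gshift t b x) x) =
    - Int (fun x => eta x * g2 x).
  by rewrite -(IntN e2); apply: eq_Int => x; rewrite E2 mulrN opprK.
have i1 := gauss_tempered_L1M tP t0 b; have i2 := gauss_tempered_L1M twP t0 b.
have i3 : L1 (fun x => Phi x * (x ^+ 2 * gshift t b x)).
  have := gauss_tempered_L1M (gauss_tempered_poly 'X^2 tP) t0 b.
  by apply: eq_L1 => x; rewrite hornerXn; ring.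
have i4 := gauss_tempered_L1M tH t0 b.
have J := IntB (L1B (L1D i3 (L1Z 2 i2)) (L1Z (c ^+ 2) i1)) i4.
have {}J := etrans J (congr1 (fun z => z - _) (IntB (L1D i3 (L1Z 2 i2)) (L1Z (c ^+ 2) i1))).
have {}J := etrans J (congr1 (fun z => z - _ - _) (IntD i3 (L1Z 2 i2))).
have {}J := etrans J (congr2 (fun y z => _ + y - z - _) (IntZ 2 i2) (IntZ (c ^+ 2) i1)).
have J4 : Int (fun x => H src x * gshift t b x) = Int (fun x => src x * g0 x).
  rewrite -E0' -(H_swap Lg Ls); apply: eq_Int => x; exact: mulrC.
apply: etrans (etrans _ J) _; first by apply: eq_Int => x; ring.
move: (etrans X1 (E0' _)) (etrans X2 (E0' _)) (etrans X3 E2') J4 Z'.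
move: (Int _) (Int _) (Int _) (Int _) (Int _) (Int _) (Int _) (Int _).
clear; move=> a1 a2 a3 a4 a5 a6 a7 a8 -> -> -> ->; rewrite mulNr.
by move: (c ^+ 2 * _) => z; lra.
Qed.

End Spectral.

(** * Gaining decay of the transform of [eta] *)

Section Bootstrap.
Variable R : realType.
Local Notation mu := (@lebesgue_measure R).
Local Notation meas := (measurable_fun [set: R]).
Implicit Types (f V D : R -> R) (x xi X : R).

(** Only the tail needs an estimate: on [|x| < X] the weight is at most [wt k X] and
    [expR (X ^+ 2) * gs 1 x >= 1], so integrability there comes from [gauss_tempered]. *)
Lemma Lw_tail k V D X : gauss_tempered V ->
  {ae mu, forall x, X <= `|x| -> `|V x| <= D x} -> (forall x, 0 <= D x) ->
  Lw k D -> Lw k V.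
Proof.
move=> [mV LV] hD D0 [mD LD]; split=> //.
have L := L1D LD (L1Z (wt k X * expR (X ^+ 2)) (L1_norm (LV 1 ltr01))).
apply: L1_domae L; first by apply: measurable_funM => //; exact: meas_wt.
apply: ae_imp hD => x hx; rewrite normrM (ger0_norm (wt_ge0 _ _)).
have [Xx|xX] := leP X `|x|.
  apply: le_trans (ler_wpM2l (wt_ge0 k x) (hx Xx)) _.
  by rewrite lerDl mulr_ge0// mulr_ge0 ?wt_ge0 ?expR_ge0.
rewrite -[leLHS]add0r lerD ?mulr_ge0 ?wt_ge0// normrM (ger0_norm (gs_ge0 _ _)).
have xX' : `|x| <= `|X| := le_trans (ltW xX) (ler_norm _).
have -> : wt k X * expR (X ^+ 2) * (`|V x| * gs 1 x) =
  (wt k X * `|V x|) * (expR (X ^+ 2) * gs 1 x) by ring.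
apply: le_trans (_ : wt k X * `|V x| <= _).
  by apply: ler_wpM2r => //; rewrite lerXn2r ?nnegrE ?addr_ge0// lerD2l.
rewrite ler_peMr ?mulr_ge0 ?wt_ge0//.
rewrite /gs -expRD -[leLHS]expR0 ler_expR mul1r subr_ge0.
by rewrite -(real_normK (num_real x)) -(real_normK (num_real X)) lerXn2r ?nnegrE.
Qed.

Section Decay.
Variables (A B V1 V2 h w Phi : R -> R) (c Bw : R).
Local Notation eta := (defect A B).
Local Notation deta := (deta A B V1 V2).
Local Notation kin := (kin V1 V2).
Local Notation src := (src A B V1 V2 h).
Hypothesis S : spectral A B V1 V2 h w Phi c Bw.
Hypothesis M0 : {ae mu, forall xi : R, 0 < xi ^+ 2 + 2 * w xi - c ^+ 2}.

(** Beyond this [X] the lower-order part [2 w - c^2] is at most half of [xi^2] in absolute value,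
    hence [M_c >= xi^2 / 2]. *)
Lemma Phi_bound : exists2 X, 1 <= X &
  {ae mu, forall xi, X <= `|xi| -> `|Phi xi| <= 2 * `|H src xi| / xi ^+ 2}.
Proof.
have [_ _ bw _ _] := S.
exists (1 + 2 * (2 * `|Bw| + c ^+ 2)).
  by rewrite lerDl mulr_ge0// addr_ge0 ?sqr_ge0// mulr_ge0.
apply: ae_imp3 (spectral_identity S) bw M0 => xi E hB Mpos Xxi.
have X1 : 1 <= `|xi|.
  by apply: le_trans Xxi; rewrite lerDl mulr_ge0// addr_ge0 ?sqr_ge0// mulr_ge0.
have sq : `|xi| <= xi ^+ 2.
  by rewrite -(real_normK (num_real xi)) expr2 ler_peMr.
have x2 : 0 < xi ^+ 2 by apply: lt_le_trans sq; exact: lt_le_trans X1.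
have Mx : xi ^+ 2 / 2 <= xi ^+ 2 + 2 * w xi - c ^+ 2.
  have h1 := ler_norm (- w xi); have h2 := ler_norm Bw; rewrite normrN in h1.
  move: Xxi sq hB h1 h2; move: (xi ^+ 2) (c ^+ 2) (`|xi|) (`|w xi|) (w xi) (`|Bw|) => p q r s y z.
  by lra.
have M2 : xi ^+ 2 <= 2 * (xi ^+ 2 + 2 * w xi - c ^+ 2) by move: Mx; lra.
rewrite -E normrM (gtr0_norm Mpos) ler_pdivlMr// (mulrA 2) (mulrC _ `|Phi xi|).
exact: ler_wpM2l.
Qed.

(** Start of the bootstrap: [H src] is bounded, so [Phi] is [O(xi^-2)] at infinity. Near the origin,
    where [M_c] may come close to 0, only local integrability of [Phi] is used. *)
Lemma Phi_L1 : L1 Phi.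
Proof.
have [sys _ _ tP _] := S; have Ls := L1_src sys.
have [X X1 hX] := Phi_bound.
set C := 2 * Int (fun x => `|src x|).
have C0 : 0 <= C by rewrite mulr_ge0// Int_ge0.
have p0 (x : R) : 0 < 1 + x ^+ 2 by rewrite ltr_wpDr// sqr_ge0.
apply/Lw0; apply: (@Lw_tail 0 Phi (fun x => 4 * C * (1 + x ^+ 2)^-1) X) => //.
- apply: ae_imp hX => x hx Xx; apply: le_trans (hx Xx) _.
  have x1 : 1 <= `|x| := le_trans X1 Xx.
  have x2 : 1 <= x ^+ 2 by rewrite -(real_normK (num_real x)) exprn_ege1.
  have x20 : 0 < x ^+ 2 := lt_le_trans ltr01 x2.
  have HC : `|H src x| <= C by exact: H_bound.
  rewrite ler_pdivrMr// mulrAC ler_pdivlMr//.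
  apply: le_trans (_ : 2 * C * (1 + x ^+ 2) <= _).
    by rewrite ler_wpM2r ?(ltW (p0 x))// ler_wpM2l.
  have -> : 4 * C * x ^+ 2 = 2 * C * (x ^+ 2 + x ^+ 2) by ring.
  by apply: ler_wpM2l; [rewrite mulr_ge0|rewrite lerD2r].
- move=> x; apply: mulr_ge0; first exact: mulr_ge0 (ler0n _ 4) C0.
  by rewrite invr_ge0 (ltW (p0 x)).
- by apply/Lw0; exact: L1Z (L1_inv1sq R).
Qed.

Lemma wPhi_Lw k : Lw k Phi -> Lw k (fun x => w x * Phi x).
Proof.
move=> LP; have [_ mw bw [mP _] _] := S.
apply: Lw_dom (LwZ Bw LP); first exact: measurable_funM.
apply: ae_imp bw => x hx; rewrite !normrM ler_wpM2r//.
exact: le_trans (ler_norm _).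
Qed.

(** The formula for [eta] holds everywhere by continuity; for [h], given only as a class, almost
    everywhere. *)
Lemma inversion : eta =1 (fun x => (2 * pi)^-1 * H Phi x) /\
  aeq h (fun x => (2 * pi)^-1 * H (fun xi => w xi * Phi xi) x).
Proof.
have [sys mw bw tP X] := S.
have [_ _ [_ _ L2h L2e] _] := sys.
have te : gauss_tempered eta := gauss_tempered_sq L2e.1 L2e.2.
have th : gauss_tempered h := gauss_tempered_sq L2h.1 L2h.2.
have LwP : L1 (fun x => w x * Phi x) by apply/Lw0; apply: wPhi_Lw; apply/Lw0; exact: Phi_L1.
split; last first.
  by apply: hartley_inversion th LwP _ => s a s0; exact: (X _ (gtest_gwave a s0)).2.
apply: ae_eq_continuous.
- exact: prim_continuous (prim_eta sys).
- rewrite (_ : (fun x => _) = H (fun x => (2 * pi)^-1 * Phi x)).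
    exact: H_continuous (L1Z (2 * pi)^-1 Phi_L1).
  by apply/funext => x; rewrite HZ//; exact: Phi_L1.
- by apply: hartley_inversion te Phi_L1 _ => s a s0; exact: (X _ (gtest_gwave a s0)).1.
Qed.

(* [W * eta] is only defined up to a null set; this replaces it by its continuous
   representative. *)
Lemma regular_potential :
  spectral A B V1 V2 (fun x => (2 * pi)^-1 * H (fun xi => w xi * Phi xi) x) w Phi c Bw.
Proof.
have [sys mw bw tP X] := S.
have [pAB [p1 p2] [L1' L2' Lh Le] bd] := sys.
have [mA mB m1 m2] := bounded_meas sys.
have [_ eh] := inversion; set h' := (fun x => _ * _) in eh *.
have LwP : L1 (fun x => w x * Phi x) by apply/Lw0; apply: wPhi_Lw; apply/Lw0; exact: Phi_L1.
have mh : meas h' by apply: measurable_funM => //; exact: H_meas.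
have Lh' := aeq_L2 mh eh Lh.
split=> //.
  split=> //; split; [apply: prim_aeq p1|apply: prim_aeq p2]; try by solve_meas.
    by apply: ae_imp eh => x ->.
  by apply: ae_imp eh => x ->.
move=> P gP; have [-> ->] := X _ gP; split=> //.
have th : gauss_tempered h := gauss_tempered_sq Lh.1 Lh.2.
have th' : gauss_tempered h' := gauss_tempered_sq Lh'.1 Lh'.2.
apply: aeq_Int; [exact: L1_meas (gtest_H th gP)|exact: L1_meas (gtest_H th' gP)|].
by apply: ae_imp eh => x ->.
Qed.

End Decay.

Section Regular.
Variables (A B V1 V2 h w Phi : R -> R) (c Bw : R).
Local Notation eta := (defect A B).
Local Notation deta := (deta A B V1 V2).
Local Notation kin := (kin V1 V2).
Local Notation src := (src A B V1 V2 h).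
Hypothesis S : spectral A B V1 V2 h w Phi c Bw.
Hypothesis M0 : {ae mu, forall xi : R, 0 < xi ^+ 2 + 2 * w xi - c ^+ 2}.
Hypothesis hE : h =1 (fun x => (2 * pi)^-1 * H (fun xi => w xi * Phi xi) x).

Lemma wiener_of_Lw k : Lw k Phi -> wiener k eta /\ wiener k h.
Proof.
move=> LP; split.
  exists (fun x => (2 * pi)^-1 * Phi x); first exact: LwZ.
  by move=> x; rewrite (inversion S M0).1 HZ//; exact: Lw_L1 LP.
have LwP := wPhi_Lw S LP.
exists (fun x => (2 * pi)^-1 * (w x * Phi x)); first exact: LwZ.
by move=> x; rewrite hE HZ//; exact: Lw_L1 LwP.
Qed.

Lemma Lw_of_wiener k f : wiener k f -> L1 f -> Lw k (H f).
Proof.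
move=> [P LP E] Lf; have := H_of_H Lf (Lw_L1 LP) E => e.
apply: Lw_dom (LwZ (2 * pi) LP); first exact: H_meas.
by apply: ae_imp e => x ->.
Qed.

(** [H kin xi] is [H (eta' h) (- xi) / xi] by [prim_kin], hence the weight of order 3. The constants
    [32 = 4 * 2 ^+ 3] and [16 = 4 * 2 ^+ 2] come from [1 + |xi| <= 2 |xi|]. *)
Lemma Phi_dom : exists2 X, 1 <= X &
  {ae mu, forall xi, X <= `|xi| -> `|Phi xi| <=
    32 * (wt 3 xi)^-1 * `|H (fun x => deta x * h x) (- xi)| +
    16 * (wt 2 xi)^-1 * `|H (fun x => eta x * h x) xi|}.
Proof.
have [sys _ _ _ _] := S; have [X X1 hX] := Phi_bound S M0.
exists X => //; apply: ae_imp hX => xi hx Xxi; apply: le_trans (hx Xxi) _.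
have x1 : 1 <= `|xi| := le_trans X1 Xxi.
have x0 : 0 < `|xi| := lt_le_trans ltr01 x1.
have Lk := L1_kin sys; have Le := L1_eta_h sys; have Ld := L1_deta_h sys.
have Hk := H_prim (- xi) (prim_kin sys) Lk Ld; rewrite !opprK in Hk.
have -> : H src xi = 2 * H kin xi + 2 * H (fun x => eta x * h x) xi.
  rewrite -(HZ 2 Lk) -(HZ 2 Le) -HD//; exact: L1Z.
rewrite Hk normrM -(real_normK (num_real xi)).
move: (H _ xi) (H _ xi) => b a.
set y := `|xi| in x1 x0 *.
have w3 : 0 < wt 3 xi := lt_le_trans ltr01 (wt_ge1 _ _).
have w2 : 0 < wt 2 xi := lt_le_trans ltr01 (wt_ge1 _ _).
have i2 : (y ^+ 2)^-1 <= 4 / wt 2 xi.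
  rewrite -[leLHS]mul1r ler_pdivrMr ?exprn_gt0// mulrAC ler_pdivlMr// mul1r.
  have -> : 4 * y ^+ 2 = (2 * y) ^+ 2 by ring.
  by rewrite lerXn2r ?nnegrE ?addr_ge0 ?mulr_ge0 ?(ltW x0)// -/y; lra.
have i3 : (y ^+ 2)^-1 <= 8 / wt 3 xi * y.
  rewrite -[leLHS]mul1r ler_pdivrMr ?exprn_gt0//.
  have -> : 8 / wt 3 xi * y * y ^+ 2 = (2 * y) ^+ 3 / wt 3 xi by field; rewrite gt_eqF.
  rewrite ler_pdivlMr// mul1r.
  by rewrite lerXn2r ?nnegrE ?addr_ge0 ?mulr_ge0 ?(ltW x0)// -/y; lra.
have h1 : 2 * `|2 * a + 2 * b| <= 4 * `|a| + 4 * `|b|.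
  apply: le_trans (ler_wpM2l _ (ler_normD _ _)) _ => //.
  by rewrite !normrM !(ger0_norm (ler0n _ 2)); move: (`|a|) (`|b|) => p q; lra.
apply: le_trans (ler_wpM2r _ h1) _; first by rewrite invr_ge0 exprn_ge0// ltW.
have := ler_wpM2l (mulr_ge0 (ler0n R 4) (normr_ge0 a)) i3.
have := ler_wpM2l (mulr_ge0 (ler0n R 4) (normr_ge0 b)) i2.
move=> hb ha; rewrite [leLHS]mulrDl; apply: le_trans (lerD ha hb) _.
rewrite le_eqVlt; apply/orP; left; apply/eqP.
move: (wt 3 xi)^-1 (wt 2 xi)^-1 (`|a|) (`|b|) => p q r s; ring.
Qed.

(* [H src] gains one power of xi: its kinetic part has derivative [eta' h], and the
   transform of a product of [wiener k] functions is again in [Lw k]. *)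
Lemma Lw_step k : Lw k Phi -> Lw k.+1 Phi.
Proof.
move=> LP; have [sys _ _ tP _] := S.
have [X X1 hX] := Phi_dom.
have [we wh] := wiener_of_Lw LP.
have Le := L1_eta_h sys; have Ld := L1_deta_h sys.
have q2 := Lw_of_wiener (wienerM we wh) Le.
have mo : meas (fun x : R => H (fun x => deta x * h x) (- x)).
  exact: (measurableT_comp (H_meas Ld) (@meas_opp R)).
have mD : meas (fun xi => 32 * (wt 3 xi)^-1 * `|H (fun x => deta x * h x) (- xi)| +
    16 * (wt 2 xi)^-1 * `|H (fun x => eta x * h x) xi|).
  have mi n : meas (fun xi => (wt n xi)^-1).
    apply: cont_meas => x; apply: cvgV; first by rewrite gt_eqF// (lt_le_trans ltr01 (wt_ge1 _ _)).
    apply: (@continuous_comp _ _ _ (fun x : R => 1 + `|x|) (fun y : R => y ^+ n)).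
      by apply: cvgD; [exact: cvg_cst|exact: norm_continuous].
    exact: exprn_continuous.
  have m2 := q2.1; solve_meas; exact: mi.
apply: (Lw_tail tP hX) => [x|].
  by rewrite addr_ge0// mulr_ge0// mulr_ge0// invr_ge0 wt_ge0.
split=> //.
(* For [k = 0] it is not yet known that [eta'] is a Wiener function; the boundedness of [H (eta' h)]
   suffices because [wt 1 / wt 3] is integrable. Otherwise [eta'] lies one weight below [eta]. *)
case: k LP we wh q2 => [|k] LP we wh q2.
- set C := 2 * Int (fun x => `|deta x * h x|).
  have hC x : `|H (fun x => deta x * h x) x| <= C by exact: H_bound.
  have C0 : 0 <= C by rewrite mulr_ge0// Int_ge0.
  apply: L1_dom (L1D (L1Z (32 * C) (L1_inv1sq R)) (L1Z 16 (L1_norm (Lw_L1 q2)))).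
    by apply: measurable_funM => //; exact: meas_wt.
  move=> x; rewrite ger0_norm; last first.
    by rewrite mulr_ge0 ?wt_ge0// addr_ge0// mulr_ge0// mulr_ge0// invr_ge0 wt_ge0.
  have h1 := hC (- x); move: h1 (normr_ge0 (H (fun x => deta x * h x) (- x))).
  move: (`|H _ (- x)|) => p pC p0; have := normr_ge0 (H (fun x => eta x * h x) x).
  move: (`|H _ x|) => q q0; have y0 := normr_ge0 x.
  rewrite mulrDr lerD//.
    have -> : wt 1 x * (32 * (wt 3 x)^-1 * p) = 32 * p * (wt 2 x)^-1.
      by rewrite !wtS /wt expr0 mulr1; field; rewrite gt_eqF// ltr_wpDr.
    apply: ler_pM; rewrite ?mulr_ge0// ?invr_ge0 ?wt_ge0 ?ler_wpM2l//.
    rewrite lef_pV2 ?posrE ?(lt_le_trans ltr01 (wt_ge1 _ _)) ?ltr_wpDr ?sqr_ge0//.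
    rewrite /wt -(real_normK (num_real x)).
    have -> : (1 + `|x|) ^+ 2 = 1 + `|x| ^+ 2 + 2 * `|x| by ring.
    by rewrite lerDl mulr_ge0.
  have -> : wt 1 x * (16 * (wt 2 x)^-1 * q) = 16 * q * (wt 1 x)^-1.
    by rewrite !wtS /wt expr0 mulr1; field; rewrite gt_eqF// ltr_wpDr.
  by rewrite ler_piMr ?mulr_ge0// invf_le1 ?(lt_le_trans ltr01 (wt_ge1 _ _))// wt_ge1.
have [g wg dg] := wiener_deriv we.
have [mA mB m1 m2] := bounded_meas sys.
have cd : continuous deta := prim_continuous (prim_deta sys).
have dd : has_deriv eta deta by move=> x; exact: (prim_derive (prim_eta sys) (cd x)).
have eg : g = deta by rewrite -(deriv_derive1 dg) (deriv_derive1 dd).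
rewrite eg in wg.
have q1 := Lw_opp (Lw_of_wiener (wienerM wg (wiener_le (leqnSn k) wh)) Ld).
have q2' := Lw_le (leqnSn k) q2.
apply: L1_dom (L1D (L1Z 32 (Lw_norm q1)) (L1Z 16 (Lw_norm q2'))).
  by apply: measurable_funM => //; exact: meas_wt.
move=> x; rewrite ger0_norm; last first.
  by rewrite mulr_ge0 ?wt_ge0// addr_ge0// mulr_ge0// mulr_ge0// invr_ge0 wt_ge0.
move: (normr_ge0 (H (fun x => deta x * h x) (- x))).
move: (`|H _ (- x)|) => p p0; have := normr_ge0 (H (fun x => eta x * h x) x).
move: (`|H _ x|) => q q0; have y0 := normr_ge0 x.
have y1 : 1 + `|x| != 0 by rewrite gt_eqF// ltr_wpDr.
rewrite mulrDr lerD//.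
  have -> : wt k.+2 x * (32 * (wt 3 x)^-1 * p) = 32 * (wt k x * p) * (1 + `|x|)^-1.
    by rewrite !wtS /wt expr0 mulr1; field.
  by rewrite ler_piMr ?mulr_ge0 ?wt_ge0// invf_le1 ?lerDl// ltr_wpDr.
have -> : wt k.+2 x * (16 * (wt 2 x)^-1 * q) = 16 * (wt k x * q).
  by rewrite !wtS /wt expr0 mulr1; field.
by [].
Qed.

Lemma wiener_all k : wiener k eta /\ wiener k h.
Proof.
apply: wiener_of_Lw; elim: k => [|k IH]; last exact: Lw_step.
by apply/Lw0; exact: Phi_L1 S M0.
Qed.

End Regular.
End Bootstrap.

(** * Exponential decay *)

Section Landau.
Variable R : realType.
Implicit Types (f g : R -> R) (a b x y s e : R).

Lemma deriv_mvt f g a b : has_deriv f g ->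
  exists2 z, Num.min a b <= z <= Num.max a b & f b - f a = g z * (b - a).
Proof.
move=> d.
have key u v : u < v -> exists2 z, u <= z <= v & f v - f u = g z * (v - u).
  move=> uv; have [||z] := @MVT R f g u v uv.
  - by move=> x _; exact: d.
  - by apply: continuous_subspaceT; exact: deriv_continuous d.
  - by rewrite in_itv/= => /andP[uz zv] E; exists z => //; rewrite !ltW.
have [ab|ba|->] := ltgtP a b.
- exact: key.
- have [z zI E] := key _ _ ba; exists z => //.
  by rewrite -opprB E -mulrN opprB.
- by exists b; rewrite ?lexx// !subrr mulr0.
Qed.

(** A step of length [e] away from the origin, so that bounds valid for [|y| >= |x|] cover the whole
    segment. *)
Definition outward e x := if 0 <= x then e else - e.

Lemma outward_norm e x : 0 <= e -> `|x + outward e x| = `|x| + e /\ `|outward e x| = e.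
Proof.
move=> e0; rewrite /outward; have [x0|x0] := leP 0 x.
  by rewrite !ger0_norm// addr_ge0.
rewrite normrN (ger0_norm e0) !ler0_norm ?(ltW x0)//; first by rewrite opprB addrC.
by rewrite subr_le0 (le_trans (ltW x0)).
Qed.

Lemma outward_between e x y : 0 <= e ->
  Num.min x (x + outward e x) <= y <= Num.max x (x + outward e x) ->
  `|x| <= `|y| /\ `|y - x| <= e.
Proof.
move=> e0; rewrite /outward; have [x0|x0] := leP 0 x.
  rewrite min_l ?max_r ?lerDl// => /andP[h1 h2].
  rewrite (ger0_norm x0) ger0_norm ?(le_trans x0)// ger0_norm ?subr_ge0//.
  by split=> //; rewrite lerBlDl.
rewrite min_r ?max_l ?gerBl// => /andP[h1 h2].
rewrite (ltr0_norm x0) ler0_norm ?(le_trans h2 (ltW x0))// ler0_norm ?subr_le0//.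
by split; [rewrite lerN2|rewrite opprB lerBlDl -lerBlDr].
Qed.

(** A Taylor step through the mean value theorem, used twice. The length [e] stays free: it is small
    in [vanishes_deriv], balanced in [src_small] and exponentially small in [decays_interpolate]. *)
Lemma landau f f1 f2 (C e x : R) : has_deriv f f1 -> has_deriv f1 f2 -> 0 <= e -> 0 <= C ->
  (forall y, `|x| <= `|y| -> `|f2 y| <= C) ->
  e * `|f1 x| <= `|f (x + outward e x)| + `|f x| + e ^+ 2 * C.
Proof.
move=> d1 d2 e0 C0 hC; set s := outward e x.
have [_ ns] := outward_norm x e0.
have [z zI E] := deriv_mvt x (x + s) d1.
have [xz zx] := outward_between e0 zI.
have [y yI F] := deriv_mvt x z d2.
have xy : `|x| <= `|y|.
  have : Num.min x (x + s) <= y <= Num.max x (x + s).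
    case/andP: zI => z1 z2; case/andP: yI => y1 y2; apply/andP; split.
      by apply: le_trans y1; rewrite le_min ge_min lexx.
    by apply: le_trans y2 _; rewrite ge_max le_max lexx.
  by case/(outward_between e0).
have E' : f1 x * s = f (x + s) - f x - f2 y * (z - x) * s.
  rewrite E -F; ring.
rewrite -ns mulrC -normrM E'.
apply: le_trans (ler_normB _ _) _; apply: lerD; first exact: ler_normB.
rewrite !normrM ns (_ : e ^+ 2 * C = C * e * e); last by ring.
by apply: ler_wpM2r => //; apply: ler_pM => //; exact: hC.
Qed.

Lemma vanishes2 f g e : vanishes f -> vanishes g -> 0 < e -> exists X, forall x, X <= `|x| ->
  `|f x| <= e /\ `|g x| <= e.
Proof.
move=> vf vg e0; have [X hX] := vf e e0; have [Y hY] := vg e e0.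
exists (Num.max X Y) => x; rewrite ge_max => /andP[/hX ? /hY ?].
by split.
Qed.

Lemma vanishes_deriv f f1 f2 : has_deriv f f1 -> has_deriv f1 f2 -> bounded f2 ->
  vanishes f -> vanishes f1.
Proof.
move=> d1 d2 /bounded_ge0[C C0 hC] vf e e0.
(* Chosen so that [d^2 C <= e d / 2], which leaves [e d / 4] for each of the two values of [f]. *)
pose d := e / (2 * (C + 1)).
have d0 : 0 < d by rewrite divr_gt0// mulr_gt0// ltr_wpDl.
have [X hX] := vf (e * d / 4) (divr_gt0 (mulr_gt0 e0 d0) (ltr0Sn _ 3)).
exists X => x Xx; rewrite -(ler_pM2l d0).
apply: le_trans (landau d1 d2 (ltW d0) C0 (fun y _ => hC y)) _.
have [n1 _] := outward_norm x (ltW d0).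
have h1 : `|f (x + outward d x)| <= e * d / 4.
  by apply: hX; rewrite n1; apply: le_trans Xx _; rewrite lerDl ltW.
have h2 := hX _ Xx.
have h3 : d ^+ 2 * C <= e * d / 2.
  have -> : e * d / 2 = d ^+ 2 * (C + 1).
    by rewrite /d; field; rewrite gt_eqF// ltr_wpDl.
  by rewrite ler_wpM2l ?sqr_ge0// lerDl.
apply: le_trans (lerD (lerD h1 h2) h3) _.
by rewrite le_eqVlt; apply/orP; left; apply/eqP; field.
Qed.

End Landau.

(** * The equation near infinity *)

Section SourceDecay.
Variable R : realType.
Variables (A B V1 V2 h : R -> R) (c : R).
Local Notation eta := (defect A B).
Local Notation deta := (deta A B V1 V2).
Local Notation kin := (kin V1 V2).
Local Notation src := (src A B V1 V2 h).
Hypothesis sys : travelling A B V1 V2 h c.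
Hypothesis ch : continuous h.
Let deta2 (x : R) := - c ^+ 2 * eta x + 2 * h x - src x.

Lemma deriv_eta : has_deriv eta deta.
Proof. by move=> x; exact: (prim_derive (prim_eta sys) (prim_continuous (prim_deta sys) (x:=x))). Qed.

Lemma deriv_deta : has_deriv deta deta2.
Proof.
move=> x; apply: (prim_derive (prim_deta sys)).
have ce := prim_continuous (prim_eta sys); have ck := prim_continuous (prim_kin sys).
have cM (k : R) (f : R -> R) : continuous f -> continuous (fun x => k * f x).
  by move=> cf y; apply: continuousM; [exact: cvg_cst|exact: cf].
have ceh : continuous (fun x => eta x * h x).
  by move=> y; apply: continuousM; [exact: ce|exact: ch].
apply: continuousB; last first.
  by apply: continuousD; [exact: cM|exact: (cM _ _ ceh)].
by apply: continuousD; exact: cM.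
Qed.

Hypothesis bdeta2 : bounded deta2.
Hypothesis vdeta2 : vanishes deta2.

Lemma deta_vanishes : vanishes deta.
Proof. exact: vanishes_deriv deriv_eta deriv_deta bdeta2 (eta_vanishes sys). Qed.

Lemma kin_le x : `|eta x| <= 2^-1 -> 0 <= kin x /\
  kin x <= (deta x ^+ 2 + c ^+ 2 * eta x ^+ 2) / 2.
Proof.
move=> e2; have k0 : 0 <= kin x by rewrite addr_ge0 ?sqr_ge0.
split=> //.
have h1 : 2^-1 <= 1 - eta x by have := ler_norm (eta x); lra.
have := ler_wpM2r k0 h1; rewrite (kin_identity sys x).
by move: (kin x) (_ + _) => p q; lra.
Qed.

(** [h] depends on [eta] in a nonlocal way, but the equation expresses it locally:
    [2 h (1 - eta) = 2 kin + eta'' + c^2 eta], and far out [1 - eta >= 1 / 2]. *)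
Lemma potential_vanishes : vanishes h.
Proof.
move=> e e0.
pose k := e / (4 * (3 + 2 * c ^+ 2)).
have c2 : 0 <= c ^+ 2 := sqr_ge0 c.
have p0 : 0 < 3 + 2 * c ^+ 2 by lra.
have k0 : 0 < Num.min k 2^-1.
  by rewrite lt_min invr_gt0 ltr0n andbT divr_gt0// mulr_gt0.
have [X hX] := vanishes2 (eta_vanishes sys) deta_vanishes k0.
have [Y hY] := vdeta2 k0.
exists (Num.max X Y) => x; rewrite ge_max => /andP[/hX[]].
rewrite !le_min => /andP[h1 h1'] /andP[h2 h2'] /hY; rewrite le_min => /andP[h3 _].
have [K0 K1] := kin_le h1'.
have E : 2 * h x * (1 - eta x) = 2 * kin x + deta2 x + c ^+ 2 * eta x.
  by rewrite /deta2 /src; ring.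
have sq (z : R) : `|z| <= k -> `|z| <= 2^-1 -> z ^+ 2 <= k.
  move=> z1 z2; rewrite -(real_normK (num_real z)) expr2.
  apply: le_trans (ler_wpM2l (normr_ge0 z) (_ : _ <= 1)) _; last by rewrite mulr1.
  by move: z2; lra.
have s1 := sq _ h1 h1'; have s2 := sq _ h2 h2'.
have k00 : 0 <= k by apply: le_trans h1.
have B1 : `|2 * kin x + deta2 x + c ^+ 2 * eta x| <= (3 + 2 * c ^+ 2) * k.
  apply: le_trans (ler_normD _ _) _; rewrite (normrM (c ^+ 2)) (ger0_norm c2).
  have := ler_wpM2l c2 h1; have := ler_wpM2l c2 s1.
  have := ler_normD (2 * kin x) (deta2 x).
  rewrite (ger0_norm (_ : 0 <= 2 * kin x)); last by rewrite mulr_ge0.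
  have -> : (3 + 2 * c ^+ 2) * k = 3 * k + 2 * (c ^+ 2 * k) by ring.
  move: K1 s2 h3.
  move: (`|2 * kin x + deta2 x|) (`|deta2 x|) => a b.
  move: (c ^+ 2 * eta x ^+ 2) (deta x ^+ 2) (c ^+ 2 * `|eta x|) (c ^+ 2 * k) (kin x).
  by move=> p q r s t; lra.
have B2 : (3 + 2 * c ^+ 2) * k = e / 4.
  by rewrite /k; field; rewrite gt_eqF.
have h4 : 2^-1 <= 1 - eta x by have := ler_norm (eta x); move: h1'; lra.
have : `|2 * h x * (1 - eta x)| <= e / 4 by rewrite E -B2.
rewrite !normrM (ger0_norm (le_trans _ h4)) ?invr_ge0// (ger0_norm (ler0n _ 2)).
have := ler_wpM2l (normr_ge0 (h x)) h4.
move: (`|h x|) => y; rewrite -mulrA; move: (y * (1 - eta x)) => z; lra.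
Qed.

(* [src] is quadratic in eta: Landau's inequality gives
   [eta'^2 <= 9 a sup |eta''|], with [eta''] small near infinity. *)
Lemma src_small e : 0 < e -> exists X, forall x, X <= `|x| -> forall a, 0 < a ->
  (forall y, `|x| <= `|y| -> `|eta y| <= a) -> `|src x| <= e * a.
Proof.
move=> e0; have c2 : 0 <= c ^+ 2 := sqr_ge0 c.
(* The term [2 kin] costs [9 + c^2], where 9 comes from Landau's inequality, and [2 eta h] costs
   2. *)
pose k := e / (11 + c ^+ 2).
have p0 : 0 < 11 + c ^+ 2 by lra.
have kk0 : 0 < k by rewrite divr_gt0.
have k0 : 0 < Num.min k 2^-1 by rewrite lt_min invr_gt0 ltr0n andbT.
have [X hX] := vanishes2 (eta_vanishes sys) vdeta2 k0.
have [Y hY] := potential_vanishes kk0.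
exists (Num.max X Y) => x; rewrite ge_max => /andP[Xx Yx] a a0 ha.
have [] := hX x Xx; rewrite le_min => /andP[h1 h1'] _; have h2 := hY x Yx.
have [K0 K1] := kin_le h1'.
have ea := ha x (lexx _).
have d2 : deta x ^+ 2 <= 9 * (k * a).
  (* As [d^2 k = a], the three terms of Landau's inequality are each at most [a]. *)
  pose d := Num.sqrt (a / k).
  have ak : 0 < a / k by rewrite divr_gt0.
  have d0 : 0 < d by rewrite sqrtr_gt0.
  have dd : d ^+ 2 = a / k by rewrite sqr_sqrtr// ltW.
  have L : d * `|deta x| <= 3 * a.
    apply: le_trans (landau deriv_eta deriv_deta (ltW d0) (ltW kk0) _) _.
      by move=> y xy; have [_] := hX y (le_trans Xx xy); rewrite le_min => /andP[].
    have [n1 _] := outward_norm x (ltW d0).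
    have ea' : `|eta (x + outward d x)| <= a by apply: ha; rewrite n1 lerDl ltW.
    have -> : d ^+ 2 * k = a by rewrite dd; field; rewrite gt_eqF.
    by move: ea ea'; move: (`|_|) (`|_|) => y z; lra.
  have L2 : (d * `|deta x|) ^+ 2 <= (3 * a) ^+ 2.
    by rewrite lerXn2r ?nnegrE// mulr_ge0// ltW.
  move: L2; rewrite exprMn dd real_normK ?num_real// => L2.
  have : k / a * (a / k * deta x ^+ 2) <= k / a * (3 * a) ^+ 2.
    by rewrite ler_wpM2l// divr_ge0 ?ltW.
  have -> : k / a * (a / k * deta x ^+ 2) = deta x ^+ 2 by field; rewrite !gt_eqF.
  by have -> : k / a * (3 * a) ^+ 2 = 9 * (k * a) by field; rewrite gt_eqF.
have e2 : eta x ^+ 2 <= k * a.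
  by rewrite -(real_normK (num_real (eta x))) expr2 ler_pM.
have eh : `|eta x * h x| <= k * a by rewrite normrM mulrC ler_pM.
have K2 : 2 * kin x <= (9 + c ^+ 2) * (k * a).
  have -> : (9 + c ^+ 2) * (k * a) = 9 * (k * a) + c ^+ 2 * (k * a) by ring.
  have := ler_wpM2l c2 e2; move: K1 d2.
  move: (c ^+ 2 * (k * a)) (c ^+ 2 * eta x ^+ 2) (deta x ^+ 2) (kin x) (k * a).
  by move=> p q r s t; lra.
have -> : e * a = (9 + c ^+ 2) * (k * a) + 2 * (k * a).
  by rewrite /k; field; rewrite gt_eqF.
apply: le_trans (ler_normD _ _) _; apply: lerD.
  by rewrite ger0_norm ?mulr_ge0.
by rewrite normrM (ger0_norm (ler0n _ 2)) ler_wpM2l.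
Qed.

End SourceDecay.

(** * Absorbing the source in a weighted norm *)

Section Absorption.
Variable R : realType.
Local Notation meas := (measurable_fun [set: R]).
Implicit Types (f : R -> R) (x y l m e : R).

(** A substitute for Hölder's inequality: if [0 <= k <= 1], [z >= 0] and [q > 1], then
    [k z <= k + z^q], by separating [z <= 1] from [z > 1]. Here [k] is the surplus decay
    [expR (- ((m - l) * |x|))], integrable by itself; it alone settles [p = +oo]. *)
Lemma kernel_weight (p : \bar R) m l (F : R -> R[i]) : (1 < p)%E ->
  in_Lp p (fun x => (expR (m * `|x|))%:C * F x) -> l < m -> cmeasurable F ->
  L1 (fun x => expR (l * `|x|) * re F x) /\ L1 (fun x => expR (l * `|x|) * im F x).
Proof.
move=> p1 LF lm [m1 m2]; set E := (fun x => _ * F x) in LF.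
have d0 : 0 < m - l by rewrite subr_gt0.
have Ld := expR_decay d0.
have ER x : re E x = expR (m * `|x|) * re F x.
  by rewrite /E /re; case: (F x) => a b /=; rewrite mul0r subr0.
have EI x : im E x = expR (m * `|x|) * im F x.
  by rewrite /E /im; case: (F x) => a b /=; rewrite mul0r addr0.
have me : meas (fun x : R => expR (l * `|x|)).
  apply: cont_meas => x; apply: continuous_comp; last exact: continuous_expR.
  by apply: continuousM; [exact: cvg_cst|exact: norm_continuous].
have split_exp x : expR (l * `|x|) = expR (- ((m - l) * `|x|)) * expR (m * `|x|).
  by rewrite -expRD; congr (@expR R _); ring.
have fin (q : R) : 1 < q -> in_Lp q%:E E -> L1 (fun x => expR (- ((m - l) * `|x|)) * cabs E x).
  move=> q1 Lq; have Lc := in_Lp_fin (lt_trans ltr01 q1) Lq.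
  apply: (L1_dom _ _ (L1D Lc Ld)).
    by apply: measurable_funM; [exact: L1_meas Ld|exact: meas_cabs Lq.1].
  move=> x; rewrite ger0_norm ?mulr_ge0 ?expR_ge0 ?cabs_ge0//.
  have k0 := expR_ge0 (- ((m - l) * `|x|)).
  have k1 : expR (- ((m - l) * `|x|)) <= 1.
    by rewrite -expR0 ler_expR oppr_le0 mulr_ge0// ltW.
  have [c1|c1] := leP (cabs E x) 1.
    apply: le_trans (_ : expR (- ((m - l) * `|x|)) <= _); last by rewrite lerDr powR_ge0.
    by rewrite ler_piMr.
  apply: le_trans (_ : cabs E x <= _); first by rewrite ler_piMl// cabs_ge0.
  apply: le_trans (_ : cabs E x `^ q <= _); last by rewrite lerDl.
  by rewrite -{1}(powRr1 (cabs_ge0 E x)) ler_powR ?(ltW c1)// ltW.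
case: p p1 LF => [q| |] // p1 LF.
  have L := fin q p1 LF.
  split; apply: (L1_dom _ _ L); try exact: measurable_funM.
    move=> x; rewrite split_exp -mulrA -ER normrM (ger0_norm (expR_ge0 _)).
    by rewrite ler_wpM2l ?expR_ge0// re_le_cabs.
  move=> x; rewrite split_exp -mulrA -EI normrM (ger0_norm (expR_ge0 _)).
  by rewrite ler_wpM2l ?expR_ge0// im_le_cabs.
have [_ _ [C hC]] := in_Loo LF.
split; apply: (L1_domae _ _ (L1Z C Ld)); try exact: measurable_funM.
  apply: ae_imp hC => x [h _]; rewrite split_exp -mulrA -ER normrM (ger0_norm (expR_ge0 _)).
  by rewrite mulrC ler_wpM2r ?expR_ge0.
apply: ae_imp hC => x [_ h]; rewrite split_exp -mulrA -EI normrM (ger0_norm (expR_ge0 _)).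
by rewrite mulrC ler_wpM2r ?expR_ge0.
Qed.

(** The best [s] in [f <= s v] would satisfy [s <= s / 2 + C], so [s <= 2 C]. Iterating the
    improvement from the a priori constant [S0] avoids forming that supremum. *)
Lemma absorb_iter f (v : R -> R) (C S0 : R) : (forall x, 0 <= v x) -> 0 < S0 -> 0 <= C ->
  (forall x, f x <= S0 * v x) ->
  (forall s, 0 < s -> (forall x, f x <= s * v x) -> forall x, f x <= (s / 2 + C) * v x) ->
  forall x, f x <= 2 * C * v x.
Proof.
move=> v0 s0 C0 h0 step.
have it (k : nat) x : f x <= (S0 / 2 ^+ k + 2 * C) * v x.
  elim: k x => [|k IH] x.
    apply: le_trans (h0 x) _; rewrite ler_wpM2r// expr0 divr1 lerDl mulr_ge0//.
  have p0 : 0 < S0 / 2 ^+ k + 2 * C.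
    by rewrite ltr_wpDr ?mulr_ge0// divr_gt0// exprn_gt0.
  apply: le_trans (step _ p0 IH x) _; rewrite ler_wpM2r// exprS.
  rewrite le_eqVlt; apply/orP; left; apply/eqP; field.
  by rewrite expf_neq0.
move=> x; apply/ler_addgt0Pr => e e0.
pose k := Num.bound (S0 * v x / e).
have hk : S0 * v x / e <= 2 ^+ k.
  apply: le_trans (_ : k%:R <= _).
    apply: ltW; apply: archi_boundP.
    exact: divr_ge0 (mulr_ge0 (ltW s0) (v0 x)) (ltW e0).
  by rewrite -natrX ler_nat ltnW// ltn_expl.
apply: le_trans (it k x) _; rewrite mulrDl addrC lerD2l (mulrAC S0).
have p2 : (0 : R) < 2 ^+ k by rewrite exprn_gt0.
by rewrite ler_pdivrMr// (mulrC e) -ler_pdivrMr.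
Qed.

(* The weight [exp (- l |x|) + d] makes the a priori bound finite; the part of [src]
   near infinity is absorbed with factor 1/2, uniformly in d. *)
Lemma convolution_absorb (eta src lam : R -> R) l : 0 <= l ->
  continuous eta -> bounded eta -> continuous src -> bounded src -> L1 lam ->
  L1 (fun y => expR (l * `|y|) * lam y) -> aeq eta (conv src lam) ->
  (forall e, 0 < e -> exists X, forall x, X <= `|x| -> forall a, 0 < a ->
    (forall y, `|x| <= `|y| -> `|eta y| <= a) -> `|src x| <= e * a) ->
  exists C, forall x, `|eta x| <= C * expR (- (l * `|x|)).
Proof.
move=> l0 ceta /bounded_ge0[Ce Ce0 hCe] csrc /bounded_ge0[Cs Cs0 hCs] Llam Lw E small.
have LA : L1 (fun y => expR (l * `|y|) * `|lam y|).
  by apply: eq_L1 (L1_norm Lw) => y; rewrite normrM (ger0_norm (expR_ge0 _)).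
set Lam := Int (fun y => expR (l * `|y|) * `|lam y|).
have Lam0 : 0 <= Lam by apply: Int_ge0 => y; rewrite mulr_ge0 ?expR_ge0.
(* This makes [e * Lam <= 1 / 2], the contraction factor required by [absorb_iter]; adding 1 guards
   against [Lam = 0]. *)
pose e := (2 * (Lam + 1))^-1.
have e0 : 0 < e by rewrite invr_gt0 mulr_gt0// ltr_wpDl.
have eL : e * Lam <= 2^-1.
  by rewrite /e mulrC ler_pdivrMr ?mulr_gt0 ?ltr_wpDl// mulKf// lerDl.
have [X hX] := small e e0.
pose C1 := expR (l * `|X|) * Cs.
have C10 : 0 <= C1 by rewrite mulr_ge0 ?expR_ge0.
exists (2 * (C1 * Lam)) => x0.
have main d : 0 < d -> `|eta x0| <= 2 * (C1 * Lam) * (expR (- (l * `|x0|)) + d).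
  move=> d0; pose v x := expR (- (l * `|x|)) + d.
  have v0 x : 0 < v x by rewrite ltr_wpDl ?expR_ge0.
  have cv : continuous v.
    rewrite /v => x; apply: cvgD; last exact: cvg_cst.
    change (continuous_at x (fun x : R => expR (- (l * `|x|)))).
    apply: continuous_comp; last exact: continuous_expR.
    apply: continuousN; apply: continuousM; first exact: cvg_cst.
    exact: norm_continuous.
  apply: (@absorb_iter (fun x => `|eta x|) v (C1 * Lam) ((Ce + 1) / d)) => //.
  - by move=> x; exact: ltW.
  - by rewrite divr_gt0// ltr_wpDl.
  - exact: mulr_ge0.
  - move=> x; apply: le_trans (hCe x) _; rewrite mulrAC ler_pdivlMr//.
    apply: ler_pM; rewrite ?(ltW d0)// ?lerDl//.
    by rewrite /v lerDr expR_ge0.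
  move=> s s0 hs.
  have vmono y z : `|z| <= `|y| -> v y <= v z.
    by move=> zy; rewrite lerD2r ler_expR lerN2 ler_wpM2l.
  (* Far out, [a = s * v z] is admissible because [v] decreases in [|y|]. On the ball of radius [X],
     where [v] is at least [expR (- (l * |X|))], the constant [C1] takes over. *)
  have srcv z : `|src z| <= (e * s + C1) * v z.
    have [Xz|zX] := leP X `|z|.
      apply: le_trans (hX z Xz (s * v z) _ _) _; first by rewrite mulr_gt0.
        by move=> y zy; apply: le_trans (hs y) _; rewrite (ler_wpM2l (ltW s0))// vmono.
      by rewrite mulrA mulrDl lerDl mulr_ge0// ltW.
    apply: le_trans (hCs z) _; rewrite mulrDl; apply: le_trans (_ : C1 * v z <= _); last first.
      by rewrite lerDr mulr_ge0 ?(ltW (v0 z))// mulr_ge0 ?ltW.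
    have h1 : 1 <= expR (l * `|X|) * v z.
      apply: le_trans (_ : expR (l * `|X|) * expR (- (l * `|z|)) <= _); last first.
        by rewrite ler_wpM2l ?expR_ge0// lerDl ltW.
      rewrite -expRD -expR0 ler_expR subr_ge0 ler_wpM2l//.
      by apply: ltW; apply: lt_le_trans zX (ler_norm _).
    rewrite /C1 mulrAC -[leLHS]mul1r.
    by apply: ler_wpM2r.
  have vsub x y : v (x - y) <= expR (l * `|y|) * v x.
    rewrite mulrDr; apply: lerD; last first.
      by rewrite ler_peMl ?(ltW d0)// -expR0 ler_expR mulr_ge0.
    have tri : `|x| <= `|y| + `|x - y| by rewrite -{1}(subrKC y x) ler_normD.
    have := ler_wpM2l l0 tri; rewrite -expRD ler_expR mulrDr.
    by move: (l * `|x|) (l * `|y|) (l * `|x - y|) => p q r; lra.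
  have K0 : 0 <= e * s + C1 := addr_ge0 (mulr_ge0 (ltW e0) (ltW s0)) C10.
  have msub x : meas (fun y => src (x - y)).
    apply: cont_meas => y; apply: continuous_comp; last exact: csrc.
    by apply: continuousB; [exact: cvg_cst|exact: cvg_id].
  apply: ae_le_continuous.
  - by move=> x; apply: continuous_comp; [exact: ceta|exact: norm_continuous].
  - by move=> x; apply: (@continuousM R R (fun=> _) v x); [exact: cvg_cst|exact: cv].
  apply: ae_imp E => x ->; rewrite /conv.
  have Li : L1 (fun y => src (x - y) * lam y).
    apply: (L1_dom _ _ (L1Z Cs (L1_norm Llam))).
      by apply: measurable_funM; [exact: msub|exact: L1_meas].
    by move=> y; rewrite normrM ler_wpM2r.
  apply: le_trans (le_norm_Int Li) _.
  apply: le_trans (_ : Int (fun y => ((e * s + C1) * v x) * (expR (l * `|y|) * `|lam y|)) <= _).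
    apply: (le_Int (L1_norm Li) (L1Z _ LA)) => y; rewrite normrM mulrA ler_wpM2r//.
    apply: le_trans (srcv _) _; rewrite -mulrA ler_wpM2l// mulrC.
    exact: vsub.
  rewrite (IntZ _ LA) -/Lam mulrAC ler_wpM2r ?(ltW (v0 x))//.
  rewrite mulrDl lerD2r mulrAC mulrC ler_wpM2l ?(ltW s0)//.
(* The constant does not depend on the perturbation of the weight, which is now made arbitrarily
   small. *)
apply/ler_addgt0Pr => d d0.
have K1 : 0 < 2 * (C1 * Lam) + 1 by rewrite ltr_wpDl// mulr_ge0// mulr_ge0.
move: main K1; move: (2 * (C1 * Lam)) => K main K1.
apply: le_trans (main (d / (K + 1)) (divr_gt0 d0 K1)) _.
rewrite mulrDr lerD2l mulrA ler_pdivrMr// mulrC ler_wpM2l ?(ltW d0)//.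
by rewrite lerDl.
Qed.

End Absorption.

(** * Decay of the derivatives *)

Section DerivativeDecay.
Variable R : realType.
Implicit Types (f g : R -> R) (x y l m e r s : R).

(* All derivatives of such an f are bounded. *)
Definition tame f := forall k, wiener k f.

Lemma tame_deriv f : tame f -> has_deriv f (derive1 f) /\ tame (derive1 f).
Proof.
move=> tf; have D k : wiener k (derive1 f) /\ has_deriv f (derive1 f).
  by have [g wg dg] := wiener_deriv (tf k.+1); rewrite (deriv_derive1 dg).
by split=> [|k]; [exact: (D 0%N).2|exact: (D k).1].
Qed.

Lemma tame_bounded f : tame f -> bounded f.
Proof. by move=> tf; exact: wiener_bounded (tf 0%N). Qed.

Lemma tame_derive1n f k : tame f -> tame (derive1n k f).
Proof. by move=> tf; elim: k => // k /tame_deriv[]. Qed.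

Definition decays r f := exists C, forall x, `|f x| <= C * expR (- (r * `|x|)).

Lemma decays_ge0 r f : decays r f ->
  exists2 C, 0 <= C & forall x, `|f x| <= C * expR (- (r * `|x|)).
Proof.
move=> [C hC]; exists C => //.
have := le_trans (normr_ge0 _) (hC 0).
by rewrite normr0 mulr0 oppr0 expR0 mulr1.
Qed.

Lemma decaysW r s f : s <= r -> decays r f -> decays s f.
Proof.
move=> sr /decays_ge0[C C0 hC]; exists C => x; apply: le_trans (hC x) _.
by rewrite ler_wpM2l// ler_expR lerN2 ler_wpM2r.
Qed.

(** Landau's inequality with the step [e = expR (- ((l - r) / 2 * |x|))]: the factor [e^2] raises
    the rate [r] of [f2] to [l], and dividing by [e] leaves the mean of the two rates. *)
Lemma decays_interpolate f f1 f2 l r : has_deriv f f1 -> has_deriv f1 f2 ->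
  0 <= r -> r <= l -> decays l f -> decays r f2 -> decays ((l + r) / 2) f1.
Proof.
move=> d1 d2 r0 rl /decays_ge0[A A0 hA] /decays_ge0[B B0 hB].
exists (2 * A + B) => x.
pose e := expR (- ((l - r) / 2 * `|x|)); have e0 : 0 < e by exact: expR_gt0.
have l0 : 0 <= l := le_trans r0 rl.
have mono (s y : R) : 0 <= s -> `|x| <= `|y| -> expR (- (s * `|y|)) <= expR (- (s * `|x|)).
  by move=> s0 xy; rewrite ler_expR lerN2 ler_wpM2l.
rewrite -(ler_pM2l e0).
have C0 : 0 <= B * expR (- (r * `|x|)) by rewrite mulr_ge0 ?expR_ge0.
apply: le_trans (landau d1 d2 (ltW e0) C0 _) _.
  by move=> y xy; apply: le_trans (hB y) _; rewrite ler_wpM2l// mono.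
have [n1 _] := outward_norm x (ltW e0).
have h1 : `|f (x + outward e x)| <= A * expR (- (l * `|x|)).
  by apply: le_trans (hA _) _; rewrite ler_wpM2l// mono// n1 lerDl ltW.
have E1 : e ^+ 2 * (B * expR (- (r * `|x|))) = B * expR (- (l * `|x|)).
  by rewrite mulrCA /e expr2 -!expRD; congr (_ * @expR R _); field.
have E2 : e * ((2 * A + B) * expR (- ((l + r) / 2 * `|x|))) =
    (2 * A + B) * expR (- (l * `|x|)).
  by rewrite mulrCA /e -!expRD; congr (_ * @expR R _); field.
rewrite E1 E2 mulrDl lerD2r mulr2n; move: h1 (hA x).
by rewrite mulrDl mul1r => h1 h2; rewrite mulrDl; exact: lerD.
Qed.

(* Interpolating f' between f (rate 1) and f'' (rate [rate n ^ 2]). *)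
Fixpoint rate (n : nat) : R := if n is n'.+1 then (1 + rate n' ^+ 2) / 2 else 0.

(** In terms of [s = 1 - rate n] the recursion is [s -> s - s^2 / 2], which gives
    [s <= 2 / (n + 2)]; hence [rate n] tends to 1. *)
Lemma rate_bound n : 0 <= rate n /\ rate n <= 1 /\ (1 - rate n) * (n.+2)%:R <= 2.
Proof.
elim: n => [|n [r0 [r1 IH]]]; first by rewrite /= subr0 mul1r.
have r2 : rate n ^+ 2 <= 1 by rewrite expr_le1.
split; first by rewrite divr_ge0// addr_ge0// sqr_ge0.
split; first by rewrite /= ler_pdivrMr// mul1r; lra.
have N0 : 0 <= n%:R :> R := ler0n _ _.
have E2 : n.+2%:R = n%:R + 2 :> R by rewrite -addn2 natrD.
have E3 : n.+3%:R = n%:R + 3 :> R by rewrite -addn3 natrD.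
move: IH; rewrite /= E2 E3; move: (n%:R : R) (rate n) r0 r1 {r2 E2 E3} N0 => N r r0 r1 N0 IH.
have -> : (1 - (1 + r ^+ 2) / 2) * (N + 3) =
    2 - (2 - (1 - r) * (N + 2)) + (1 - r) * (2 - (1 - r) * (N + 2)) / 2 - (1 - r) ^+ 2 / 2.
  by field.
have := sqr_ge0 (1 - r); have s0 : 0 <= 2 - (1 - r) * (N + 2) by rewrite subr_ge0.
have : (1 - r) * (2 - (1 - r) * (N + 2)) <= 2 - (1 - r) * (N + 2).
  by rewrite ler_piMl// lerBlDr lerDl.
move: s0; move: (2 - (1 - r) * (N + 2)) => p; move: ((1 - r) ^+ 2) ((1 - r) * p) => q t.
by lra.
Qed.

Lemma decays_rate n f l : 0 <= l -> tame f -> decays l f -> decays (l * rate n) (derive1 f).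
Proof.
elim: n f l => [|n IH] f l l0 tf df.
  rewrite mulr0; have [_ /tame_bounded[C hC]] := tame_deriv tf; exists C => x.
  by rewrite mul0r oppr0 expR0 mulr1.
have [d1 t1] := tame_deriv tf; have [d2 t2] := tame_deriv t1.
have [r0 [r1 _]] := rate_bound n.
have D2 : decays (l * rate n ^+ 2) (derive1 (derive1 f)).
  (* The induction hypothesis is used twice, for [f] and then for its derivative at the reduced
     rate. *)
  by rewrite expr2 mulrA; apply: IH (IH _ _ l0 tf df) => //; rewrite mulr_ge0.
have := decays_interpolate d1 d2 (mulr_ge0 l0 (sqr_ge0 _)) _ df D2.
rewrite ler_piMr ?expr_le1// => /(_ isT).
by congr (decays _ _) => /=; field.
Qed.

(** The range of rates is open, so the loss [1 - rate n] fits into the gap between [l] and the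
    larger rate [r]. *)
Lemma decays_deriv m f : tame f -> (forall l, 0 <= l -> l < m -> decays l f) ->
  forall l, 0 <= l -> l < m -> decays l (derive1 f).
Proof.
move=> tf df l l0 lm; pose r := (l + m) / 2.
have lr : l < r by rewrite /r; lra.
have rm : r < m by rewrite /r; lra.
have r0 : 0 <= r := le_trans l0 (ltW lr).
(* With [1 - rate n <= 2 / (n + 2)], this [n] ensures [r * rate n >= l]. *)
pose n := Num.bound (2 * r / (r - l)).
have [t0 [t1 tn]] := rate_bound n.
apply: decaysW (decays_rate n r0 tf (df r r0 rm)).
have rl : 0 < r - l by rewrite subr_gt0.
have hn : 2 * r / (r - l) <= n.+2%:R.
  apply: le_trans (_ : n%:R <= _); last by rewrite ler_nat -addn2 leq_addr.
  apply: ltW; apply: archi_boundP.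
  exact: divr_ge0 (mulr_ge0 (ler0n _ 2) r0) (ltW rl).
move: hn tn; rewrite ler_pdivrMr//.
have N0 : 0 < n.+2%:R :> R by rewrite ltr0n.
move: (n.+2%:R : R) N0 (rate n) t0 t1 => N N0 t t0 t1 h1 h2.
have h3 : r * ((1 - t) * N) <= r * 2 by rewrite ler_wpM2l.
have : N * (r * (1 - t)) <= N * (r - l).
  by apply: le_trans h1; rewrite mulrCA (mulrC N) (mulrC 2).
by rewrite ler_pM2l// mulrBr mulr1; lra.
Qed.

Lemma decays_derive1n m f : tame f -> (forall l, 0 <= l -> l < m -> decays l f) ->
  forall k l, 0 <= l -> l < m -> decays l (derive1n k f).
Proof.
move=> tf df; elim=> [//|k IH] l l0 lm.
exact: decays_deriv (tame_derive1n k tf) IH l l0 lm.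
Qed.

Lemma vanishes_cvg f : vanishes f -> f x @[x --> +oo] --> 0 /\ f x @[x --> -oo] --> 0.
Proof.
move=> vf; split; apply/cvgr0Pnorm_le => e e0; have [X hX] := vf e e0; near=> x; apply: hX.
  by apply: le_trans (ler_norm x); near: x; exact: nbhs_pinfty_ge (num_real X).
rewrite -normrN; apply: le_trans (ler_norm (- x)); rewrite lerNr.
by near: x; exact: nbhs_ninfty_le (num_real (- X)).
Unshelve. all: by end_near.
Qed.

Lemma decays_vanishes l r f : l < r -> decays r f -> vanishes (fun x => expR (l * `|x|) * f x).
Proof.
move=> lr /decays_ge0[C C0 hC] e e0; have d0 : 0 < r - l by rewrite subr_gt0.
have [D D0 hD] := @pow_expR R 1.
exists (C * D / e / (r - l)) => x hx.
have dx : 0 <= (r - l) * `|x| by rewrite mulr_ge0 ?(ltW d0).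
rewrite normrM (ger0_norm (expR_ge0 _)).
apply: le_trans (ler_wpM2l (expR_ge0 _) (hC x)) _.
have -> : expR (l * `|x|) * (C * expR (- (r * `|x|))) = C * expR (- ((r - l) * `|x|)).
  by rewrite mulrCA -expRD; congr (_ * @expR R _); ring.
rewrite expRN ler_pdivrMr ?expR_gt0//.
have h1 := hD _ dx; rewrite expr1 in h1.
have h2 : C * D <= e * (1 + (r - l) * `|x|).
  move: hx; rewrite ler_pdivrMr// ler_pdivrMr// => h.
  by apply: le_trans h _; rewrite mulrC ler_wpM2l ?(ltW e0)// mulrC lerDr.
have Dp : 0 < D.
  rewrite lt0r D0 andbT; apply: contraTneq (hD 0 (lexx _)) => ->.
  by rewrite mul0r addr0 expr1 -ltNge.
rewrite -(ler_pM2r Dp); apply: le_trans h2 _.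
rewrite -[leRHS]mulrA; apply: ler_wpM2l; first exact: ltW.
by rewrite (mulrC _ D).
Qed.

End DerivativeDecay.

(** * The convolution formula for [eta] and the final limits *)

Section Conclusion.
Variable R : realType.
Local Notation mu := (@lebesgue_measure R).
Variables (A B V1 V2 h w Phi lam : R -> R) (c Bw m : R).
Local Notation eta := (defect A B).
Local Notation deta := (deta A B V1 V2).
Local Notation src := (src A B V1 V2 h).
Hypothesis S : spectral A B V1 V2 h w Phi c Bw.
Hypothesis M0 : {ae mu, forall xi : R, 0 < xi ^+ 2 + 2 * w xi - c ^+ 2}.
Hypothesis hE : h =1 (fun x => (2 * pi)^-1 * H (fun xi => w xi * Phi xi) x).
Hypothesis lam_even : forall x, lam (- x) = lam x.
Hypothesis lamL1 : forall l, l < m -> L1 (fun x => expR (l * `|x|) * lam x).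
Hypothesis lamE : aeq (fun xi : R => (xi ^+ 2 + 2 * w xi - c ^+ 2)^-1) (H lam).
Hypothesis m0 : 0 < m.

Lemma L1_lam : L1 lam.
Proof. by apply: eq_L1 (lamL1 m0) => x; rewrite mul0r expR0 mul1r. Qed.

(** Evenness of [lam] reduces [H_conv] to a plain product, and
    [H src * H lam = (M_c Phi) / M_c = Phi]. Inversion identifies the convolution with [eta]. *)
Lemma defect_conv : aeq eta (conv src lam).
Proof.
have [sys _ _ _ _] := S; have Ls := L1_src sys; have Ll := L1_lam.
have LP := Phi_L1 S M0.
have Lc : L1 (conv src lam).
  by apply/Lw0; apply: Lw_conv; apply/Lw0.
have He : aeq (H (conv src lam)) Phi.
  apply: ae_imp3 (spectral_identity S) lamE M0 => x E1 E2 Mp.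
  have Hl : H lam (- x) = H lam x.
    by rewrite -(H_opp Ll); apply: eq_H => y; exact: lam_even.
  rewrite H_conv// Hl subrr mulr0 addr0 -E1 -E2; field.
  by rewrite gt_eqF.
have inv : aeq (conv src lam) (fun x => (2 * pi)^-1 * H Phi x).
  apply: (hartley_inversion (gauss_tempered_L1 Lc) LP) => s a s0.
  have Lg := L1_gwave a s0.
  rewrite (H_swap Lc Lg); apply: aeq_Int.
  - by apply: measurable_funM; exact: L1_meas.
  - by apply: measurable_funM; [exact: L1_meas|exact: H_meas].
  - by apply: ae_imp He => x ->; rewrite mulrC.
by apply: ae_imp inv => x ->; rewrite (inversion S M0).1.
Qed.

Lemma tame_defect : tame eta.
Proof. by move=> k; exact: (wiener_all S M0 hE k).1. Qed.

Lemma tame_potential : tame h.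
Proof. by move=> k; exact: (wiener_all S M0 hE k).2. Qed.

Lemma defect_decays l : 0 <= l -> l < m -> decays l eta.
Proof.
move=> l0 lm; have [sys _ _ _ _] := S.
have ch : continuous h := wiener_continuous (tame_potential 0%N).
have [d1 t1] := tame_deriv tame_defect; have [d2 t2] := tame_deriv t1.
have [d3 t3] := tame_deriv t2.
have E1 : derive1 eta = deta := deriv_derive1 (deriv_eta sys).
rewrite E1 in d1 t1 d2 t2 d3 t3.
have E2 := deriv_derive1 (deriv_deta sys ch).
have b2 := tame_bounded t2.
(* Vanishing passes from [eta] to [eta'] and from [eta'] to [eta'']; the second passage uses a bound
   on the third derivative. *)
have v2 : vanishes (derive1 deta).
  apply: (vanishes_deriv d2 d3 (tame_bounded t3)).
  exact: vanishes_deriv d1 d2 b2 (eta_vanishes sys).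
rewrite E2 in b2 v2.
have [_ _ _ [_ _ [C1 h1] [C2 h2]]] := sys.
have [Ce he] := bounded_eta sys; have [Ch hh] := tame_bounded tame_potential.
have bs : bounded src.
  exists (2 * (C1 ^+ 2 + C2 ^+ 2) + 2 * (Ce * Ch)) => x.
  apply: le_trans (ler_normD _ _) _; rewrite !normrM (ger0_norm (ler0n _ 2)).
  apply: lerD; apply: ler_wpM2l => //; last by apply: ler_pM.
  apply: le_trans (ler_normD _ _) _; rewrite !normrX.
  have C10 : 0 <= C1 := le_trans (normr_ge0 _) (h1 0).
  have C20 : 0 <= C2 := le_trans (normr_ge0 _) (h2 0).
  by apply: lerD; rewrite lerXn2r ?nnegrE.
have cs : continuous src.
  have ce := prim_continuous (prim_eta sys); have ck := prim_continuous (prim_kin sys).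
  have cM (k : R) (f : R -> R) : continuous f -> continuous (fun x => k * f x).
    by move=> cf y; apply: continuousM; [exact: cvg_cst|exact: cf].
  have ceh : continuous (fun x => eta x * h x).
    by move=> y; apply: continuousM; [exact: ce|exact: ch].
  change (continuous (fun x => 2 * kin V1 V2 x + 2 * (eta x * h x))).
  by move=> x; apply: cvgD; [exact: (cM 2 _ ck)|exact: (cM 2 _ ceh)].
exact: (convolution_absorb l0 (prim_continuous (prim_eta sys)) (bounded_eta sys) cs bs
  L1_lam (lamL1 lm) defect_conv (src_small sys ch b2 v2)).
Qed.

Lemma defect_limits l k : 0 <= l -> l < m ->
  expR (l * `|x|) * derive1n k eta x @[x --> +oo] --> (0 : R) /\
  expR (l * `|x|) * derive1n k eta x @[x --> -oo] --> (0 : R).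
Proof.
move=> l0 lm; have lr : l < (l + m) / 2 by lra.
have rm : (l + m) / 2 < m by lra.
apply: vanishes_cvg; apply: (decays_vanishes lr).
exact: decays_derive1n tame_defect defect_decays k _ (le_trans l0 (ltW lr)) rm.
Qed.

(** Each turn of the system gains one derivative, [h] having derivatives of every order. *)
Lemma profile_smooth : smoothR A /\ smoothR B.
Proof.
have [sys _ _ _ _] := S; have [[pA pB] [p1 p2] _ _] := sys.
have ch : continuous h := wiener_continuous (tame_potential 0%N).
have cA := prim_continuous pA; have cB := prim_continuous pB.
have c1 := prim_continuous p1; have c2 := prim_continuous p2.
have cM (f g : R -> R) : continuous f -> continuous g -> continuous (fun x => f x * g x).
  by move=> cf cg x; apply: continuousM; [exact: cf|exact: cg].
have cB' (f g : R -> R) : continuous f -> continuous g -> continuous (fun x => f x - g x).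
  by move=> cf cg x; apply: continuousB; [exact: cf|exact: cg].
have dA : has_deriv A V1 by move=> x; exact: prim_derive pA (c1 x).
have dB : has_deriv B V2 by move=> x; exact: prim_derive pB (c2 x).
have d1 : has_deriv V1 (fun x => c * V2 x - A x * h x).
  move=> x; apply: (prim_derive p1); apply: cB'; apply: cM => //; exact: cst_continuous.
have d2 : has_deriv V2 (fun x => - c * V1 x - B x * h x).
  move=> x; apply: (prim_derive p2); apply: cB'; apply: cM => //; exact: cst_continuous.
have D n : [/\ Dk n A, Dk n B, Dk n V1 & Dk n V2].
  elim: n => [//|n [DA DB D1 D2]]; have Dh := wiener_Dk (tame_potential n).
  split; [exact: Dk_deriv dA D1|exact: Dk_deriv dB D2
         |apply: Dk_deriv d1 _|apply: Dk_deriv d2 _].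
    by apply: DkB; [exact: DkZ|exact: DkM].
  by apply: DkB; [exact: DkZ|exact: DkM].
by split; apply/smoothRP => n; have [] := D n.
Qed.

End Conclusion.

(** The equation constrains [u] only up to null sets, so the derivatives and limits are those of its
    smooth representative [v]. *)
Theorem theorem1p4 (R : realType)
  (W : distribution_on_schwartz R) (What : R -> R[i])
  (W_tempered : tempered W) (W_real : real_valued_dist W) (W_even : even_dist W)
  (What_Loo : in_Lp +oo%E What)
  (WhatE : is_function (fourier_dist W) What)
  (c : R) (c_ge0 : 0 <= c)
  (u : R -> R[i]) (u_energy : energy_space u) (u_sol : solution W c u)
  (M_gt0 : {ae (@lebesgue_measure R), forall xi : R, 0 < Mc What c xi})
  (invM_tempered : defines_tempered (fun xi => (Mc What c xi)^-1))
  (L : distribution_on_schwartz R) (L_tempered : tempered L)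
  (LhatE : is_function (fourier_dist L) (fun xi => (Mc What c xi)^-1))
  (m : R) (m_gt0 : 0 < m) (p : \bar R) (p_gt1 : (1 < p)%E)
  (Lc : R -> R[i]) (LE : is_function L Lc)
  (L_decay : in_Lp p (fun x => (expR (m * `|x|))%:C * Lc x)) :
  exists v : R -> R[i],
    [/\ smooth v,
        {ae (@lebesgue_measure R), forall x : R, u x = v x} &
        forall l : R, 0 <= l -> l < m -> forall k : nat,
          expR (l * `|x|) * derive1n k (eta_of v) x @[x --> +oo] --> (0 : R) /\
          expR (l * `|x|) * derive1n k (eta_of v) x @[x --> -oo] --> (0 : R)].
Proof.
have [h [hconv eqn]] := u_sol.
have [Phi [tP Lh h0 X]] := convolution_data W_even What_Loo WhatE M_gt0 hconv.
have [_ [_ [_ _ _ [/in_L2[_ mh2 _ _] _ _]]]] := hconv.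
have [A [B [V1 [V2 [[eA eB] pAB pV L2s bd]]]]] := ode_data u_energy Lh mh2 h0 eqn.
have sys : travelling A B V1 V2 (re h) c.
  by have [? ? ?] := L2s; split=> //; split.
have [mw1 _ [Bw hB]] := in_Loo What_Loo.
have [_ /in_L2[me _ Le _] _] := u_energy.
have etaE (f : R -> R[i]) x : eta_of f x = 1 - re f x ^+ 2 - im f x ^+ 2.
  by rewrite /eta_of cabs_sq opprD addrA.
have ee : aeq (eta_of u) (defect A B).
  by apply: (ae_imp2 _ eA eB) => x ax bx; rewrite etaE ax bx.
have [_ _ [_ _ _ Ld] _] := sys.
have te : gauss_tempered (eta_of u) := gauss_tempered_sq me Le.
have td : gauss_tempered (defect A B) := gauss_tempered_sq Ld.1 Ld.2.
have S : spectral A B V1 V2 (re h) (re What) Phi c Bw.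
  split=> //; first by apply: ae_imp hB => x [].
  move=> P gP; have [-> ->] := X P gP; split=> //.
  apply: aeq_Int; [exact: L1_meas (gtest_H te gP)|exact: L1_meas (gtest_H td gP)|].
  by apply: ae_imp ee => x ->.
have M0 : {ae (@lebesgue_measure R), forall xi : R, 0 < xi ^+ 2 + 2 * re What xi - c ^+ 2}.
  by apply: ae_imp M_gt0 => xi /Mc_gt0[].
(* From here on [h] is the continuous representative given by inversion, for which the formula holds
   at every point by definition. *)
have S' := regular_potential S M0.
have KW l (lm : l < m) := kernel_weight p_gt1 L_decay lm LE.1.
have L0 (f : R -> R) : L1 (fun x => expR (0 * `|x|) * f x) -> L1 f.
  by apply: eq_L1 => x; rewrite mul0r expR0 mul1r.
have [/L0 Lre /L0 Lim] := KW 0 m_gt0.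
have reM : aeq (re (fun xi => (Mc What c xi)^-1))
    (fun xi => (xi ^+ 2 + 2 * re What xi - c ^+ 2)^-1).
  by apply: ae_imp M_gt0 => xi /Mc_gt0[_ _ E]; rewrite /re E inv_real.
have evM : aeq (re (fun xi => (Mc What c xi)^-1)) (fun xi => re (fun xi => (Mc What c xi)^-1) (- xi)).
  apply: (ae_imp3 _ reM (ae_opp reM) (symbol_even W_even WhatE)) => xi -> -> ->.
  by rewrite sqrrN.
(* The even part of the real part of the kernel, whose Hartley transform is [1 / M_c]; symmetrising
   preserves the exponential weights. *)
pose lam x := (re Lc x + re Lc (- x)) / 2.
have lam_even x : lam (- x) = lam x by rewrite /lam opprK addrC.
have lamL1 l : l < m -> L1 (fun x => expR (l * `|x|) * lam x).
  move=> lm; have [L1' _] := KW l lm; have [L2' _] := Int_opp L1'.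
  by apply: eq_L1 (L1Z 2^-1 (L1D L1' L2')) => x; rewrite normrN /lam; field.
have lamE : aeq (fun xi => (xi ^+ 2 + 2 * re What xi - c ^+ 2)^-1) (H lam).
  by apply: (ae_imp2 _ reM (kernel_data LhatE LE Lre Lim evM)) => xi <- ->.
have [sA sB] := profile_smooth S' M0 (fun=> erefl).
exists (fun x => A x +i* B x); split.
- by move=> k x; split; [exact: sA|exact: sB].
- apply: (ae_imp2 _ eA eB) => x; rewrite /re /im; case: (u x) => a b /= -> ->.
  by [].
move=> l l0 lm k.
have -> : eta_of (fun x => A x +i* B x) = defect A B.
  by apply/funext => x; rewrite etaE.
exact: (defect_limits S' M0 (fun=> erefl) lam_even lamL1 lamE m_gt0 k l0 lm).
Qed.
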